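(* For $s\ge t\ge 0$, $z\ge 0$ and $\mathbf j=(j,\tilde j)\in E$, $$\bar p_{\mathbf j}(t,s,z)=\sum_{n\in\mathbb N_0}1_{[T_n,T_{n+1})}(t)\,\tilde p_{\mathbf j}(t,s,z;S_n),$$ where for a realization $s_n=(0,1,t_1,y_1,\ldots,t_n,y_n)$ with $t_n\le t$, $\tilde p_{\mathbf j}(t,s,z;s_n)=0$ if $t_n\ge s-z$, and if $t_n<s-z$, $$\tilde p_{\mathbf j}(t,s,z;s_n)=\frac{\alpha(s_n)\prod_{t_n}^{t}\big(I+M_{y_ny_n}(x)\,dx\big)E_{y_n}'}{\alpha(s_n)\prod_{t_n}^{t}\big(I+M_{y_ny_n}(x)\,dx\big)\mathbf 1_{d_{y_n}}}\prod_{t}^{(s-z)\vee t}\big(I+M(x)\,dx\big)E_j\prod_{(s-z)\vee t}^{s}\big(I+M_{jj}(x)\,dx\big)e_{\tilde j}.$$ In particular, when $t_n<s-z\le t$ this reduces to $$\tilde p_{\mathbf j}(t,s,z;s_n)=1_{(y_n=j)}\frac{\alpha(s_n)\prod_{t_n}^{s}\big(I+M_{y_ny_n}(x)\,dx\big)e_{\tilde j}}{\alpha(s_n)\prod_{t_n}^{t}\big(I+M_{y_ny_n}(x)\,dx\big)\mathbf 1_{d_{y_n}}}.$$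
   Context: Product integral: for a square matrix function $A$, $\prod_t^s(I+A(x)\,dx)$ denotes the solution $F(t,s)$ of $\partial_s F(t,s)=F(t,s)A(s)$, $F(t,t)=I$. $\mathbf 1_d$ is the $d$-dimensional column vector of ones; primes denote transposition. Aggregate Markov model: macrostates $\mathcal J=\{1,\ldots,J\}$, each $j$ with $d_j\ge1$ microstates; state space $E=\{(j,\tilde j): j\in\mathcal J,\tilde j\in\{1,\dots,d_j\}\}$, ordered lexicographically, $\bar d=\sum_jd_j$. $X=(X_1,X_2)$ is a time-inhomogeneous Markov jump process on $E$ with (suitably regular) $\bar d\times\bar d$ transition intensity matrix function $M(t)$ in block form with $d_j\times d_k$ blocks $M_{jk}(t)$; $M_{jj}$ sub-intensity, $M_{jk}\ge0$ for $j\ne k$. Initial distribution $(\pi_1(0),\mathbf 0)$, so $X_1(0)=1$; the macrostate process is $Z=X_1$ with natural filtration $\mathbb F^Z=(\mathcal F^Z(t))_t$. $T_n$ are the jump times of $Z$ ($T_0=0$), $Y_n=Z(T_n)$, $S_n=(T_0,Y_0,\ldots,T_n,Y_n)$. For a realization $s_n$, $\alpha(s_n)=\pi_1(0)\prod_{\ell=0}^{n-1}\prod_{t_\ell}^{t_{\ell+1}}(I+M_{y_\ell y_\ell}(x)\,dx)M_{y_\ell y_{\ell+1}}(t_{\ell+1})$ ($t_0=0,y_0=1$). Duration process: $U(t)=\sup\{s\in[0,t]: Z(v)=Z(t)\ \forall v\in[t-s,t]\}$. $\bar p_{\mathbf j}(t,s,z)=\mathbb P(X(s)=\mathbf j,\,U(s)>z\mid\mathcal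 F^Z(t))$. $e_{\tilde j}$ is the $d_j$-dimensional unit column vector with a one in entry $\tilde j$; $E_j$ is the $\bar d\times d_j$ matrix whose $j$-th block row (rows $d_1+\dots+d_{j-1}+1,\ldots,d_1+\dots+d_j$) is the $d_j\times d_j$ identity and whose other entries are zero. *)

(* Defs.v *)
From HB Require Import structures.
From mathcomp Require Import all_boot all_order all_algebra.
From mathcomp Require Import all_classical all_reals all_analysis.
From Stdlib Require Import ClassicalEpsilon.
Set Implicit Arguments. Unset Strict Implicit. Unset Printing Implicit Defensive.
Import Order.TTheory GRing.Theory Num.Theory.
Import numFieldNormedType.Exports.
Local Open Scope ring_scope.
Local Open Scope classical_set_scope.

(* Product integral  prod_t^s (I + A(x) dx) := F(s), where F is the solution of
   dF/ds = F(s) A(s), F(t) = I (entrywise derivatives). For continuous A this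
   solution exists and is unique, so the choice below is the solution. *)
Definition prodint {R : realType} {n : nat} (A : R -> 'M[R]_n) (t s : R) : 'M[R]_n :=
  epsilon (inhabits (fun _ : R => (1%:M : 'M[R]_n)))
    (fun F : R -> 'M[R]_n => F t = 1%:M /\
       forall (x : R) (i k : 'I_n),
         is_derive x 1 (fun y => F y i k) ((F x *m A x) i k)) s.

(* Macrostates are 'I_J.+1 (so J.+1 >= 1 macrostates); macrostate "1" is ord0.
   d j = number of microstates of macrostate j. *)
Definition dbar (J : nat) (d : 'I_J.+1 -> nat) : nat := (\sum_(j < J.+1) d j)%N.

(* offset d_1 + ... + d_{j-1} of block j in the lexicographic order *)
Definition off (J : nat) (d : 'I_J.+1 -> nat) (j : 'I_J.+1) : nat :=
  (\sum_(i < J.+1 | (i < j)%N) d i)%N.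

Definition state (J : nat) (d : 'I_J.+1 -> nat) := {j : 'I_J.+1 & 'I_(d j)}.

Definition Emx (R : realType) (J : nat) (d : 'I_J.+1 -> nat) (j : 'I_J.+1)
  : 'M[R]_(dbar d, d j) :=
  \matrix_(k < dbar d, l < d j) ((k : nat) == (off d j + l)%N)%:R.

Definition etil (R : realType) (J : nat) (d : 'I_J.+1 -> nat) (e : state d)
  : 'cV[R]_(d (tag e)) := \col_(l < d (tag e)) (l == tagged e)%:R.

Definition ev (R : realType) (J : nat) (d : 'I_J.+1 -> nat) (e : state d)
  : 'cV[R]_(dbar d) :=
  \col_(k < dbar d) ((k : nat) == (off d (tag e) + tagged e)%N)%:R.

Definition blkf (R : realType) (J : nat) (d : 'I_J.+1 -> nat)
  (M : R -> 'M[R]_(dbar d)) (j k : 'I_J.+1) : R -> 'M[R]_(d j, d k) :=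
  fun x => (Emx R d j)^T *m M x *m Emx R d k.

(* alpha(s_n), carried as a dbar-row vector supported on the block of the last
   visited macrostate (alpha_bar s_n = alpha(s_n) E_{y_n}'). *)
Fixpoint alpha_ext (R : realType) (J : nat) (d : 'I_J.+1 -> nat)
  (M : R -> 'M[R]_(dbar d)) (v : 'rV[R]_(dbar d)) (p : R * 'I_J.+1)
  (l : seq (R * 'I_J.+1)) : 'rV[R]_(dbar d) :=
  match l with
  | [::] => v
  | q :: l' =>
      alpha_ext M (v *m Emx R d p.2 *m prodint (blkf M p.2 p.2) p.1 q.1
                     *m blkf M p.2 q.2 q.1 *m (Emx R d q.2)^T) q l'
  end.

Definition alpha_bar (R : realType) (J : nat) (d : 'I_J.+1 -> nat)
  (M : R -> 'M[R]_(dbar d)) (pi1 : 'rV[R]_(d ord0)) (sn : seq (R * 'I_J.+1))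
  : 'rV[R]_(dbar d) :=
  match sn with
  | [::] => pi1 *m (Emx R d ord0)^T
  | p :: l => alpha_ext M (pi1 *m (Emx R d ord0)^T) p l
  end.

(* alpha(s_n) in R^{d_{y_n}}; s_n = [:: (0,1); (t_1,y_1); ...; (t_n,y_n)] *)
Definition alpha (R : realType) (J : nat) (d : 'I_J.+1 -> nat)
  (M : R -> 'M[R]_(dbar d)) (pi1 : 'rV[R]_(d ord0)) (sn : seq (R * 'I_J.+1))
  : 'rV[R]_(d (last (0, ord0) sn).2) :=
  alpha_bar M pi1 sn *m Emx R d (last (0, ord0) sn).2.

Definition ptilde (R : realType) (J : nat) (d : 'I_J.+1 -> nat)
  (M : R -> 'M[R]_(dbar d)) (pi1 : 'rV[R]_(d ord0)) (t s z : R)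
  (sn : seq (R * 'I_J.+1)) (je : state d) : R :=
  let tn := (last (0, ord0) sn).1 in
  let yn := (last (0, ord0) sn).2 in
  if s - z <= tn then 0 else
  let A := alpha M pi1 sn *m prodint (blkf M yn yn) tn t in
  ((A *m (Emx R d yn)^T *m prodint M t (Num.max (s - z) t) *m Emx R d (tag je)
      *m prodint (blkf M (tag je) (tag je)) (Num.max (s - z) t) s *m etil R je)
     ord0 ord0)
  / ((A *m (const_mx 1 : 'cV[R]_(d yn))) ord0 ord0).

Section process.
Context {R : realType} {dsp : measure_display} {Omega : measurableType dsp}
  {J : nat} {d : 'I_J.+1 -> nat}.

Definition Zp (X : R -> Omega -> state d) (v : R) (w : Omega) : 'I_J.+1 :=
  tag (X v w).

Definition isjump (X : R -> Omega -> state d) (w : Omega) (u : R) : Prop :=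
  0 < u /\ forall e, 0 < e -> exists v, u - e < v < u /\ Zp X v w != Zp X u w.

(* jump times T_n of Z (T_0 = 0; +oo when there are fewer than n jumps) *)
Fixpoint jumpT (X : R -> Omega -> state d) (w : Omega) (n : nat) : \bar R :=
  match n with
  | O => 0%:E
  | n'.+1 => ereal_inf [set u%:E | u in [set u | isjump X w u /\
                                                (jumpT X w n' < u%:E)%E]]
  end.

Definition Shist (X : R -> Omega -> state d) (w : Omega) (n : nat)
  : seq (R * 'I_J.+1) :=
  [seq (fine (jumpT X w k), Zp X (fine (jumpT X w k)) w) | k <- iota 0 n.+1].

Definition Udur (X : R -> Omega -> state d) (t : R) (w : Omega) : R :=
  sup [set r : R | 0 <= r <= t /\
         forall v, t - r <= v <= t -> Zp X v w = Zp X t w].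

Definition FZ (X : R -> Omega -> state d) (t : R) : set (set Omega) :=
  <<s [set A | exists v k, 0 <= v <= t /\ A = [set w | Zp X v w = k]] >>.

Definition is_cond_prob (P : probability Omega R) (G : set (set Omega))
  (A : set Omega) (Y : Omega -> R) : Prop :=
  (forall B : set R, measurable B -> G (Y @^-1` B)) /\
  (forall B, G B -> P (A `&` B) = (\int[P]_(w in B) (Y w)%:E)%E).

Definition is_markov_jump (P : probability Omega R) (M : R -> 'M[R]_(dbar d))
  (pi1 : 'rV[R]_(d ord0)) (X : R -> Omega -> state d) : Prop :=
  [/\ (forall t e, 0 <= t -> measurable [set w | X t w = e]),
      (forall w t, 0 <= t ->
         (exists2 eps, 0 < eps & forall v, t <= v < t + eps -> X v w = X t w) /\
         (0 < t -> exists2 eps, 0 < eps &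
            exists e, forall v, t - eps < v < t -> X v w = e)) &
      (forall (n : nat) (u : nat -> R) (e : nat -> state d),
         u 0%N = 0 -> (forall k, (k < n)%N -> u k <= u k.+1) ->
         P (\bigcap_(k in [set k | (k <= n)%N]) [set w | X (u k) w = e k]) =
         (((pi1 *m (Emx R d ord0)^T *m ev R (e 0%N)) ord0 ord0) *
          \prod_(k < n) (((ev R (e k))^T *m prodint M (u k) (u k.+1)
                            *m ev R (e k.+1)) ord0 ord0))%:E)].

End process.

(* Main.v *)
Require Import Defs.
From HB Require Import structures.
From mathcomp Require Import all_boot all_order all_algebra.
From mathcomp Require Import all_classical all_reals all_analysis.
From mathcomp Require Import measurable_realfun ring lra.
Set Implicit Arguments. Unset Strict Implicit. Unset Printing Implicit Defensive.
Import Order.TTheory GRing.Theory Num.Theory.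
Import numFieldNormedType.Exports.
Local Open Scope ring_scope.
Local Open Scope classical_set_scope.

(* Idea: the macrostate path Z on [0, t] is observed on the dyadic grid of mesh t / 2^m.
   Given such an observation, the conditional probability of the event is a ratio of
   products of transition matrices restricted to the observed blocks.  Multiplied by 2^m
   for every observed jump, numerator and denominator converge along each path: stretches
   without jumps give product integrals of the diagonal blocks M_jj, and each jump at T_k
   gives t * M_jk(T_k), so the ratio tends to ptilde evaluated at the history of Z.  These
   ratios are bounded by 1, hence dominated convergence identifies the integral of the
   limit over every grid event, and a pi-lambda argument extends this to the whole of
   F^Z(t).  The path space weights 2^(-m * number of jumps) have total mass bounded
   uniformly in m, so paths with a vanishing limit denominator do not contribute.  When
   s - z <= t, the duration at s exceeds z iff no jump occurs in (t, s] and the last jump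
   up to t precedes s - z, and the latter is an event of F^Z(t). *)

(** * Matrix-valued differential equations and product integrals *)

(** The process enters only through its finite-dimensional laws and its piecewise constant paths, so
    events in continuous time are first reduced to countably many grid events. [prodint] is a choice
    of a solution on the whole line, so its use rests on global existence, together with uniqueness
    forward in time. The main obstacle is that a given jump history has probability zero: each jump
    makes the probability of the observed grid path smaller by an order of 2^-m, and even the
    rescaled limit may vanish. Hence the denominator is replaced by itself plus e > 0. The
    regularized ratio converges along every path, and its error on a grid path is at most e times
    the weight of that path. The total weight is at most (J+1) exp J, because a path amounts to an
    initial value and 2^m increments, each of them zero with weight 1 or one of J others with weight
    2^-m. Scaling by 2^m instead of the inverse mesh 2^m / t keeps t = 0 admissible. The price is a
    factor t^n common to numerator and denominator, which is nonzero since a jump up to t forces t >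
    0. *)

Section MatrixNorm.
Variable R : realType.

(** The sum of the absolute entries is submultiplicative across all rectangular shapes, which the
    largest absolute entry is not. *)
Definition nrm m n (A : 'M[R]_(m, n)) : R := \sum_i \sum_j `|A i j|.

Lemma nrm_ge0 m n (A : 'M[R]_(m, n)) : 0 <= nrm A.
Proof. by apply: sumr_ge0 => i _; apply: sumr_ge0. Qed.

Lemma ler_entry_nrm m n (A : 'M[R]_(m, n)) i j : `|A i j| <= nrm A.
Proof.
rewrite /nrm (bigD1 i)//= (bigD1 j)//= -addrA lerDl addr_ge0//.
  exact: sumr_ge0.
by apply: sumr_ge0 => k _; apply: sumr_ge0.
Qed.

Lemma ler_nrmD m n (A B : 'M[R]_(m, n)) : nrm (A + B) <= nrm A + nrm B.
Proof.
rewrite /nrm -big_split/=; apply: ler_sum => i _.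
rewrite -big_split/=; apply: ler_sum => j _.
by rewrite mxE ler_normD.
Qed.

Lemma nrmN m n (A : 'M[R]_(m, n)) : nrm (- A) = nrm A.
Proof.
by apply: eq_bigr => i _; apply: eq_bigr => j _; rewrite mxE normrN.
Qed.

Lemma nrm0 m n : nrm (0 : 'M[R]_(m, n)) = 0.
Proof. by apply: big1 => i _; apply: big1 => j _; rewrite mxE normr0. Qed.

Lemma nrmZ m n a (A : 'M[R]_(m, n)) : nrm (a *: A) = `|a| * nrm A.
Proof.
rewrite /nrm mulr_sumr; apply: eq_bigr => i _.
by rewrite mulr_sumr; apply: eq_bigr => j _; rewrite mxE normrM.
Qed.

Lemma ler_nrmM m n p (A : 'M[R]_(m, n)) (B : 'M[R]_(n, p)) :
  nrm (A *m B) <= nrm A * nrm B.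
Proof.
rewrite /nrm mulr_suml; apply: ler_sum => i _.
apply: (@le_trans _ _ (\sum_j \sum_k `|A i k| * `|B k j|)).
  apply: ler_sum => j _; rewrite mxE (le_trans (ler_norm_sum _ _ _))//.
  by under eq_bigr do rewrite normrM.
rewrite exchange_big/= mulr_suml; apply: ler_sum => k _.
rewrite -mulr_sumr ler_wpM2l//.
rewrite [leRHS](bigD1 k)//= lerDl.
by apply: sumr_ge0 => l _; apply: sumr_ge0.
Qed.

Lemma nrm_le_entries m n (A : 'M[R]_(m, n)) e :
  (forall i j, `|A i j| <= e) -> nrm A <= (m * n)%:R * e.
Proof.
move=> h; apply: (@le_trans _ _ (\sum_(i < m) \sum_(j < n) e)).
  by apply: ler_sum => i _; apply: ler_sum => j _.
by rewrite !sumr_const !card_ord -mulrnA mulr_natl mulnC.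
Qed.

Lemma ler_nrmB m n (A B C : 'M[R]_(m, n)) : nrm (A - C) <= nrm (A - B) + nrm (B - C).
Proof. by rewrite (le_trans _ (ler_nrmD _ _))// addrA subrK. Qed.

End MatrixNorm.

Section RealLemmas.
Variable R : realType.
Implicit Types (f g : R -> R) (a b c e l t x L T : R).

Lemma is_derive_continuous f (f1 : R -> R) :
  (forall x, is_derive x 1 f (f1 x)) -> continuous f.
Proof.
by move=> df x; apply/differentiable_continuous/derivable1_diffP.
Qed.

Lemma continuous_bounded_cc f a b : continuous f ->
  exists2 K, 0 <= K & forall x, a <= x <= b -> `|f x| <= K.
Proof.
move=> cf; have [ab|ba] := leP a b; last first.
  by exists 0 => // x /andP[ax xb]; have := le_lt_trans (le_trans ax xb) ba; rewrite ltxx.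
have cg : {within `[a, b], continuous (fun x => `|f x|)}.
  apply: continuous_subspaceT => x.
  by apply: continuous_comp; [exact: cf|exact: norm_continuous].
have [c _ hc] := EVT_max ab cg.
by exists `|f c| => // x xab; apply: hc; rewrite in_itv.
Qed.

Lemma le_of_deriv_le f g (f1 g1 : R -> R) a b : a <= b ->
  (forall x, is_derive x 1 f (f1 x)) -> (forall x, is_derive x 1 g (g1 x)) ->
  (forall x, a <= x <= b -> f1 x <= g1 x) -> f b - f a <= g b - g a.
Proof.
move=> ab df dg h.
have dh x : is_derive x 1 (g - f) (g1 x - f1 x) by exact: is_deriveB.
have [|c cab E] := MVT_segment ab (fun x _ => dh x).
  by apply: continuous_subspaceT; exact: is_derive_continuous dh.
have : 0 <= (g - f) b - (g - f) a.
  rewrite E mulr_ge0 ?subr_ge0//; apply: h.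
  by move: cab; rewrite in_itv.
by rewrite !fctE; lra.
Qed.

Lemma deriv_bound f (f1 : R -> R) a b c e : a <= b ->
  (forall x, is_derive x 1 f (f1 x)) ->
  (forall x, a <= x <= b -> `|f1 x - c| <= e) ->
  `|f b - f a - (b - a) * c| <= (b - a) * e.
Proof.
move=> ab df h.
have [|x xab ->] := MVT_segment ab (fun x _ => df x).
  by apply: continuous_subspaceT; exact: is_derive_continuous df.
rewrite [_ * (b - a)]mulrC -mulrBr normrM (ger0_norm (_ : 0 <= b - a)) ?subr_ge0//.
by rewrite ler_wpM2l ?subr_ge0// h//; move: xab; rewrite in_itv.
Qed.

Lemma is_derive_reflect f (f1 : R -> R) t : (forall x, is_derive x 1 f (f1 x)) ->
  forall x, is_derive x 1 (fun y => f (2 * t - y)) (- f1 (2 * t - x)).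
Proof.
move=> df x.
have dg : is_derive x 1 ((fun=> 2 * t) - id : R -> R) (0 - 1).
  exact: is_deriveB.
have := @is_derive1_comp R f _ x _ _ (df (2 * t - x)) dg.
by rewrite sub0r mulrN1.
Qed.

Lemma is_derive_expRM (l t x : R) :
  is_derive x 1 (fun y => expR (l * (y - t))) (l * expR (l * (x - t))).
Proof.
have dg : is_derive x 1 (l *: (id - (fun=> t)) : R -> R) (l *: (1 - 0)).
  by apply: is_deriveZ; apply: is_deriveB.
have := @is_derive1_comp R expR _ x _ _ (is_derive_expR (l * (x - t))) dg.
by rewrite subr0 /GRing.scale/= mulr1 mulrC.
Qed.

(** Integration gains a factor 1/l against the weight [expR (l * |x - t|)]; this makes the Picard
    map contract for large l. To the right of t the function is compared with the primitive of the
    bound; the left side is reflected through t. *)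
Lemma deriv_expR_bound f (f1 : R -> R) t T l L : 0 < l -> 0 <= L ->
  (forall x, is_derive x 1 f (f1 x)) -> f t = 0 ->
  (forall x, `|x - t| <= T -> `|f1 x| <= L * expR (l * `|x - t|)) ->
  forall x, `|x - t| <= T -> `|f x| <= L / l * expR (l * `|x - t|).
Proof.
move=> l0 L0.
have half g (g1 : R -> R) : (forall x, is_derive x 1 g (g1 x)) -> g t = 0 ->
  (forall x, t <= x <= t + T -> g1 x <= L * expR (l * (x - t))) ->
  forall x, t <= x <= t + T -> g x <= L / l * expR (l * (x - t)).
  move=> dg gt0 h x /andP[tx xT].
  pose G := (L / l) *: (fun y => expR (l * (y - t))) : R -> R.
  have dG (y : R) : is_derive y 1 G (L * expR (l * (y - t))).
    have -> : L * expR (l * (y - t)) = (L / l) *: (l * expR (l * (y - t))).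
      by rewrite /GRing.scale/= mulrA divfK// gt_eqF.
    by apply: is_deriveZ; exact: is_derive_expRM.
  have := @le_of_deriv_le g G g1 _ t x tx dg dG.
  rewrite gt0 subr0 => hh; apply: le_trans (hh _) _.
    by move=> y /andP[ty yx]; apply: h; rewrite ty (le_trans yx).
  by rewrite /G !fctE /GRing.scale/= gerBl mulr_ge0 ?expR_ge0// divr_ge0// ltW.
have both g (g1 : R -> R) : (forall x, is_derive x 1 g (g1 x)) -> g t = 0 ->
  (forall x, t <= x <= t + T -> `|g1 x| <= L * expR (l * (x - t))) ->
  forall x, t <= x <= t + T -> `|g x| <= L / l * expR (l * (x - t)).
  move=> dg gt0 h x xT; rewrite ler_norml; apply/andP; split.
    have dN (y : R) : is_derive y 1 (- g) (- g1 y) by exact: is_deriveN.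
    have Nt : (- g) t = 0 by rewrite -[LHS]/(- g t) gt0 oppr0.
    rewrite lerNl; apply: (half (- g) (fun x => - g1 x) dN Nt) xT.
    by move=> y yT; apply: le_trans (h y yT); rewrite ler_normr lexx orbT.
  apply: (half g g1) xT => // y yT.
  by apply: le_trans (h y yT); rewrite ler_normr lexx.
move=> df ft h x; have [tx|/ltW xt] := leP t x.
  have E y : t <= y -> `|y - t| = y - t by move=> ty; rewrite ger0_norm ?subr_ge0.
  rewrite E// => xT; apply: (both f f1) => //; last by rewrite tx -lerBlDl.
  move=> y /andP[ty yT]; rewrite -E//; apply: h.
  by rewrite E// lerBlDl.
have E y : y <= t -> `|y - t| = t - y by move=> ty; rewrite distrC ger0_norm ?subr_ge0.
rewrite E// => xT.
have -> : f x = f (2 * t - (2 * t - x)) by congr f; ring.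
have -> : t - x = (2 * t - x) - t by ring.
apply: (both (fun y => f (2 * t - y)) _ (is_derive_reflect t df)); last first.
- by apply/andP; split; lra.
- move=> y /andP[ty yT]; rewrite normrN.
  have -> : y - t = t - (2 * t - y) by ring.
  by rewrite -E ?h ?E//; lra.
- by rewrite -[RHS]ft; congr f; ring.
Qed.

Notation mu := (@lebesgue_measure R).

Lemma continuous_integrable_cc f a b : continuous f ->
  mu.-integrable `[a, b] (EFin \o f).
Proof.
move=> cf; apply: continuous_compact_integrable; first exact: segment_compact.
exact: continuous_subspaceT.
Qed.

Lemma primitive_ray f a t : continuous f -> a < t ->
  exists2 G : R -> R, G t = 0 & forall x, a < x -> is_derive x 1 G (f x).
Proof.
move=> cf at_.
pose F x := (\int[mu]_(y in `[a, x]) f y)%R.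
have dF x : a < x -> is_derive x 1 F (f x).
  move=> ax; have xu : x < x + 1 by rewrite ltrDl.
  have [d1 d2] := continuous_FTC1_closed xu (continuous_integrable_cc _ _ cf) ax (cf x).
  rewrite -d2 derive1E; exact: derivableP d1.
exists (F - cst (F t)); first by rewrite !fctE subrr.
move=> x ax; rewrite -[f x]subr0; apply: is_deriveB; exact: dF.
Qed.

Lemma deriv_eq_cst f (f1 : R -> R) a b : a <= b ->
  (forall x, a <= x <= b -> is_derive x 1 f (f1 x)) ->
  (forall x, a <= x <= b -> f1 x = 0) -> f b = f a.
Proof.
move=> ab df h.
have [||c] := @MVT_segment R f f1 a b ab.
- by move=> x; rewrite in_itv/= => /andP[/ltW ax /ltW xb]; apply: df; rewrite ax.
- apply: derivable_within_continuous => x; rewrite in_itv/= => /df dx.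
  by apply: ex_derive.
- by rewrite in_itv/= => /h -> /eqP; rewrite mul0r subr_eq0 => /eqP.
Qed.

(** An integral started at a is a primitive only to the right of a, while [prodint] asks for
    derivatives on the whole line. Primitives started at t - n.+1 and normalized to vanish at t
    agree wherever both are valid, so they glue. *)
Lemma ex_primitive f t : continuous f ->
  exists2 G : R -> R, G t = 0 & forall x, is_derive x 1 G (f x).
Proof.
move=> cf.
have /choice[G hG] (n : nat) : exists G : R -> R,
    G t = 0 /\ forall x, t - n.+1%:R < x -> is_derive x 1 G (f x).
  have [|G h1 h2] := @primitive_ray f (t - n.+1%:R) t cf.
    by rewrite gtrBl.
  by exists G.
have GE n m x : t - n.+1%:R < x -> t - m.+1%:R < x -> G n x = G m x.
  move=> nx mx.
  have n0 : t - n.+1%:R < t by rewrite gtrBl.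
  have m0 : t - m.+1%:R < t by rewrite gtrBl.
  have dB y : t - n.+1%:R < y -> t - m.+1%:R < y ->
      is_derive y 1 (G n - G m) (f y - f y).
    by move=> ny my; apply: is_deriveB; [apply: (hG n).2|apply: (hG m).2].
  have : (G n - G m) x = 0.
    have <- : (G n - G m) t = 0 by rewrite !fctE (hG n).1 (hG m).1 subrr.
    have [tx|/ltW xt] := leP t x.
      apply: (@deriv_eq_cst _ (fun y => f y - f y) t x) => // y.
        move=> /andP[ty yx]; apply: dB; [exact: lt_le_trans n0 ty|exact: lt_le_trans m0 ty].
      by rewrite subrr.
    apply/esym; apply: (@deriv_eq_cst _ (fun y => f y - f y) x t) => // y.
      move=> /andP[xy yt]; apply: dB; [exact: lt_le_trans nx xy|exact: lt_le_trans mx xy].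
    by rewrite subrr.
  by rewrite !fctE => /eqP; rewrite subr_eq0 => /eqP.
(* An index whose starting point t - (N x).+1 lies to the left of x. *)
pose N x := Num.truncn `|x - t|.
have Nx x : t - (N x).+1%:R < x.
  have /andP[_] := truncn_itv (normr_ge0 (x - t)).
  rewrite -/(N x) => h; rewrite ltrBlDr -ltrBlDl.
  by apply: le_lt_trans h; rewrite distrC ler_norm.
exists (fun x => G (N x) x); first exact: (hG _).1.
move=> x; have [D E] := (hG (N x)).2 x (Nx x).
apply: near_eq_is_derive (DeriveDef D E).
near=> y; apply: GE => //; near: y.
exact: lt_nbhsr.
Unshelve. all: by end_near. Qed.

End RealLemmas.

Section MatrixFunctions.
Variable R : realType.

Lemma continuous_bigsum (I : Type) (r : seq I) (f : I -> R -> R) :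
  (forall i, continuous (f i)) -> continuous (fun x => \sum_(i <- r) f i x).
Proof.
move=> cf; elim: r => [|i r IH] x.
  rewrite (_ : (fun x => _) = fun=> 0); first exact: cvg_cst.
  by apply/funext => y; rewrite big_nil.
rewrite (_ : (fun x => _) = fun x => f i x + \sum_(j <- r) f j x).
  by apply: cvgD; [exact: cf|exact: IH].
by apply/funext => y; rewrite big_cons.
Qed.

Definition mxcont m n (A : R -> 'M[R]_(m, n)) :=
  forall i k, continuous (fun x => A x i k).

Lemma mxcont_cst m n (C : 'M[R]_(m, n)) : mxcont (fun=> C).
Proof. by move=> i k x; exact: cvg_cst. Qed.

Lemma mxcontD m n (A B : R -> 'M[R]_(m, n)) :
  mxcont A -> mxcont B -> mxcont (fun x => A x + B x).
Proof.
move=> cA cB i k.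
rewrite (_ : (fun x => _) = fun x => A x i k + B x i k).
  by move=> x; apply: cvgD; [exact: cA|exact: cB].
by apply/funext => x; rewrite mxE.
Qed.

Lemma mxcontN m n (A : R -> 'M[R]_(m, n)) : mxcont A -> mxcont (fun x => - A x).
Proof.
move=> cA i k.
rewrite (_ : (fun x => _) = fun x => - A x i k).
  by move=> x; apply: cvgN; exact: cA.
by apply/funext => x; rewrite mxE.
Qed.

Lemma mxcontM m n p (A : R -> 'M[R]_(m, n)) (B : R -> 'M[R]_(n, p)) :
  mxcont A -> mxcont B -> mxcont (fun x => A x *m B x).
Proof.
move=> cA cB i k.
rewrite (_ : (fun x => _) = fun x => \sum_j A x i j * B x j k).
  by apply: continuous_bigsum => j x; apply: cvgM; [exact: cA|exact: cB].
by apply/funext => x; rewrite mxE.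
Qed.

Lemma mxcont_nrm m n (A : R -> 'M[R]_(m, n)) : mxcont A -> continuous (fun x => nrm (A x)).
Proof.
move=> cA; apply: continuous_bigsum => i; apply: continuous_bigsum => k x.
by apply: continuous_comp; [exact: cA|exact: norm_continuous].
Qed.

Lemma mxcont_bounded m n (A : R -> 'M[R]_(m, n)) (a b : R) : mxcont A ->
  exists2 K : R, 0 <= K & forall x, a <= x <= b -> nrm (A x) <= K.
Proof.
move=> /mxcont_nrm/continuous_bounded_cc => /(_ a b)[K K0 h].
by exists K => // x /h; rewrite ger0_norm ?nrm_ge0.
Qed.

Lemma mxcont_near m n (A : R -> 'M[R]_(m, n)) (x e : R) : mxcont A -> 0 < e ->
  exists2 del : R, 0 < del & forall y, `|x - y| < del -> nrm (A x - A y) <= e.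
Proof.
move=> cA e0.
have c : continuous (fun y => nrm (A x - A y)).
  by apply: mxcont_nrm; apply: mxcontD; [exact: mxcont_cst|exact: mxcontN].
have /cvgrPdist_le/(_ _ e0)/nbhs_ballP[r /= r0 hr] := c x.
exists r => // y /hr; rewrite subrr nrm0 sub0r normrN ger0_norm//.
exact: nrm_ge0.
Qed.

(** Heine's theorem, from compactness of the segment in its near-covering form; half of e goes to
    each leg of the triangle through the centre x. *)
Lemma mxcont_unif m n (A : R -> 'M[R]_(m, n)) (a b e : R) : mxcont A -> 0 < e ->
  exists2 del : R, 0 < del & forall x y, a <= x <= b -> `|x - y| <= del ->
    nrm (A x - A y) <= e.
Proof.
move=> cA e0.
pose Q del x := forall y, `|x - y| <= del -> nrm (A x - A y) <= e.
have h0 x : `[a, b]%classic x -> \forall x' \near x & del \near 0^'+, Q del x'.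
  move=> xab.
  have e20 : 0 < e / 2 by rewrite divr_gt0.
  have [r r0 hr] := mxcont_near x cA e20.
  exists (ball x (r / 2), [set del | 0 < del < r / 2]) => /=.
    split; first by apply: nbhsx_ballx; rewrite divr_gt0.
    near=> del => /=; apply/andP; split; near: del; first exact: nbhs_right_gt.
    by apply: nbhs_right_lt; rewrite divr_gt0.
  move=> [x' del] /= [xx' /andP[del0 delr]] y yx'.
  rewrite /ball/= in xx'.
  rewrite (le_trans (ler_nrmB _ (A x) _))// [leRHS](splitr e) lerD//.
    by rewrite -nrmN opprB hr// (lt_trans xx')// gtr_pMr// invf_lt1// ltr1n.
  apply: hr; have -> : x - y = (x - x') + (x' - y) by rewrite addrA subrK.
  rewrite (le_lt_trans (ler_normD _ _))//.
  by rewrite [ltRHS](splitr r) ltrD// (le_lt_trans yx').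
have := @segment_compact R a b; move/compact_near_coveringP => /(_ R _ Q _ h0) h.
near (0 : R)^'+ => del.
exists del; first by near: del; exact: nbhs_right_gt.
move=> x y xab; have : `[a, b]%classic `<=` Q del by near: del; exact: h.
by apply; rewrite /= in_itv.
Unshelve. all: by end_near. Qed.

Definition is_mxderive m n (F F1 : R -> 'M[R]_(m, n)) :=
  forall (x : R) i k, is_derive x 1 (fun y => F y i k) (F1 x i k).

Lemma is_mxderive_cont m n (F F1 : R -> 'M[R]_(m, n)) : is_mxderive F F1 -> mxcont F.
Proof. by move=> dF i k; apply: is_derive_continuous => x; exact: dF. Qed.

Lemma is_mxderiveB m n (F F1 G G1 : R -> 'M[R]_(m, n)) :
  is_mxderive F F1 -> is_mxderive G G1 ->
  is_mxderive (fun x => F x - G x) (fun x => F1 x - G1 x).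
Proof.
move=> dF dG x i k.
rewrite (_ : (fun x => _) = (fun y => F y i k) - (fun y => G y i k)).
  by rewrite !mxE; apply: is_deriveB; [exact: dF|exact: dG].
by apply/funext => y; rewrite !mxE.
Qed.

Lemma is_mxderiveMl m n p (C : 'M[R]_(p, m)) (F F1 : R -> 'M[R]_(m, n)) :
  is_mxderive F F1 -> is_mxderive (fun x => C *m F x) (fun x => C *m F1 x).
Proof.
move=> dF x i k.
rewrite (_ : (fun x => _) = \sum_j (C i j *: (fun y => F y j k) : R -> R)).
  rewrite mxE; apply: is_derive_sum => j; apply: is_deriveZ; exact: dF.
by apply/funext => y; rewrite mxE fct_sumE; apply: eq_bigr => j _.
Qed.

Lemma ex_mxprimitive m n (F : R -> 'M[R]_(m, n)) (t : R) (C : 'M[R]_(m, n)) :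
  mxcont F -> exists2 G : R -> 'M[R]_(m, n), G t = C & is_mxderive G F.
Proof.
move=> cF.
have /choice[g hg] (p : 'I_m * 'I_n) : exists g : R -> R,
    g t = 0 /\ forall x : R, is_derive x 1 g (F x p.1 p.2).
  by have [g g1 g2] := ex_primitive t (cF p.1 p.2); exists g.
exists (fun x => \matrix_(i, k) (g (i, k) x + C i k)).
  by apply/matrixP => i k; rewrite mxE (hg _).1 add0r.
move=> x i k.
rewrite (_ : (fun x => _) = g (i, k) + cst (C i k)).
  by rewrite -[F x i k]addr0; apply: is_deriveD; exact: (hg (i, k)).2.
by apply/funext => y; rewrite mxE.
Qed.

Lemma ler_entry_mulmx m n p (D : 'M[R]_(m, n)) (A : 'M[R]_(n, p)) (c : R) i j :
  (forall i k, `|D i k| <= c) -> `|(D *m A) i j| <= c * nrm A.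
Proof.
move=> h; rewrite mxE (le_trans (ler_norm_sum _ _ _))//.
rewrite /nrm mulr_sumr; apply: ler_sum => k _.
rewrite normrM; apply: ler_pM => //.
by rewrite (bigD1 j)//= lerDl sumr_ge0.
Qed.

Lemma geometric_cauchy (u : R^nat) (c : R) :
  (forall k, `|u k.+1 - u k| <= c * 2^-1 ^+ k) ->
  cvgn u /\ forall k, `|limn u - u k| <= 2 * c * 2^-1 ^+ k.
Proof.
move=> h.
have c0 : 0 <= c by have := le_trans (normr_ge0 _) (h 0%N); rewrite expr0 mulr1.
(* The right-hand side is the exact partial geometric sum, so the induction closes without loss. *)
have hp k p : `|u (k + p)%N - u k| <= 2 * c * 2^-1 ^+ k - 2 * c * 2^-1 ^+ (k + p).
  elim: p => [|p IH]; first by rewrite addn0 !subrr normr0.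
  rewrite addnS.
  have -> : u (k + p).+1 - u k = (u (k + p).+1 - u (k + p)%N) + (u (k + p)%N - u k).
    by rewrite addrA subrK.
  rewrite (le_trans (ler_normD _ _))//.
  have := h (k + p)%N; have := IH.
  rewrite exprS; set a := _ ^+ (k + p); set b := _ ^+ k; lra.
have hk k m : (k <= m)%N -> `|u m - u k| <= 2 * c * 2^-1 ^+ k.
  move=> km; have := hp k (m - k)%N; rewrite subnKC// => /le_trans; apply.
  by rewrite gerBl mulr_ge0 ?exprn_ge0// mulr_ge0.
have lim0 : 2 * c * 2^-1 ^+ k @[k --> \oo] --> (0 : R).
  rewrite -[X in _ --> X](mulr0 (2 * c)); apply: cvgMr.
  by apply: cvg_expr; rewrite ger0_norm ?invf_lt1 ?ltr1n// invr_ge0.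
have cu : cvgn u.
  apply/cauchy_cvgP/cauchy_exP => e e0.
  have /cvgrPdist_lt/(_ _ e0)[N _ hN] := lim0.
  exists (u N); exists N => // m /= Nm; rewrite /ball/= distrC.
  apply: le_lt_trans (hk _ _ Nm) _.
  by have := hN N (leqnn N); rewrite sub0r normrN; apply: le_lt_trans; exact: ler_norm.
split => // k.
have cd : `|u m - u k| @[m --> \oo] --> `|limn u - u k|.
  by apply: cvg_norm; apply: cvgB => //; exact: cvg_cst.
rewrite -(cvg_lim _ cd)//; apply: limr_le; first by apply/cvg_ex; eexists; exact: cd.
by exists k => // m /= km; exact: hk.
Qed.

(** * Global existence for linear matrix equations *)

Section LinearODE.
Variables (n : nat) (A : R -> 'M[R]_n) (t : R).
Hypothesis cA : mxcont A.

(* Picard iteration; in the weight expR (l * |x - t|) with l > 2 * sup |A| the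
   iteration map contracts by a factor 1/2. *)
Lemma ex_ode_solution : exists2 F : R -> 'M[R]_n, F t = 1%:M &
  is_mxderive F (fun x => F x *m A x).
Proof.
have /choice[S hS] (F : R -> 'M[R]_n) : exists G : R -> 'M[R]_n,
    mxcont F -> G t = 1%:M /\ is_mxderive G (fun x => F x *m A x).
  have [cF|nF] := pselect (mxcont F); last by exists F.
  by have [G g1 g2] := ex_mxprimitive t 1%:M (mxcontM cF cA); exists G.
pose F k := iter k S (fun=> 1%:M).
have cF k : mxcont (F k).
  elim: k => [|k IH]; first exact: mxcont_cst.
  exact: is_mxderive_cont (hS _ IH).2.
have Ft k : F k t = 1%:M by case: k => [//|k]; exact: (hS _ (cF k)).1.
have dF k : is_mxderive (F k.+1) (fun x => F k x *m A x) by exact: (hS _ (cF k)).2.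
(* The rate l = 2 K + 1 makes K / l at most 1/2; it depends on the window T, while the iterates
   [F k] do not. *)
have bound (T : R) : exists2 l : R, 0 < l & exists2 K : R, 0 <= K & (K / l <= 2^-1 /\
    forall x, `|x - t| <= T -> nrm (A x) <= K).
  have [K K0 hK] := mxcont_bounded (t - T) (t + T) cA.
  exists (2 * K + 1); first by rewrite ltr_wpDl// mulr_ge0.
  exists K => //; split.
    rewrite ler_pdivrMr; last by rewrite ltr_wpDl// mulr_ge0.
    lra.
  by move=> x; rewrite ler_distl => h; exact: hK.
have contr (T l K c : R) (D D1 : R -> 'M[R]_n) : 0 < l -> 0 <= K -> K / l <= 2^-1 ->
    (forall x, `|x - t| <= T -> nrm (A x) <= K) -> 0 <= c ->
    (forall x i k, `|x - t| <= T -> `|D x i k| <= c * expR (l * `|x - t|)) ->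
    D1 t = 0 -> is_mxderive D1 (fun x => D x *m A x) ->
    forall x i k, `|x - t| <= T -> `|D1 x i k| <= c / 2 * expR (l * `|x - t|).
  move=> l0 K0 Kl hK c0 hD D1t dD1 x i k xT.
  have E0 : D1 t i k = 0 by rewrite D1t mxE.
  have hb y : `|y - t| <= T -> `|(D y *m A y) i k| <= c * K * expR (l * `|y - t|).
    move=> yT; have hy := @ler_entry_mulmx _ _ _ (D y) (A y) _ i k (fun a b => hD y a b yT).
    apply: le_trans hy _.
    by rewrite mulrAC ler_wpM2r ?expR_ge0// ler_wpM2l// hK.
  have := deriv_expR_bound l0 (mulr_ge0 c0 K0) (fun x => dD1 x i k) E0 hb xT.
  move=> /le_trans; apply.
  by rewrite ler_wpM2r ?expR_ge0// -mulrA ler_wpM2l.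
have DF (T : R) : exists2 C : R, 0 <= C & forall k x i j, `|x - t| <= T ->
    `|F k.+1 x i j - F k x i j| <= C * 2^-1 ^+ k.
  have [l l0 [K K0 [Kl hK]]] := bound T.
  exists (expR (l * T)); first exact: expR_ge0.
  have h k : forall x i j, `|x - t| <= T ->
      `|(F k.+1 x - F k x) i j| <= 2^-1 ^+ k * expR (l * `|x - t|).
    elim: k => [|k IH] x i j xT.
      (* The constant 2 is chosen so that one contraction of the initial value 1 gives 2 / 2 = 1,
         the bound claimed for k = 0. *)
      have := @contr T l K 2 (fun=> 1%:M) (fun x => F 1%N x - F 0%N x) l0 K0 Kl hK.
      rewrite divff// expr0; apply => //.
      - move=> y a b _; rewrite mxE.
        have : 1 <= expR (l * `|y - t|) by rewrite -expR0 ler_expR mulr_ge0// ltW.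
        by case: (a == b); rewrite ?normr1 ?normr0; lra.
      - by rewrite !Ft subrr.
      - have dF0 : is_mxderive (F 0%N) (fun=> 0).
          by move=> z a b; rewrite [X in is_derive _ _ _ X]mxE; exact: is_derive_cst.
        by move=> y a b; have := is_mxderiveB (dF 0%N) dF0 y a b; rewrite subr0.
    rewrite exprS [2^-1 * _]mulrC.
    apply: (@contr T l K _ (fun x => F k.+1 x - F k x)
      (fun x => F k.+2 x - F k.+1 x)) => //.
    - by rewrite !Ft subrr.
    - move=> y a b; have := is_mxderiveB (dF k.+1) (dF k) y a b.
      by rewrite mulmxBl.
  move=> k x i j xT; have := h k x i j xT; rewrite !mxE => /le_trans; apply.
  by rewrite mulrC ler_wpM2r ?exprn_ge0// ler_expR ler_wpM2l// ltW.
pose G x := \matrix_(i, j) limn (fun k => F k x i j).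
have hG (T : R) : exists2 C : R, 0 <= C & forall k x i j, `|x - t| <= T ->
    `|G x i j - F k x i j| <= C * 2^-1 ^+ k.
  have [C C0 hC] := DF T; exists (2 * C); first by rewrite mulr_ge0.
  move=> k x i j xT; rewrite mxE.
  by have [_ ->] := geometric_cauchy (fun k => hC k x i j xT).
have lim0 (C : R) : C * 2^-1 ^+ k @[k --> \oo] --> (0 : R).
  rewrite -[X in _ --> X](mulr0 C); apply: cvgMr.
  by apply: cvg_expr; rewrite ger0_norm ?invf_lt1 ?ltr1n// invr_ge0.
have cG : mxcont G.
  move=> i j x; apply/cvgrPdist_le => e e0.
  have [C C0 hC] := hG (`|x - t| + 1).
  have e30 : 0 < e / 3 by rewrite divr_gt0.
  have /cvgrPdist_le/(_ _ e30)[k _ /(_ k (leqnn k)) hk] := lim0 C.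
  have {}hk : C * 2^-1 ^+ k <= e / 3.
    by apply: le_trans hk; rewrite sub0r normrN ler_norm.
  have /cvgrPdist_le/(_ _ e30)/nbhs_ballP[del /= del0 hdel] := cF k i j x.
  have m0 : 0 < Num.min del 1 by rewrite lt_min del0 ltr01.
  apply/nbhs_ballP; exists (Num.min del 1) => // y.
  rewrite /ball/= lt_min => /andP[/hdel h1 xy1].
  have yT : `|y - t| <= `|x - t| + 1.
    have -> : y - t = (x - t) - (x - y) by ring.
    by rewrite (le_trans (ler_normB _ _))// lerD2l ltW.
  have h2 : `|G y i j - F k y i j| <= e / 3 by exact: le_trans (hC _ _ _ _ yT) hk.
  have h3 : `|G x i j - F k x i j| <= e / 3.
    by apply: le_trans (hC _ _ _ _ _) hk; rewrite lerDl.
  have -> : G x i j - G y i j = (G x i j - F k x i j) + (F k x i j - F k y i j)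
     - (G y i j - F k y i j) by ring.
  rewrite (le_trans (ler_normB _ _))// (le_trans (lerD (ler_normD _ _) (lexx _)))//.
  lra.
clearbody G.
(* Limits and derivatives are never exchanged: the primitive [G'] of G A stays within a multiple of
   2^-k of [F k.+1], as does G, so [G'] = G and G inherits the equation. *)
have [G' G't dG'] := ex_mxprimitive t 1%:M (mxcontM cG cA).
have GG' x i j : G' x i j = G x i j.
  have [C C0 hC] := hG `|x - t|.
  have [l l0 [K K0 [Kl hK]]] := bound `|x - t|.
  have h k : `|G' x i j - G x i j| <= (C * expR (l * `|x - t|) + C) * 2^-1 ^+ k.
    have h1 : `|(G' x - F k.+1 x) i j| <= C * 2^-1 ^+ k / 2 * expR (l * `|x - t|).
      apply: (@contr `|x - t| l K _ (fun x => G x - F k x)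
        (fun x => G' x - F k.+1 x)) => //.
      - by rewrite mulr_ge0// exprn_ge0.
      - move=> y a b yT; rewrite !mxE -[leLHS]mulr1.
        apply: ler_pM => //; first exact: hC.
        by rewrite -expR0 ler_expR mulr_ge0// ltW.
      - by rewrite G't Ft subrr.
      - move=> y a b; have := is_mxderiveB dG' (dF k) y a b.
        by rewrite mulmxBl.
    have h2 := hC k.+1 x i j (lexx _).
    have -> : G' x i j - G x i j = (G' x - F k.+1 x) i j - (G x i j - F k.+1 x i j).
      by rewrite !mxE; ring.
    rewrite (le_trans (ler_normB _ _))// mulrDl; apply: lerD.
      apply: le_trans h1 _.
      have : 0 <= C * 2^-1 ^+ k * expR (l * `|x - t|).
        by rewrite !mulr_ge0 ?exprn_ge0 ?expR_ge0.
      lra.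
    apply: le_trans h2 _; rewrite ler_wpM2l// exprS.
    by have : 0 <= 2^-1 ^+ k :> R by []; lra.
  apply/eqP; rewrite -subr_eq0; apply: contraT; rewrite -normr_gt0 => a0.
  have /cvgrPdist_lt/(_ _ a0)[N _ /(_ N (leqnn N))] :=
    lim0 (C * expR (l * `|x - t|) + C).
  rewrite sub0r normrN => hN.
  by have := le_lt_trans (le_trans (h N) (ler_norm _)) hN; rewrite ltxx.
exists G'; first by [].
move=> x i k; have := dG' x i k.
by rewrite (_ : G x = G' x)//; apply/matrixP => a b; rewrite GG'.
Qed.

End LinearODE.

Lemma is_derive_bigsum k (f : 'I_k -> R -> R) (f1 : 'I_k -> R) (x : R) :
  (forall i, is_derive x 1 (f i) (f1 i)) ->
  is_derive x 1 (fun y => \sum_i f i y) (\sum_i f1 i).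
Proof.
move=> h; rewrite (_ : (fun y => _) = \sum_i f i); first exact: is_derive_sum.
by apply/funext => y; rewrite fct_sumE.
Qed.

(* Gronwall: the sum of squares g of the entries satisfies g' <= 2 n K g. *)
Lemma ode_growth m n (A : R -> 'M[R]_n) (D : R -> 'M[R]_(m, n)) (a b K : R) :
  is_mxderive D (fun x => D x *m A x) ->
  (forall x, a <= x <= b -> nrm (A x) <= K) -> 0 <= K -> a <= b ->
  \sum_i \sum_j D b i j ^+ 2 <=
  (\sum_i \sum_j D a i j ^+ 2) * expR (2 * n%:R * K * (b - a)).
Proof.
move=> dD hK K0 ab.
pose g x := \sum_i \sum_j D x i j ^+ 2.
pose g1 x := \sum_i \sum_j (2 * D x i j * (D x *m A x) i j).
have dg (x : R) : is_derive x 1 g (g1 x).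
  apply: is_derive_bigsum => i; apply: is_derive_bigsum => j.
  have -> : 2 * D x i j * (D x *m A x) i j =
    D x i j *: (D x *m A x) i j + D x i j *: (D x *m A x) i j.
    by rewrite /GRing.scale/=; ring.
  rewrite (_ : (fun y => _) = (fun y => D y i j) * (fun y => D y i j)).
    by apply: is_deriveM; exact: dD.
  by apply/funext => y; rewrite expr2.
pose l := 2 * n%:R * K.
have g1le x : a <= x <= b -> g1 x <= l * g x.
  move=> xab.
  have h1 i : \sum_j (2 * D x i j * (D x *m A x) i j) <=
      \sum_j \sum_k K * (D x i j ^+ 2 + D x i k ^+ 2).
    apply: ler_sum => j _; rewrite mxE mulr_sumr; apply: ler_sum => k _.
    have hA : `|A x k j| <= K by exact: le_trans (ler_entry_nrm _ _ _) (hK x xab).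
    apply: (@le_trans _ _ (`|A x k j| * (D x i j ^+ 2 + D x i k ^+ 2))); last first.
      by rewrite ler_wpM2r// addr_ge0// sqr_ge0.
    have h2 : `|2 * D x i j * D x i k| <= D x i j ^+ 2 + D x i k ^+ 2.
      have p1 := sqr_ge0 (D x i j + D x i k); have p2 := sqr_ge0 (D x i j - D x i k).
      by rewrite ler_norml; apply/andP; split; rewrite !expr2 in p1 p2 *; lra.
    rewrite mulrA (le_trans (ler_norm _))// normrM mulrC ler_wpM2l//.
  rewrite /g1 /g mulr_sumr; apply: ler_sum => i _; apply: le_trans (h1 i) _.
  under eq_bigr do rewrite -mulr_sumr big_split/= sumr_const card_ord.
  rewrite -mulr_sumr big_split/= sumr_const card_ord sumrMnl.
  move: (\sum_(j < n) D x i j ^+ 2) => s.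
  by rewrite -mulr2n -mulrnA -mulr_natl natrM mulrA [K * _]mulrC [n%:R * 2]mulrC.
pose e x := expR (- l * (x - a)).
have dh (x : R) : is_derive x 1 (g * e : R -> R) (g x *: (- l * e x) + e x *: g1 x).
  by apply: is_deriveM => //; exact: is_derive_expRM.
have := @le_of_deriv_le _ (g * e : R -> R) (cst 0) _ (fun=> 0) a b ab dh
  (fun x => is_derive_cst _ _ _).
rewrite /cst/= subrr => /(_ _) h.
have {h} : (g * e) b - (g * e) a <= 0.
  apply: h => x xab; have := g1le x xab; have := expR_ge0 (- l * (x - a)).
  rewrite -/(e x) /GRing.scale/= => e0 gl.
  have : e x * g1 x <= e x * (l * g x) by rewrite ler_wpM2l.
  lra.
have -> : (g * e) b = g b * e b by [].
have -> : (g * e) a = g a * e a by [].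
rewrite /e subrr mulr0 expR0 mulr1 subr_le0 mulNr expRN -/l => h.
by rewrite -ler_pdivrMr ?expR_gt0.
Qed.

Lemma ode_unique m n (A : R -> 'M[R]_n) (F G : R -> 'M[R]_(m, n)) (a b : R) :
  mxcont A -> is_mxderive F (fun x => F x *m A x) ->
  is_mxderive G (fun x => G x *m A x) -> F a = G a -> a <= b -> F b = G b.
Proof.
move=> cA dF dG FGa ab.
have [K K0 hK] := mxcont_bounded a b cA.
have dD : is_mxderive (fun x => F x - G x) (fun x => (F x - G x) *m A x).
  by move=> x i k; have := is_mxderiveB dF dG x i k; rewrite mulmxBl.
have := ode_growth dD hK K0 ab.
rewrite [X in _ <= X * _]big1 ?mul0r => [h|i _]; last first.
  by apply: big1 => j _; rewrite FGa subrr mxE expr0n.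
have s0 i : 0 <= \sum_j ((F b - G b) i j) ^+ 2 by apply: sumr_ge0 => j _; exact: sqr_ge0.
have /eqP : \sum_i \sum_j ((F b - G b) i j) ^+ 2 = 0.
  by apply/eqP; rewrite eq_le h sumr_ge0.
rewrite psumr_eq0// => /allP hi.
apply/matrixP => i j; apply/eqP; rewrite -subr_eq0.
have /eqP := hi i (mem_index_enum _).
move/eqP; rewrite psumr_eq0 => [/allP/(_ j (mem_index_enum _))|k _]; last exact: sqr_ge0.
by rewrite sqrf_eq0 !mxE.
Qed.

(** * Estimates for product integrals *)

Section Prodint.
Variables (n : nat) (A : R -> 'M[R]_n).
Hypothesis cA : mxcont A.

(** Existence of a solution turns the epsilon choice into its defining properties, from which all
    later facts about [prodint] are derived. *)
Lemma prodint_spec (t : R) : prodint A t t = 1%:M /\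
  is_mxderive (prodint A t) (fun x => prodint A t x *m A x).
Proof.
pose Q (F : R -> 'M[R]_n) := F t = 1%:M /\ forall (x : R) (i k : 'I_n),
  is_derive x 1 (fun y => F y i k) ((F x *m A x) i k).
have exQ : exists F, Q F.
  by have [F F1 F2] := ex_ode_solution t cA; exists F.
exact: (ClassicalEpsilon.epsilon_spec (inhabits (fun _ : R => (1%:M : 'M[R]_n))) Q exQ).
Qed.

Lemma prodint_refl t : prodint A t t = 1%:M. Proof. exact: (prodint_spec t).1. Qed.

Lemma is_mxderive_prodint t :
  is_mxderive (prodint A t) (fun x => prodint A t x *m A x).
Proof. exact: (prodint_spec t).2. Qed.

(** As functions of the right endpoint both sides solve the same equation, and they agree at s;
    uniqueness runs forward, whence [s <= r]. *)
Lemma prodint_mul (t s r : R) : s <= r ->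
  prodint A t s *m prodint A s r = prodint A t r.
Proof.
move=> sr.
apply: (@ode_unique _ _ A (fun x => prodint A t s *m prodint A s x) (prodint A t) s r) => //.
- move=> x i k; have := is_mxderiveMl (prodint A t s) (is_mxderive_prodint s) x i k.
  by rewrite mulmxA.
- exact: is_mxderive_prodint.
- by rewrite prodint_refl mulmx1.
Qed.

Lemma prodint_bounded (a b : R) : exists2 C : R, 0 <= C & forall u v,
  a <= u -> u <= v -> v <= b -> nrm (prodint A u v) <= C.
Proof.
have [K K0 hK] := mxcont_bounded a b cA.
pose B := (\sum_(i < n) \sum_(j < n) ((1%:M : 'M[R]_n) i j) ^+ 2) * expR (2 * n%:R * K * (b - a)).
have B0 : 0 <= B.
  rewrite mulr_ge0 ?expR_ge0// sumr_ge0// => i _.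
  by rewrite sumr_ge0// => j _; exact: sqr_ge0.
exists ((n * n)%:R * (1 + B)); first by rewrite mulr_ge0// addr_ge0.
move=> u v au uv vb; apply: nrm_le_entries => i j.
have h := @ode_growth _ _ A (prodint A u) u v K (is_mxderive_prodint u) _ K0 uv.
have {}h : \sum_i \sum_j prodint A u v i j ^+ 2 <= B.
  apply: le_trans (h _) _.
    by move=> x /andP[ux xv]; apply: hK; rewrite (le_trans au)//= (le_trans xv).
  rewrite prodint_refl ler_wpM2l//.
    by rewrite sumr_ge0// => k _; rewrite sumr_ge0// => l _; exact: sqr_ge0.
  by rewrite ler_expR ler_wpM2l ?mulr_ge0//; lra.
have hij : prodint A u v i j ^+ 2 <= B.
  apply: le_trans h; rewrite (bigD1 i)//= (bigD1 j)//= -addrA lerDl addr_ge0//.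
    by rewrite sumr_ge0// => l _; exact: sqr_ge0.
  by rewrite sumr_ge0// => k _; rewrite sumr_ge0// => l _; exact: sqr_ge0.
(* From x^2 <= B follows |x| <= 1 + B, which spares a square root. *)
rewrite ler_norml; apply/andP; split; nra.
Qed.

Lemma prodint_sub1 (a b : R) : exists2 C : R, 0 <= C & forall u v,
  a <= u -> u <= v -> v <= b -> nrm (prodint A u v - 1%:M) <= C * (v - u).
Proof.
have [K K0 hK] := mxcont_bounded a b cA.
have [C C0 hC] := prodint_bounded a b.
exists ((n * n)%:R * (C * K)); first by rewrite mulr_ge0// mulr_ge0.
move=> u v au uv vb; rewrite -mulrA; apply: nrm_le_entries => i j.
have := deriv_bound (c := 0) (e := C * K) uv (fun x => is_mxderive_prodint u x i j).
rewrite mulr0 subr0 prodint_refl [(v - u) * _]mulrC !mxE; apply.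
move=> x /andP[ux xv]; rewrite subr0 (le_trans (ler_entry_nrm _ _ _))//.
rewrite (le_trans (ler_nrmM _ _))// ler_pM ?nrm_ge0//.
  by rewrite hC// (le_trans xv).
by rewrite hK// (le_trans au)//= (le_trans xv).
Qed.

(** The rate may be taken at any x in [u, v]: in a grid cell that contains a jump it will be
    evaluated at the jump time, not at a grid point. *)
Lemma prodint_first_order (a b e : R) : 0 < e -> exists2 del : R, 0 < del &
  forall u x v, a <= u -> u <= x -> x <= v -> v <= b -> v - u <= del ->
  nrm (prodint A u v - 1%:M - (v - u) *: A x) <= e * (v - u).
Proof.
move=> e0.
have [K K0 hK] := mxcont_bounded a b cA.
have [C C0 hC] := prodint_sub1 a b.
pose N : R := (n * n)%:R.
have N0 : 0 <= N by exact: ler0n.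
(* Entrywise errors e1 add up to N e1 <= e in [nrm]. One half of e1 pays for the oscillation of A,
   the other for the distance of the product integral from 1. *)
pose e1 := e / (N + 1).
have e10 : 0 < e1 by rewrite divr_gt0// ltr_wpDl.
have e20 : 0 < e1 / 2 by rewrite divr_gt0.
have [d1 d10 hd1] := mxcont_unif a b cA e20.
pose d2 := e1 / 2 / (C * K + 1).
have CK0 : 0 <= C * K by rewrite mulr_ge0.
have d20 : 0 < d2 by rewrite divr_gt0// ltr_wpDl.
exists (Num.min d1 d2); first by rewrite lt_min d10.
move=> u x v au ux xv vb; rewrite le_min => /andP[vd1 vd2].
have uv := le_trans ux xv.
have Ne : N * e1 <= e.
  rewrite /e1 mulrCA -[leRHS]mulr1 ler_wpM2l ?(ltW e0)//.
  by rewrite ler_pdivrMr ?ltr_wpDl// mul1r lerDl.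
apply: (@le_trans _ _ (N * (e1 * (v - u)))); last first.
  by rewrite mulrA ler_wpM2r// subr_ge0.
apply: nrm_le_entries => i j.
have := deriv_bound (c := A x i j) (e := e1) uv (fun y => is_mxderive_prodint u y i j).
rewrite prodint_refl !mxE [(v - u) * e1]mulrC; apply.
move=> y /andP[uy yv].
have yab : a <= y <= b by rewrite (le_trans au)//= (le_trans yv).
have xab : a <= x <= b by rewrite (le_trans au)//= (le_trans xv).
have -> : (prodint A u y *m A y) i j - A x i j =
    ((prodint A u y - 1%:M) *m A y + (A y - A x)) i j.
  by rewrite mulmxBl mul1mx addrA subrK !mxE.
rewrite (le_trans (ler_entry_nrm _ _ _))// (le_trans (ler_nrmD _ _))//.
rewrite [leRHS](splitr e1) lerD//; last first.
  rewrite hd1// ler_norml; apply/andP; split; lra.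
rewrite (le_trans (ler_nrmM _ _))//.
apply: (@le_trans _ _ (C * d2 * K)).
  rewrite ler_pM ?nrm_ge0// ?hK// (le_trans (hC _ _ _ _ _))//.
    by case/andP: yab.
  by rewrite ler_wpM2l//; lra.
rewrite mulrAC /d2 mulrCA -[leRHS]mulr1 ler_wpM2l ?(ltW e20)//.
by rewrite ler_pdivrMr ?ltr_wpDl// mul1r lerDl.
Qed.

End Prodint.
End MatrixFunctions.

(** * Block structure of the intensity matrix *)

Section Blocks.
Variables (R : realType) (J : nat) (d : 'I_J.+1 -> nat).
Notation E := (Emx R d).

Definition sidx (e : state d) : 'I_(dbar d) := tagnat.rank e.

Lemma sidx_inj : injective sidx. Proof. exact: tagnat.rank_inj. Qed.

Lemma sidx_bij : bijective sidx. Proof. exact: tagnat.rank_bij. Qed.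

(** The bridge from the arithmetic offsets to the lexicographic rank: after it, [Emx] and [ev] are
    column selections of the identity matrix. *)
Lemma eq_sidx (k : 'I_(dbar d)) (e : state d) :
  ((k : nat) == (off d (tag e) + tagged e)%N) = (k == sidx e).
Proof. by rewrite -val_eqE; congr (_ == _); rewrite [RHS](tagnat.rankEsum e). Qed.

Lemma EmxE j : E j = colsub (fun l => sidx (Tagged _ l)) 1%:M.
Proof.
by apply/matrixP => k l; rewrite !mxE -(eq_sidx k (Tagged _ l)).
Qed.

Lemma EmxTE j : (E j)^T = rowsub (fun l => sidx (Tagged _ l)) 1%:M.
Proof. by rewrite EmxE; apply/matrixP => k l; rewrite !mxE eq_sym. Qed.

Lemma evE e : ev R e = colsub (fun=> sidx e) 1%:M.
Proof. by apply/matrixP => k l; rewrite !mxE eq_sidx. Qed.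

Lemma mulTEmx_E i j : (E i)^T *m E j =
  mxsub (fun l => sidx (Tagged _ l)) (fun l => sidx (Tagged _ l)) 1%:M.
Proof. by rewrite EmxTE EmxE mul_rowsub_mx mul1mx; apply/matrixP => k l; rewrite !mxE. Qed.

Lemma mulTEmx j : (E j)^T *m E j = 1%:M.
Proof.
rewrite mulTEmx_E; apply/matrixP => k l; rewrite !mxE (inj_eq sidx_inj).
by rewrite eq_Tagged.
Qed.

Lemma mulKTEmx j m (A : 'M[R]_(d j, m)) : (E j)^T *m (E j *m A) = A.
Proof. by rewrite mulmxA mulTEmx mul1mx. Qed.

Lemma mulTEmx_neq i j : i != j -> (E i)^T *m E j = 0.
Proof.
move=> ij; rewrite mulTEmx_E; apply/matrixP => k l; rewrite !mxE (inj_eq sidx_inj).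
by case: eqP => // /(congr1 tag)/= /eqP; rewrite (negbTE ij).
Qed.

Lemma mulTEmx_ev e : (E (tag e))^T *m ev R e = etil R e.
Proof.
rewrite EmxTE mul_rowsub_mx mul1mx evE; apply/matrixP => k l.
rewrite !mxE (inj_eq sidx_inj); case: e k => i k' /= k.
by rewrite eq_Tagged.
Qed.

Lemma mulTEmx_ev_neq j e : j != tag e -> (E j)^T *m ev R e = 0.
Proof.
move=> ij; rewrite EmxTE mul_rowsub_mx mul1mx evE; apply/matrixP => k l.
rewrite !mxE (inj_eq sidx_inj).
by case: eqP => // /(congr1 tag)/= /eqP; rewrite (negbTE ij).
Qed.

Lemma mulmx_ev m (A : 'M[R]_(m, dbar d)) e i : (A *m ev R e) i ord0 = A i (sidx e).
Proof. by rewrite evE mulmx_colsub mulmx1 mxE. Qed.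

Lemma sum_state (F : 'I_(dbar d) -> R) : \sum_k F k = \sum_(e : state d) F (sidx e).
Proof.
by rewrite (reindex sidx)//; exact/onW_bij/sidx_bij.
Qed.

(** The coordinate projection onto block y; applied to a row of unnormalized probabilities it
    records the observation of macrostate y. *)
Definition Pimx y : 'M[R]_(dbar d) := E y *m (E y)^T.

Lemma eq_tagged_state (e : state d) (l : 'I_(d (tag e))) :
  (e == Tagged (fun x => 'I_(d x)) l) = (tagged e == l).
Proof. by case: e l => i x l /=; rewrite eq_Tagged. Qed.

Lemma PimxE y e k : Pimx y (sidx e) k = ((tag e == y) && (sidx e == k))%:R.
Proof.
rewrite /Pimx mxE EmxTE EmxE.
under eq_bigr do rewrite !mxE (inj_eq sidx_inj).
have [ey|ney] := eqVneq (tag e) y.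
  subst y; rewrite (bigD1 (tagged e))//= big1 => [|l ne].
    have -> : Tagged (fun x => 'I_(d x)) (tagged e) = e by case: (e).
    by rewrite eqxx mul1r addr0.
  by rewrite eq_tagged_state eq_sym (negbTE ne) mul0r.
rewrite big1// => l _; case: eqP => [h|]; last by rewrite mul0r.
by move: ney; rewrite h eqxx.
Qed.

Lemma Pimx_Emx y : Pimx y *m E y = E y.
Proof. by rewrite /Pimx -mulmxA mulTEmx mulmx1. Qed.

Lemma TEmx_Pimx y : (E y)^T *m Pimx y = (E y)^T.
Proof. by rewrite /Pimx mulmxA mulTEmx mul1mx. Qed.

Lemma Pimx_idem y : Pimx y *m Pimx y = Pimx y.
Proof. by rewrite {1}/Pimx -mulmxA TEmx_Pimx. Qed.

Lemma TEmx_ones y : (E y)^T *m (const_mx 1 : 'cV[R]_(dbar d)) = const_mx 1.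
Proof.
by rewrite EmxTE mul_rowsub_mx mul1mx; apply/matrixP => i j; rewrite !mxE.
Qed.

Lemma mulmx_ones (v : 'rV[R]_(dbar d)) :
  (v *m (const_mx 1 : 'cV[R]_(dbar d))) ord0 ord0 = \sum_e (v *m ev R e) ord0 ord0.
Proof.
rewrite mxE sum_state; apply: eq_bigr => e _.
by rewrite mulmx_ev mxE mulr1.
Qed.

Lemma mxcont_blkf (M : R -> 'M[R]_(dbar d)) i j : mxcont M -> mxcont (blkf M i j).
Proof.
by move=> cM; apply: mxcontM; [apply: mxcontM => //|]; exact: mxcont_cst.
Qed.

End Blocks.

(** * Discrete Gronwall estimate for products of one-step factors *)

Section Euler.
Variable R : realType.

(** Each step commits an error of at most 2 e1 h times the size of the exact solution, and earlier
    errors grow by 1 + L h per step. As N h <= T, the total growth is at most exp (L T), uniformly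
    in N and in the initial vector. *)
Lemma euler_product n (A : R -> 'M[R]_n) (Q : R -> R -> 'M[R]_n) (T : R) : mxcont A ->
  (forall e, 0 < e -> exists2 del : R, 0 < del & forall u v, 0 <= u -> u <= v ->
     v <= T -> v - u <= del -> nrm (Q u v - 1%:M - (v - u) *: A u) <= e * (v - u)) ->
  forall e, 0 < e -> exists2 del : R, 0 < del &
    forall p (x : nat -> 'M[R]_(p, n)) (u : nat -> R) (N : nat) (h : R),
    0 <= h -> h <= del -> 0 <= u 0%N -> u N <= T ->
    (forall k, (k < N)%N -> u k.+1 = u k + h) ->
    (forall k, (k < N)%N -> x k.+1 = x k *m Q (u k) (u k.+1)) ->
    nrm (x N - x 0%N *m prodint A (u 0%N) (u N)) <= e * nrm (x 0%N).
Proof.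
move=> cA hQ e e0.
have [K K0 hK] := mxcont_bounded 0 T cA.
have [C C0 hC] := prodint_bounded cA 0 T.
(* K bounds A, and the extra 1 absorbs the first-order error e1 <= 1 of a factor. *)
pose L := K + 1.
have L1 : 1 <= L by rewrite /L lerDr.
pose e1 := Num.min 1 (e / (2 * (C + 1) * expR (L * T))).
have den0 : 0 < 2 * (C + 1) * expR (L * T).
  by rewrite !mulr_gt0 ?expR_gt0// ltr_wpDl.
have e10 : 0 < e1 by rewrite lt_min ltr01 divr_gt0.
have e11 : e1 <= 1 by rewrite ge_min lexx.
have e1e : 2 * (C + 1) * expR (L * T) * e1 <= e.
  rewrite mulrC -ler_pdivlMr// /e1 ge_min; apply/orP; right.
  by rewrite lexx.
have [d1 d10 h1] := hQ _ e10.
have [d2 d20 h2] := prodint_first_order cA 0 T e10.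
exists (Num.min d1 d2); first by rewrite lt_min d10.
move=> p x u N h h0; rewrite le_min => /andP[hd1 hd2] u0 uN hu hx.
have uE k : (k <= N)%N -> u k = u 0%N + k%:R * h.
  elim: k => [_|k IH kN]; first by rewrite mul0r addr0.
  by rewrite hu// IH 1?ltnW// -natr1; ring.
have umono k l : (k <= l)%N -> (l <= N)%N -> u k <= u l.
  move=> kl lN; rewrite (uE k) ?(uE l)//; last exact: leq_trans kl lN.
  by rewrite lerD2l ler_wpM2r// ler_nat.
have uk0 k : (k <= N)%N -> 0 <= u k by move=> kN; exact: le_trans u0 (umono _ _ _ kN).
have ukT k : (k <= N)%N -> u k <= T by move=> kN; exact: le_trans (umono _ _ kN (leqnn _)) uN.
pose y k := x 0%N *m prodint A (u 0%N) (u k).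
pose X := nrm (x 0%N).
have X0 : 0 <= X by exact: nrm_ge0.
(* With this constant D ((1 + L h)^k - 1) satisfies the recursion of [step] with equality. *)
pose D := 2 * C * X * e1 / L.
have D0 : 0 <= D.
  by rewrite divr_ge0 ?(le_trans _ L1)// !mulr_ge0// ltW.
have step k : (k < N)%N ->
    nrm (x k.+1 - y k.+1) <= nrm (x k - y k) * (1 + L * h) + D * L * h.
  move=> kN; have kN' := ltnW kN.
  have vu : u k.+1 - u k = h by rewrite hu// addrAC subrr add0r.
  have hq := h1 (u k) (u k.+1) (uk0 _ kN') (umono _ _ (leqnSn _) kN) (ukT _ kN).
  have hp := h2 (u k) (u k) (u k.+1) (uk0 _ kN') (lexx _) (umono _ _ (leqnSn _) kN) (ukT _ kN).
  rewrite vu in hq hp.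
  move: (hq hd1) (hp hd2) => {}hq {}hp.
  set q := Q (u k) (u k.+1) in hq *.
  set f := prodint A (u k) (u k.+1) in hp *.
  have yE : y k.+1 = y k *m f.
    by rewrite /y /f -mulmxA prodint_mul// umono.
  have q1 : nrm (q - 1%:M) <= L * h.
    have -> : q - 1%:M = (q - 1%:M - h *: A (u k)) + h *: A (u k) by rewrite subrK.
    rewrite (le_trans (ler_nrmD _ _))// nrmZ (ger0_norm h0) /L mulrDl addrC lerD//.
      by rewrite mulrC ler_wpM2r// hK// uk0// ukT.
    by apply: le_trans hq _; rewrite ler_wpM2r.
  have qf : nrm (q - f) <= 2 * e1 * h.
    have -> : q - f = (q - 1%:M - h *: A (u k)) - (f - 1%:M - h *: A (u k)).
      by rewrite !opprD !opprK !addrA; apply/matrixP => a b; rewrite !mxE; ring.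
    rewrite (le_trans (ler_nrmD _ _))// nrmN -mulrA mulr_natl mulr2n lerD//.
  have yb : nrm (y k) <= X * C.
    rewrite (le_trans (ler_nrmM _ _))// ler_wpM2l// hC//; last exact: ukT.
    exact: umono.
  have -> : x k.+1 - y k.+1 = ((x k - y k) + (x k - y k) *m (q - 1%:M)) + y k *m (q - f).
    rewrite hx// yE -/q !mulmxBl !mulmxBr !mulmx1.
    by apply/matrixP => a b; rewrite !mxE; ring.
  rewrite (le_trans (ler_nrmD _ _))// lerD//.
    rewrite (le_trans (ler_nrmD _ _))// mulrDr mulr1 lerD2l//.
    by rewrite (le_trans (ler_nrmM _ _))// ler_wpM2l// nrm_ge0.
  rewrite (le_trans (ler_nrmM _ _))//.
  apply: (@le_trans _ _ (X * C * (2 * e1 * h))).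
    by rewrite ler_pM ?nrm_ge0.
  rewrite /D divfK ?gt_eqF ?(lt_le_trans ltr01)//.
  by rewrite le_eqVlt; apply/orP; left; apply/eqP; ring.
have main k : (k <= N)%N -> nrm (x k - y k) <= D * ((1 + L * h) ^+ k - 1).
  elim: k => [_|k IH kN].
    by rewrite /y prodint_refl// mulmx1 subrr nrm0 expr0 subrr mulr0.
  apply: le_trans (step _ kN) _.
  have Lh : 0 <= 1 + L * h by rewrite addr_ge0// mulr_ge0// (le_trans _ L1).
  apply: (@le_trans _ _ (D * ((1 + L * h) ^+ k - 1) * (1 + L * h) + D * L * h)).
    by rewrite lerD2r ler_wpM2r// IH// ltnW.
  rewrite exprS; move: ((1 + L * h) ^+ k) => w.
  by rewrite le_eqVlt; apply/orP; left; apply/eqP; ring.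
apply: le_trans (main N (leqnn N)) _.
have hN : N%:R * h <= T by rewrite (le_trans _ uN)// [leRHS]uE// lerDr.
have : (1 + L * h) ^+ N <= expR (L * T).
  apply: (@le_trans _ _ (expR (L * h) ^+ N)).
    apply: lerXn2r; rewrite ?nnegrE ?expR_ge0 ?expR_ge1Dx//.
    by rewrite addr_ge0// mulr_ge0// (le_trans _ L1).
  rewrite -expRM_natl ler_expR mulrCA ler_wpM2l// (le_trans _ L1)//.
move=> hw; apply: (@le_trans _ _ (D * expR (L * T))).
  by rewrite ler_wpM2l//; lra.
rewrite mulrC; have -> : e * X = X * e by rewrite mulrC.
apply: le_trans (_ : X * (2 * (C + 1) * expR (L * T) * e1) <= _); last by rewrite ler_wpM2l.
rewrite /D; set w := expR _; have w0 : 0 <= w by exact: expR_ge0.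
have p0 : 0 <= X * e1 * w by rewrite !mulr_ge0// ltW.
apply: (@le_trans _ _ (2 * C * (X * e1 * w))).
  rewrite [leLHS]mulrA ler_pdivrMr ?(lt_le_trans ltr01)//.
  have -> : w * (2 * C * X * e1) = 2 * C * (X * e1 * w) by ring.
  by rewrite ler_peMr// mulr_ge0// mulr_ge0.
have : 0 <= C * (X * e1 * w) by rewrite mulr_ge0.
lra.
Qed.

End Euler.

(** * Convergence of products of one-step factors *)

Section MatrixLimits.
Variable R : realType.

Definition mxcvg m n (x : nat -> 'M[R]_(m, n)) (l : 'M[R]_(m, n)) :=
  nrm (x k - l) @[k --> \oo] --> (0 : R).

Lemma squeeze0 (f g : nat -> R) : (\forall k \near \oo, `|f k| <= g k) ->
  g k @[k --> \oo] --> (0 : R) -> f k @[k --> \oo] --> (0 : R).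
Proof.
move=> fg g0; apply/cvgr0Pnorm_le => e e0.
move/cvgr0Pnorm_le : g0 => /(_ e e0) g0; near=> k.
apply: (@le_trans _ _ (g k)); first by near: k.
by apply: (le_trans (ler_norm _)); near: k.
Unshelve. all: by end_near. Qed.

Lemma mxcvg_le m n (x : nat -> 'M[R]_(m, n)) l (g : nat -> R) :
  (\forall k \near \oo, nrm (x k - l) <= g k) ->
  g k @[k --> \oo] --> (0 : R) -> mxcvg x l.
Proof.
move=> h; apply: squeeze0; near=> k.
by rewrite ger0_norm ?nrm_ge0//; near: k.
Unshelve. all: by end_near. Qed.

Lemma mxcvg_cst m n (l : 'M[R]_(m, n)) : mxcvg (fun=> l) l.
Proof. by rewrite /mxcvg subrr nrm0; exact: cvg_cst. Qed.

Lemma mxcvg_near_eq m n (x y : nat -> 'M[R]_(m, n)) l :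
  (\forall k \near \oo, x k = y k) -> mxcvg x l -> mxcvg y l.
Proof.
move=> xy; apply: mxcvg_le; near=> k.
by have -> : x k = y k by near: k.
Unshelve. all: by end_near. Qed.

Lemma mxcvgD m n (x y : nat -> 'M[R]_(m, n)) l l' :
  mxcvg x l -> mxcvg y l' -> mxcvg (fun k => x k + y k) (l + l').
Proof.
move=> xl yl; apply: (@mxcvg_le _ _ _ _ (fun k => nrm (x k - l) + nrm (y k - l'))).
  near=> k; rewrite (le_trans _ (ler_nrmD _ _))//.
  by rewrite opprD addrACA.
by rewrite -[X in _ --> X](addr0 0); apply: cvgD.
Unshelve. all: by end_near. Qed.

Lemma mxcvgM m n p (x : nat -> 'M[R]_(m, n)) (y : nat -> 'M[R]_(n, p)) l l' :
  mxcvg x l -> mxcvg y l' -> mxcvg (fun k => x k *m y k) (l *m l').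
Proof.
move=> xl yl; apply: (@mxcvg_le _ _ _ _ (fun k => nrm (x k - l) * nrm (y k - l') +
    nrm (x k - l) * nrm l' + nrm l * nrm (y k - l'))).
  near=> k.
  have -> : x k *m y k - l *m l' =
     (x k - l) *m (y k - l') + (x k - l) *m l' + l *m (y k - l').
    rewrite !mulmxBl !mulmxBr; apply/matrixP => a b; rewrite !mxE; ring.
  rewrite (le_trans (ler_nrmD _ _))// lerD ?ler_nrmM//.
  by rewrite (le_trans (ler_nrmD _ _))// lerD ?ler_nrmM.
rewrite (_ : 0 = 0 * 0 + 0 * nrm l' + nrm l * 0); last by rewrite mul0r mulr0 mul0r !addr0.
apply: cvgD; last by apply: cvgM => //; exact: cvg_cst.
by apply: cvgD; apply: cvgM => //; exact: cvg_cst.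
Unshelve. all: by end_near. Qed.

Lemma mxcvg_entry m n (x : nat -> 'M[R]_(m, n)) l i j : mxcvg x l ->
  x k i j @[k --> \oo] --> l i j.
Proof.
move=> xl; apply/subr_cvg0.
apply: squeeze0 xl; near=> k; have := ler_entry_nrm (x k - l) i j.
by rewrite !mxE.
Unshelve. all: by end_near. Qed.

Lemma mxcvg_cont m n (A : R -> 'M[R]_(m, n)) (u : nat -> R) a :
  mxcont A -> u k @[k --> \oo] --> a -> mxcvg (fun k => A (u k)) (A a).
Proof.
move=> cA ua; apply/cvgr0Pnorm_le => e e0.
have [del del0 hdel] := mxcont_near a cA e0.
move/cvgrPdist_lt : ua => /(_ del del0) ua; near=> k.
rewrite ger0_norm ?nrm_ge0// -nrmN opprB; apply: hdel.
by near: k.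
Unshelve. all: by end_near. Qed.

(** The starting points approach a from the right, so multiplicativity bounds the change by the
    distance of [prodint A a (u k)] from 1; the right endpoints are handled by continuity. *)
Lemma prodint_cvg n (A : R -> 'M[R]_n) (T a b : R) (u v : nat -> R) : mxcont A ->
  0 <= a -> (\forall k \near \oo, a <= u k /\ u k <= v k /\ v k <= T) ->
  u k @[k --> \oo] --> a -> v k @[k --> \oo] --> b ->
  mxcvg (fun k => prodint A (u k) (v k)) (prodint A a b).
Proof.
move=> cA a0 huv ua vb.
have [C C0 hC] := prodint_bounded cA 0 T.
have [C' C'0 hC'] := prodint_sub1 cA 0 T.
apply: (@mxcvg_le _ _ _ _ (fun k => C' * (u k - a) * C +
    nrm (prodint A a (v k) - prodint A a b))).
  near=> k.
  have [h1 [h2 h3]] : a <= u k /\ u k <= v k /\ v k <= T by near: k.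
  rewrite (le_trans (ler_nrmB _ (prodint A a (v k)) _))// lerD2r.
  rewrite -(prodint_mul cA a h2) -{1}[prodint A (u k) (v k)]mul1mx -mulmxBl.
  rewrite (le_trans (ler_nrmM _ _))// ler_pM ?nrm_ge0//.
    by rewrite -nrmN opprB hC'// (le_trans h2).
  by rewrite hC// (le_trans a0).
rewrite (_ : 0 = C' * (a - a) * C + 0); last by rewrite subrr mulr0 mul0r addr0.
apply: cvgD.
  apply: cvgM; last exact: cvg_cst.
  by apply: cvgM; [exact: cvg_cst|apply: cvgB => //; exact: cvg_cst].
by apply: mxcvg_cont => //; exact: is_mxderive_cont (is_mxderive_prodint cA a).
Unshelve. all: by end_near. Qed.

(* x_k is driven by one-step factors Q(u_k, u_(k+1)) that agree with the product
   integral of A to first order; so the products converge to product integrals. *)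
Lemma euler_cvg n (A : R -> 'M[R]_n) (Q : R -> R -> 'M[R]_n) (T : R) p
    (x : nat -> nat -> 'M[R]_(p, n)) (u : nat -> nat -> R) (h : nat -> R)
    (i j : nat -> nat) (xl : 'M[R]_(p, n)) (a b : R) : mxcont A ->
  (forall e, 0 < e -> exists2 del : R, 0 < del & forall u v, 0 <= u -> u <= v ->
     v <= T -> v - u <= del -> nrm (Q u v - 1%:M - (v - u) *: A u) <= e * (v - u)) ->
  0 <= a -> (forall m, 0 <= h m) -> h m @[m --> \oo] --> (0 : R) ->
  (\forall m \near \oo, [/\ (i m <= j m)%N, a <= u m (i m), u m (j m) <= T &
     forall k, (i m <= k < j m)%N -> u m k.+1 = u m k + h m /\
        x m k.+1 = x m k *m Q (u m k) (u m k.+1)]) ->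
  mxcvg (fun m => x m (i m)) xl ->
  u m (i m) @[m --> \oo] --> a -> u m (j m) @[m --> \oo] --> b ->
  mxcvg (fun m => x m (j m)) (xl *m prodint A a b).
Proof.
move=> cA hQ a0 h0 hlim hn xi ua ub.
pose y m := x m (i m) *m prodint A (u m (i m)) (u m (j m)).
have yl : mxcvg y (xl *m prodint A a b).
  apply: mxcvgM => //; apply: (prodint_cvg (T := T)) => //; near=> m.
  have [ij h1 h2 hk] : [/\ (i m <= j m)%N, a <= u m (i m), u m (j m) <= T &
     forall k, (i m <= k < j m)%N -> u m k.+1 = u m k + h m /\
        x m k.+1 = x m k *m Q (u m k) (u m k.+1)] by near: m; exact: hn.
  split=> //; split=> //.
  have hl l : (i m + l <= j m)%N -> u m (i m) <= u m (i m + l)%N.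
    elim: l => [_|l IH il]; first by rewrite addn0.
    rewrite addnS in il *; apply: le_trans (IH (ltnW il)) _.
    by rewrite (hk _ _).1 ?il ?leq_addr// lerDl.
  by have := hl (j m - i m)%N; rewrite subnKC//; apply.
have xbd : \forall m \near \oo, nrm (x m (i m)) <= nrm xl + 1.
  move/cvgr0Pnorm_le : xi => /(_ 1 ltr01); apply: filterS => m h1.
  rewrite -[x m (i m)](subrK xl) addrC (le_trans (ler_nrmD _ _))// lerD2l.
  by apply: le_trans h1; exact: ler_norm.
have d0 : mxcvg (fun m => x m (j m) - y m) 0.
  apply/cvgr0Pnorm_le => e e0.
  have X0 : 0 < nrm xl + 1 by rewrite ltr_wpDl// nrm_ge0.
  have e10 : 0 < e / (nrm xl + 1) by rewrite divr_gt0.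
  have [del del0 hdel] := euler_product cA hQ e10.
  move/cvgr0Pnorm_le : hlim => /(_ _ del0) hlim.
  near=> m; rewrite ger0_norm ?nrm_ge0// subr0.
  have [ij h1 h2 hk] : [/\ (i m <= j m)%N, a <= u m (i m), u m (j m) <= T &
     forall k, (i m <= k < j m)%N -> u m k.+1 = u m k + h m /\
        x m k.+1 = x m k *m Q (u m k) (u m k.+1)] by near: m; exact: hn.
  have hm : h m <= del.
    by apply: le_trans (ler_norm _) _; near: m; exact: hlim.
  have := hdel p (fun k => x m (i m + k)%N) (fun k => u m (i m + k)%N) (j m - i m)%N
    (h m) (h0 m) hm.
  rewrite !addn0 subnKC// => /(_ (le_trans a0 h1) h2) hh.
  apply: le_trans (hh _ _) _.
  - by move=> k kj; rewrite addnS (hk _ _).1// leq_addr/= -ltn_subRL.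
  - by move=> k kj; rewrite addnS (hk _ _).2// leq_addr/= -ltn_subRL.
  - rewrite mulrAC ler_pdivrMr// ler_wpM2l ?(ltW e0)//.
    by near: m; exact: xbd.
rewrite -[X in mxcvg _ X]add0r; have d1 := mxcvgD d0 yl.
apply: mxcvg_near_eq d1; near=> m.
by rewrite subrK.
Unshelve. all: by end_near. Qed.

End MatrixLimits.

Section BlockSteps.
Variables (R : realType) (J : nat) (d : 'I_J.+1 -> nat) (M : R -> 'M[R]_(dbar d)).
Hypothesis cM : mxcont M.
Notation E := (Emx R d).

(** Compressing a full transition matrix to block y gives, to first order, the step of the
    sub-intensity M_yy: leaving y and returning within one step is a second-order effect. Products
    of compressed steps therefore tend to the product integral of the diagonal block. *)
Lemma blk_first_order y (T e : R) : 0 < e -> exists2 del : R, 0 < del &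
  forall u v, 0 <= u -> u <= v -> v <= T -> v - u <= del ->
  nrm ((E y)^T *m prodint M u v *m E y - 1%:M - (v - u) *: blkf M y y u) <= e * (v - u).
Proof.
move=> e0.
pose c := nrm (E y)^T * nrm (E y).
have c0 : 0 <= c by rewrite mulr_ge0 ?nrm_ge0.
have e10 : 0 < e / (c + 1) by rewrite divr_gt0// ltr_wpDl.
have [del del0 h] := prodint_first_order cM 0 T e10.
exists del => // u v u0 uv vT vu.
have -> : (E y)^T *m prodint M u v *m E y - 1%:M - (v - u) *: blkf M y y u =
  (E y)^T *m (prodint M u v - 1%:M - (v - u) *: M u) *m E y.
  by rewrite !mulmxBr !mulmxBl mulmx1 mulTEmx /blkf -scalemxAr -scalemxAl.
rewrite (le_trans (ler_nrmM _ _))//.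
rewrite (le_trans (ler_wpM2r (nrm_ge0 _) (ler_nrmM _ _)))// mulrAC -/c.
apply: (@le_trans _ _ (c * (e / (c + 1) * (v - u)))).
  by rewrite ler_wpM2l// h.
rewrite mulrA ler_wpM2r ?subr_ge0// mulrCA -[leRHS]mulr1 ler_wpM2l ?(ltW e0)//.
by rewrite ler_pdivrMr ?ltr_wpDl// mul1r lerDl.
Qed.

End BlockSteps.

(** * Jump times and durations *)

Lemma ex_harmonic_lt (R : realType) (e : R) : 0 < e -> exists p : nat, p.+1%:R^-1 < e.
Proof.
move=> e0; have /cvgrPdist_lt/(_ _ e0)[p _ /(_ p (leqnn p)) hp] := @cvg_harmonic R.
by exists p; move: hp; rewrite sub0r normrN ger0_norm// harmonic_ge0.
Qed.

Section Paths.
Variables (R : realType) (dsp : measure_display) (Omega : measurableType dsp).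
Variables (J : nat) (d : 'I_J.+1 -> nat) (X : R -> Omega -> state d) (w : Omega).
Notation Z v := (Defs.Zp X v w).
Notation jump := (isjump X w).
Notation T := (jumpT X w).

Hypothesis Zright : forall t : R, 0 <= t ->
  exists2 eps : R, 0 < eps & forall v : R, t <= v < t + eps -> Z v = Z t.
Hypothesis Zleft : forall t : R, 0 < t ->
  exists2 eps : R, 0 < eps & exists y, forall v : R, t - eps < v < t -> Z v = y.

Lemma isjump_neq (c u : R) : c < u -> jump u -> exists2 v, c < v < u & Z v != Z u.
Proof.
move=> cu [u0 /(_ (u - c))]; rewrite subr_gt0 => /(_ cu)[v []].
by rewrite opprB addrC subrK => h1 h2; exists v.
Qed.

Lemma no_jump_right (c : R) : 0 <= c ->
  exists2 eps : R, 0 < eps & forall u, c < u < c + eps -> ~ jump u.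
Proof.
move=> c0; have [eps eps0 h] := Zright c0; exists eps => // u /andP[cu uc] ju.
have [v /andP[cv vu]] := isjump_neq cu ju.
by rewrite h ?h ?eqxx// ?(ltW cv) ?(lt_trans vu)// (ltW cu).
Qed.

(** Otherwise let tau be the infimum of the times at which Z differs from [Z a]. By right continuity
    Z already differs at tau, so tau is a jump in (a, b]. *)
Lemma no_jump_const (a b : R) : 0 <= a -> (forall u, a < u <= b -> ~ jump u) ->
  forall v, a <= v <= b -> Z v = Z a.
Proof.
move=> a0 nj v0 /andP[av0 v0b]; apply: contrapT => ne.
pose S := [set v | a <= v <= b /\ Z v != Z a].
have Sv0 : S v0 by split; [rewrite av0|apply/eqP].
have hinf : has_inf S by split; [exists v0|exists a => v [/andP[]]].
pose tau := inf S.
have atau : a <= tau by apply: lb_le_inf; [exists v0|move=> v [/andP[]]].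
have tauv0 : tau <= v0 by apply: ge_inf => //; exact: hinf.2.
have before v : a <= v < tau -> Z v = Z a.
  move=> /andP[av vt]; apply: contrapT => ne'.
  have : tau <= v.
    apply: ge_inf; first exact: hinf.2.
    split; last exact/eqP.
    by rewrite av (le_trans (ltW vt))// (le_trans tauv0).
  by rewrite leNgt vt.
have Ztau : Z tau != Z a.
  apply/eqP => Zt.
  have [eps eps0 h] := Zright (le_trans a0 atau).
  have [v Sv vt] := inf_adherent eps0 hinf.
  have [/andP[av vb] /eqP] := Sv; apply; rewrite -Zt; apply: h; rewrite vt andbT.
  by apply: ge_inf => //; exact: hinf.2.
have lt_atau : a < tau.
  by rewrite lt_neqAle atau andbT; apply/eqP => e; move: Ztau; rewrite -e eqxx.
apply: (nj tau); first by rewrite lt_atau (le_trans tauv0).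
split; first exact: le_lt_trans lt_atau.
(* The witness must lie in (a, tau), where Z still has its old value, and within e of tau. *)
move=> e e0; exists (Num.max ((a + tau) / 2) (tau - e / 2)).
have m1 : a < (a + tau) / 2 < tau by apply/andP; split; lra.
split.
  rewrite lt_max gt_max; apply/andP; split.
    by apply/orP; right; lra.
  by apply/andP; split; lra.
rewrite before; first by rewrite eq_sym.
by rewrite le_max gt_max (ltW (andP m1).1)/= (andP m1).2/=; lra.
Qed.

(** Right continuity leaves a jump-free interval after every time. Applied at c it separates the
    infimum from c; applied at the infimum it shows that the infimum is attained. *)
Lemma next_jump (c : R) : 0 <= c ->
  let e := ereal_inf [set u%:E | u in [set u | jump u /\ (c%:E < u%:E)%E]] in
  (e = +oo%E /\ forall u, c < u -> ~ jump u) \/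
  exists tau, [/\ e = tau%:E, c < tau, jump tau & forall u, c < u < tau -> ~ jump u].
Proof.
move=> c0 e.
have [[u0 [ju0 cu0]]|nj] := pselect (exists u, jump u /\ c < u); last first.
  left; split; last by move=> u cu ju; apply: nj; exists u.
  rewrite /e (_ : [set _ | _ in _] = set0) ?ereal_inf0//.
  apply/seteqP; split => // x [u [ju]]; rewrite lte_fin => cu _.
  by apply: nj; exists u.
right.
pose S := [set u | jump u /\ c < u].
have hinf : has_inf S by split; [exists u0|exists c => u [_ /ltW]].
have [eps eps0 h] := no_jump_right c0.
have ctau : c < inf S.
  apply: (@lt_le_trans _ _ (c + eps)); first by rewrite ltrDl.
  apply: lb_le_inf; first by exists u0.
  by move=> u [ju cu]; rewrite leNgt; apply/negP => uc; apply: (h u) => //; rewrite cu.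
have jtau : jump (inf S).
  have [eps' eps'0 h'] := no_jump_right (le_trans c0 (ltW ctau)).
  have [u Su ut] := inf_adherent eps'0 hinf.
  have : inf S <= u by apply: ge_inf => //; exact: hinf.2.
  rewrite le_eqVlt => /predU1P[->|lt]; first exact: Su.1.
  by case: (h' u) => //; [rewrite lt|exact: Su.1].
exists (inf S); split => //.
  apply/eqP; rewrite eq_le; apply/andP; split.
    by apply: ereal_inf_lbound; exists (inf S).
  apply: le_ereal_inf_tmp => x [u [ju]]; rewrite lte_fin => cu <-.
  by rewrite lee_fin; apply: ge_inf; [exact: hinf.2|split].
move=> u /andP[cu uS] ju.
have : inf S <= u by apply: ge_inf; [exact: hinf.2|split].
by rewrite leNgt uS.
Qed.

(** This split hides the extended-real infimum: no n-th jump, a last jump, or a further jump with a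
    jump-free gap before it. *)
Lemma jumpT_cases n :
  (T n = +oo%E /\ T n.+1 = +oo%E) \/
  exists c, [/\ T n = c%:E, 0 <= c &
   (T n.+1 = +oo%E /\ forall u, c < u -> ~ jump u) \/
   exists tau, [/\ T n.+1 = tau%:E, c < tau, jump tau &
     forall u, c < u < tau -> ~ jump u]].
Proof.
have top k : T k = +oo%E -> T k.+1 = +oo%E.
  move=> /= ->; rewrite (_ : [set _ | _ in _] = set0) ?ereal_inf0//.
  by apply/seteqP; split => // x [u [_]]; rewrite ltNge leey.
have next k c : T k = c%:E -> 0 <= c -> (T k.+1 = +oo%E /\ forall u, c < u -> ~ jump u) \/
   exists tau, [/\ T k.+1 = tau%:E, c < tau, jump tau &
     forall u, c < u < tau -> ~ jump u].
  by move=> /= -> c0; exact: next_jump.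
elim: n => [|n [[h1 h2]|[c [h1 c0 [[h2 h3]|[tau [h2 ct jt h3]]]]]]].
- by right; exists 0; split => //; apply: next.
- by left; split => //; exact: top.
- by left; split => //; exact: top.
- have t0 : 0 <= tau by exact: le_trans c0 (ltW ct).
  by right; exists tau; split => //; exact: next.
Qed.

Lemma jumpT_leS n : (T n <= T n.+1)%E.
Proof.
have [[-> ->]//|[c [-> c0 [[-> _]|[tau [-> ct _ _]]]]]] := jumpT_cases n.
  exact: leey.
by rewrite lee_fin ltW.
Qed.

Lemma jumpT_mono m n : (m <= n)%N -> (T m <= T n)%E.
Proof.
elim: n => [|n IH]; first by rewrite leqn0 => /eqP ->.
rewrite leq_eqVlt => /predU1P[->//|]; rewrite ltnS => /IH h.
exact: le_trans h (jumpT_leS n).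
Qed.

Lemma jumpT_unique (t : R) m n : (T m <= t%:E)%E -> (t%:E < T m.+1)%E ->
  (T n <= t%:E)%E -> (t%:E < T n.+1)%E -> m = n.
Proof.
move=> h1 h2 h3 h4; case: (ltngtP m n) => // mn.
- by have := le_lt_trans (le_trans (jumpT_mono mn) h3) h2; rewrite ltxx.
- by have := le_lt_trans (le_trans (jumpT_mono mn) h1) h4; rewrite ltxx.
Qed.

Lemma jumpT_const n c v : T n = c%:E -> (c%:E <= v%:E < T n.+1)%E -> Z v = Z c.
Proof.
move=> Tn /andP[cv vT].
have [[]|[c' [Tn' c0 h]]] := jumpT_cases n; first by rewrite Tn.
have ec : c' = c by move: Tn'; rewrite Tn => -[].
subst c'; rewrite lee_fin in cv.
apply: (@no_jump_const c v) => //; last by rewrite cv lexx.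
move=> u /andP[cu uv]; case: h => [[_ /(_ u cu)]//|[tau [E ct jt /(_ u)]]].
by apply; rewrite cu/= (le_lt_trans uv)// -lte_fin -E.
Qed.

(** Non-explosion. If all jump times stayed below t, they would increase strictly to a supremum, and
    Z would change infinitely often just before it, against the constancy of Z on a left
    neighbourhood. *)
Lemma jumpT_exists (t : R) : 0 <= t -> exists n, (T n <= t%:E)%E /\ (t%:E < T n.+1)%E.
Proof.
move=> t0; apply: contrapT => /forallNP nex.
have Tt n : (T n <= t%:E)%E.
  elim: n => [|n IH]; first by rewrite lee_fin.
  by rewrite leNgt; apply/negP => h; apply: (nex n).
have /choice[c hc] n : exists c, T n = c%:E /\ 0 <= c /\ c <= t /\
    exists tau, [/\ T n.+1 = tau%:E, c < tau & jump tau].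
  have [[h _]|[c [h c0 [[h2 _]|[tau [h2 ct jt _]]]]]] := jumpT_cases n.
  - by have := Tt n; rewrite h leye_eq.
  - by have := Tt n.+1; rewrite h2 leye_eq.
  - by exists c; split => //; split => //; split; [rewrite -lee_fin -h|exists tau].
have cS n : c n < c n.+1 /\ jump (c n.+1).
  have [_ [_ [_ [tau [h1 h2 h3]]]]] := hc n; have [h4 _] := hc n.+1.
  by have -> : c n.+1 = tau by move: h4; rewrite h1 => -[].
have cS' : has_sup (range c).
  by split; [exists (c 0%N), 0%N|exists t => _ [n _ <-]; have [_ [_ []]] := hc n].
have sup_lt n : c n < sup (range c).
  apply: lt_le_trans (cS n).1 _; apply: sup_ubound; first exact: cS'.2.
  by exists n.+1.
have s0 : 0 < sup (range c) by apply: le_lt_trans (sup_lt 0%N); have [_ []] := hc 0%N.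
have [eps eps0 [y hy]] := Zleft s0.
have [_ [n _ <-] hn] := sup_adherent eps0 cS'.
have [v /andP[cv vc]] := isjump_neq (cS n).1 (cS n).2.
rewrite !hy ?eqxx//; apply/andP; split => //.
- exact: lt_trans hn (cS n).1.
- exact: lt_trans hn cv.
- exact: lt_trans vc (sup_lt _).
Qed.

Lemma jumpT_isjump n c : T n.+1 = c%:E -> jump c.
Proof.
move=> Tc; have [[_]|[c' [_ _ [[]|[tau [h2 _ jt _]]]]]] := jumpT_cases n.
- by rewrite Tc.
- by rewrite Tc.
- by move: h2; rewrite Tc => -[->].
Qed.

(** A margin 1/(p+1) replaces the strict inequality for a supremum, so the duration event becomes a
    countable union of events on which Z is constant on an interval. *)
Lemma Udur_gt (s z : R) : 0 <= s -> 0 <= z -> z < Udur X s w <->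
  exists p : nat, 0 <= s - z - p.+1%:R^-1 /\
    forall v : R, s - z - p.+1%:R^-1 <= v <= s -> Z v = Z s.
Proof.
move=> s0 z0; rewrite /Udur; set S := [set r | _].
have hS : has_sup S.
  split; last by exists s => r [/andP[]].
  exists 0; split; first by rewrite lexx.
  by move=> v; rewrite subr0 => h; rewrite (_ : v = s)//; apply/eqP; rewrite eq_le andbC.
split => [zS|[p [p0 hp]]].
  have [r Sr zr] := sup_gt hS.1 zS.
  case: Sr => /andP[r0 rs] hr.
  have [p hp] : exists p : nat, p.+1%:R^-1 < r - z by apply: ex_harmonic_lt; rewrite subr_gt0.
  exists p; move: hp; set q : R := p.+1%:R^-1 => hp; split; first by lra.
  by move=> v /andP[h1 h2]; apply: hr; rewrite h2 andbT; lra.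
have p1 : 0 < p.+1%:R^-1 :> R by rewrite invr_gt0.
move: p1 p0 hp; set q : R := p.+1%:R^-1 => p1 p0 hp.
apply: (@lt_le_trans _ _ (z + q)); first by rewrite ltrDl.
apply: sup_ubound; first exact: hS.2.
split; first by apply/andP; split; lra.
by move=> v /andP[h1 h2]; apply: hp; rewrite h2 andbT; lra.
Qed.

(** The condition on the last jump becomes constancy of Z on an interval inside [0, t]; this is what
    puts it into F^Z(t). *)
Lemma jumpT_lt_iff (t u c : R) n : T n = c%:E -> c <= t -> (t%:E < T n.+1)%E -> u <= t ->
  c < u <-> exists p : nat, 0 <= u - p.+1%:R^-1 /\
    forall v : R, u - p.+1%:R^-1 <= v <= t -> Z v = Z t.
Proof.
move=> Tc ct tT ut.
have c0 : 0 <= c.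
  by have [[]|[c' []]] := jumpT_cases n; rewrite Tc// => -[->].
have cst (v : R) : c <= v <= t -> Z v = Z t.
  move=> /andP[cv vt]; rewrite (jumpT_const Tc) ?(@jumpT_const n c t)// lee_fin.
    by rewrite ct.
  by rewrite cv/= (le_lt_trans _ tT)// lee_fin.
split => [cu|[p [p0 hp]]].
  have uc : 0 < u - c by rewrite subr_gt0.
  have [p hp] := ex_harmonic_lt uc.
  exists p; move: hp; set q : R := p.+1%:R^-1 => hp; split; first by lra.
  by move=> v /andP[h1 h2]; apply: cst; rewrite h2 andbT; lra.
rewrite ltNge; apply/negP => uc.
have p1 : 0 < p.+1%:R^-1 :> R by rewrite invr_gt0.
move: p1 p0 hp; set q : R := p.+1%:R^-1 => p1 p0 hp.
have cp : u - q < c by lra.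
(* T_0 = 0 is not a jump, but c = 0 contradicts 0 <= u - q < c. *)
case: n Tc tT => [|n] Tc tT.
  by move: Tc => /= -[c00]; lra.
have [v /andP[v1 v2]] := isjump_neq cp (jumpT_isjump Tc).
by rewrite !hp ?eqxx// ?(ltW cp) ?ct// (ltW v1)/= ltW// (lt_le_trans v2).
Qed.

Lemma Udur_gt_split (t s z c : R) n : T n = c%:E -> c <= t -> (t%:E < T n.+1)%E ->
  t <= s -> 0 <= z -> s - z <= t -> 0 <= t ->
  z < Udur X s w <-> c < s - z /\ forall v : R, t <= v <= s -> Z v = Z s.
Proof.
move=> Tc ct tT ts z0 szt t0.
rewrite (Udur_gt (le_trans t0 ts) z0) (jumpT_lt_iff Tc ct tT szt).
split=> [[p [p0 hp]]|[[p [p0 hp]] hs]].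
  have p1 : 0 < p.+1%:R^-1 :> R by rewrite invr_gt0.
move: p1 p0 hp; set q : R := p.+1%:R^-1 => p1 p0 hp.
  split.
    exists p; split=> // v /andP[h1 h2]; rewrite !hp ?h1 ?(le_trans h2)//.
    by apply/andP; split; lra.
  by move=> v /andP[h1 h2]; apply: hp; rewrite h2 andbT; lra.
exists p; split => // v /andP[h1 h2]; have [vt|tv] := leP v t.
  by rewrite hp ?h1// hs// lexx.
by rewrite hs// h2 ltW.
Qed.

End Paths.

(** * Dyadic grids *)

Section DyadicGrid.
Variable R : realType.

Definition grid (a b : R) (m k : nat) : R := a + (b - a) / 2 ^+ m * k%:R.

Lemma grid0 a b m : grid a b m 0 = a. Proof. by rewrite /grid mulr0 addr0. Qed.

Lemma grid_last a b m : grid a b m (2 ^ m) = b.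
Proof. by rewrite /grid natrX divfK ?expf_neq0// addrC subrK. Qed.

Lemma gridS a b m k : grid a b m k.+1 = grid a b m k + (b - a) / 2 ^+ m.
Proof. by rewrite /grid -natr1; ring. Qed.

Lemma grid_step_ge0 (a b : R) m : a <= b -> 0 <= (b - a) / 2 ^+ m.
Proof. by move=> ab; rewrite divr_ge0 ?exprn_ge0 ?subr_ge0. Qed.

Lemma grid_le a b m k l : a <= b -> (k <= l)%N -> grid a b m k <= grid a b m l.
Proof. by move=> ab kl; rewrite lerD2l ler_wpM2l ?grid_step_ge0// ler_nat. Qed.

Lemma grid_ge a b m k : a <= b -> a <= grid a b m k.
Proof. by move=> ab; rewrite -{1}(grid0 a b m) grid_le. Qed.

Lemma grid_le_last a b m k : a <= b -> (k <= 2 ^ m)%N -> grid a b m k <= b.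
Proof. by move=> ab km; rewrite -{2}(grid_last a b m) grid_le. Qed.

Lemma grid_refine a b m p k : grid a b (m + p) (k * 2 ^ p) = grid a b m k.
Proof.
rewrite /grid natrM natrX exprD invfM -!mulrA; congr (_ + _ * (_ * _)).
by rewrite mulrCA mulVf ?mulr1// expf_neq0.
Qed.

Lemma cvg_grid_step a b : (b - a) / 2 ^+ m @[m --> \oo] --> (0 : R).
Proof.
rewrite -[X in _ --> X](mulr0 (b - a)); apply: cvgMr.
under eq_fun do rewrite -exprVn.
by apply: cvg_expr; rewrite ger0_norm ?invf_lt1 ?ltr1n// invr_ge0.
Qed.

Lemma grid_ceil a b v m : a <= v <= b -> exists k,
  [/\ (k <= 2 ^ m)%N, v <= grid a b m k & forall l, (l < k)%N -> grid a b m l < v].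
Proof.
move=> /andP[av vb]; have ex : exists k, v <= grid a b m k.
  by exists (2 ^ m)%N; rewrite grid_last.
case: (ex_minnP ex) => k vk kmin; exists k; split => //.
  by apply: kmin; rewrite grid_last.
by move=> l lk; rewrite ltNge; apply/negP => /kmin; rewrite leqNgt lk.
Qed.

Lemma grid_ceil_le a b v m k : a <= v <= b ->
  (forall l, (l < k)%N -> grid a b m l < v) -> grid a b m k <= v + (b - a) / 2 ^+ m.
Proof.
move=> /andP[av vb]; case: k => [|k] h.
  by rewrite grid0 ler_wpDr// grid_step_ge0// (le_trans av).
by rewrite gridS lerD2r ltW// h.
Qed.

(** Z does not change on some [v, v + eps), and a fine enough grid has a point there; since b is on
    every grid, that point can be taken at most b. *)
Lemma const_grid (T : Type) (Z : R -> T) (a b : R) : 0 <= a -> a <= b ->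
  (forall t : R, 0 <= t ->
    exists2 eps : R, 0 < eps & forall v : R, t <= v < t + eps -> Z v = Z t) ->
  (forall v, a <= v <= b -> Z v = Z b) <->
  (forall m k, (k <= 2 ^ m)%N -> Z (grid a b m k) = Z b).
Proof.
move=> a0 ab Zr; split => [h m k km|h v vab].
  by apply: h; rewrite grid_ge// grid_le_last.
have [eps eps0 hv] := Zr v (le_trans a0 (andP vab).1).
have /cvgrPdist_lt/(_ _ eps0)[m _ /(_ m (leqnn m)) hm] := cvg_grid_step a b.
have {}hm : (b - a) / 2 ^+ m < eps.
  by move: hm; rewrite sub0r normrN ger0_norm// grid_step_ge0.
have [k [km vk hk]] := grid_ceil m vab.
rewrite -(h m k km) hv// vk/= (le_lt_trans (grid_ceil_le vab hk))//.
by rewrite ltrD2l.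
Qed.

End DyadicGrid.

(** * Pathwise limit of the filter on dyadic grids *)

Section Histories.
Variables (R : realType) (J : nat) (d : 'I_J.+1 -> nat) (M : R -> 'M[R]_(dbar d)).
Variable pi1 : 'rV[R]_(d ord0).
Notation E := (Emx R d).

Lemma alpha_ext_rcons v p l q : let r := last p l in
  alpha_ext M v p (rcons l q) =
  alpha_ext M v p l *m E r.2 *m prodint (blkf M r.2 r.2) r.1 q.1
    *m blkf M r.2 q.2 q.1 *m (E q.2)^T.
Proof. by elim: l v p => [|q' l IH] v p //=; rewrite IH. Qed.

Lemma alpha_bar_rcons sn q : sn != [::] -> let r := last (0, ord0) sn in
  alpha_bar M pi1 (rcons sn q) =
  alpha_bar M pi1 sn *m E r.2 *m prodint (blkf M r.2 r.2) r.1 q.1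
    *m blkf M r.2 q.2 q.1 *m (E q.2)^T.
Proof. by case: sn => [//|p l] _ /=; rewrite alpha_ext_rcons. Qed.

(* Unnormalized filter along the observations z_0, z_1, ... of the macrostate at
   the times u_0, u_1, ..., with an extra factor c(z_k, z_(k+1)) per step. *)
Fixpoint filt (c : 'I_J.+1 -> 'I_J.+1 -> R) (u : nat -> R) (z : nat -> 'I_J.+1)
    (k : nat) : 'rV[R]_(dbar d) :=
  match k with
  | 0%N => pi1 *m (E ord0)^T *m Pimx R d (z 0%N)
  | k'.+1 => c (z k') (z k'.+1) *:
      (filt c u z k' *m prodint M (u k') (u k'.+1) *m Pimx R d (z k'.+1))
  end.

Lemma filt_Pimx c u z k : filt c u z k *m Pimx R d (z k) = filt c u z k.
Proof. by case: k => [|k] /=; rewrite -?scalemxAl -mulmxA Pimx_idem. Qed.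

Lemma filt_EE c u z k : filt c u z k *m E (z k) *m (E (z k))^T = filt c u z k.
Proof. by rewrite -mulmxA filt_Pimx. Qed.

(* A step of length t / 2 ^ m with a jump contributes a factor of order t / 2 ^ m,
   which [jfac] compensates up to the t. *)
Definition jfac (m : nat) (y y' : 'I_J.+1) : R := if y == y' then 1 else 2 ^+ m.

End Histories.

Section PathLimit.
Variables (R : realType) (dsp : measure_display) (Omega : measurableType dsp).
Variables (J : nat) (d : 'I_J.+1 -> nat) (X : R -> Omega -> state d) (w : Omega).
Variables (M : R -> 'M[R]_(dbar d)) (pi1 : 'rV[R]_(d ord0)) (t : R).
Notation E := (Emx R d).
Notation Z v := (Defs.Zp X v w).
Notation jump := (isjump X w).
Notation T := (jumpT X w).
Hypothesis cM : mxcont M.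
Hypothesis t0 : 0 <= t.
Hypothesis Zright : forall t : R, 0 <= t ->
  exists2 eps : R, 0 < eps & forall v : R, t <= v < t + eps -> Z v = Z t.
Hypothesis Zleft : forall t : R, 0 < t ->
  exists2 eps : R, 0 < eps & exists y, forall v : R, t - eps < v < t -> Z v = y.

Lemma Shist_rcons n : Shist X w n.+1 =
  rcons (Shist X w n) (fine (T n.+1), Z (fine (T n.+1))).
Proof.
rewrite /Shist (_ : iota 0 n.+2 = iota 0 n.+1 ++ [:: n.+1]) ?map_cat ?cats1 ?map_rcons//.
by rewrite -cats1 -[in LHS](addn1 n.+1) iotaD.
Qed.

Lemma last_Shist n x : last x (Shist X w n) = (fine (T n), Z (fine (T n))).
Proof. by case: n => [//|n]; rewrite Shist_rcons last_rcons. Qed.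

Lemma alpha_bar_Shist n c tau : T n = c%:E -> T n.+1 = tau%:E ->
  alpha_bar M pi1 (Shist X w n.+1) = alpha_bar M pi1 (Shist X w n) *m E (Z c)
    *m prodint (blkf M (Z c) (Z c)) c tau *m blkf M (Z c) (Z tau) tau *m (E (Z tau))^T.
Proof.
move=> Tc Tt; rewrite Shist_rcons alpha_bar_rcons; last by [].
by cbv zeta; rewrite last_Shist Tc Tt.
Qed.

Let u m k := grid 0 t m k.
Let z m k := Z (u m k).
Let b m := filt M pi1 (jfac R m) (u m) (z m).
Let h m : R := t / 2 ^+ m.

Let uS m k : u m k.+1 = u m k + h m.
Proof. by rewrite /u gridS subr0. Qed.

Let bS m k : b m k.+1 = jfac R m (z m k) (z m k.+1) *:
  (b m k *m prodint M (u m k) (u m k.+1) *m Pimx R d (z m k.+1)).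
Proof. by []. Qed.

Let h_ge0 m : 0 <= h m.
Proof. by have := grid_step_ge0 m t0; rewrite subr0. Qed.

Let h_lim : h m @[m --> \oo] --> (0 : R).
Proof. by have := @cvg_grid_step R 0 t; rewrite subr0. Qed.

Let near_h (e : R) : 0 < e -> \forall m \near \oo, h m < e.
Proof.
move=> e0; move/cvgrPdist_lt : h_lim => /(_ _ e0); apply: filterS => m.
by rewrite sub0r normrN ger0_norm.
Qed.

(* Between jumps the filter follows the product integral of the diagonal block. *)
Lemma filt_between n c (i j : nat -> nat) (xl : 'rV[R]_(dbar d)) (v : R) :
  T n = c%:E -> c <= t ->
  (\forall m \near \oo, [/\ (i m <= j m)%N, c <= u m (i m), u m (j m) <= t &
      ((u m (j m))%:E < T n.+1)%E]) ->
  u m (i m) @[m --> \oo] --> c -> u m (j m) @[m --> \oo] --> v ->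
  mxcvg (fun m => b m (i m)) xl ->
  mxcvg (fun m => b m (j m))
    (xl *m E (Z c) *m prodint (blkf M (Z c) (Z c)) c v *m (E (Z c))^T).
Proof.
move=> Tc ct hn ui uj bl; set y := Z c.
have c0 : 0 <= c.
  by have [[]|[c' []]] := jumpT_cases Zright n; rewrite Tc// => -[->].
have zy m k : (i m <= j m)%N -> c <= u m (i m) -> ((u m (j m))%:E < T n.+1)%E ->
    (i m <= k <= j m)%N -> z m k = y.
  move=> ij cu uT /andP[ik kj]; apply: (jumpT_const Zright Tc).
  rewrite lee_fin (le_trans cu) ?grid_le//=.
  by apply: le_lt_trans uT; rewrite lee_fin grid_le.
(* In the coordinates of block y each step is multiplication by the compressed transition matrix, so
   the Euler limit applies with A = M_yy. *)
have key : mxcvg (fun m => b m (j m) *m E y)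
    (xl *m E y *m prodint (blkf M y y) c v).
  apply: (@euler_cvg R _ (blkf M y y) (fun u v => (E y)^T *m prodint M u v *m E y) t
    _ (fun m k => b m k *m E y) u h i j) => //.
  - exact: mxcont_blkf.
  - by move=> e e0; exact: blk_first_order.
  - near=> m.
    have [ij cu ut uT] : [/\ (i m <= j m)%N, c <= u m (i m), u m (j m) <= t &
      ((u m (j m))%:E < T n.+1)%E] by near: m; exact: hn.
    split => // k /andP[ik kj]; split => //=.
    have zk : z m k = y by apply: zy => //; rewrite ik ltnW.
    have zk1 : z m k.+1 = y by apply: zy => //; rewrite kj andbT leqW.
    have hb : b m k *m E y *m (E y)^T = b m k by rewrite -zk filt_EE.
    by rewrite bS zk zk1 /jfac eqxx scale1r -[LHS]mulmxA Pimx_Emx !mulmxA hb.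
  - exact: mxcvgM bl (mxcvg_cst _).
apply: (mxcvg_near_eq _ (mxcvgM key (mxcvg_cst (E y)^T))); near=> m.
have [ij cu ut uT] : [/\ (i m <= j m)%N, c <= u m (i m), u m (j m) <= t &
  ((u m (j m))%:E < T n.+1)%E] by near: m; exact: hn.
have zj : z m (j m) = y by apply: zy => //; rewrite ij leqnn.
by have := filt_EE M pi1 (jfac R m) (u m) (z m) (j m); rewrite -/(b m) zj.
Unshelve. all: by end_near. Qed.

(** The projections onto different blocks annihilate the identity in 1 + h M + o(h). What remains
    has order h = t / 2^m, and the factor 2^m leaves t M(tau). *)
Lemma prodint_jump (tau : R) (k : nat -> nat) y y' : 0 <= tau -> y != y' ->
  (\forall m \near \oo, [/\ u m (k m) <= tau, tau <= u m (k m).+1 & (k m < 2 ^ m)%N]) ->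
  mxcvg (fun m => 2 ^+ m *: (Pimx R d y *m prodint M (u m (k m)) (u m (k m).+1) *m Pimx R d y'))
    (t *: (Pimx R d y *m M tau *m Pimx R d y')).
Proof.
move=> tau0 yy' hk.
have PP : Pimx R d y *m Pimx R d y' = 0.
  by rewrite /Pimx mulmxA -(mulmxA (E y)) mulTEmx_neq// mulmx0 mul0mx.
have key : mxcvg (fun m => 2 ^+ m *: (prodint M (u m (k m)) (u m (k m).+1) - 1%:M)) (t *: M tau).
  apply/cvgr0Pnorm_le => e e0.
  have e10 : 0 < e / (t + 1) by rewrite divr_gt0// ltr_wpDl.
  have [del del0 hdel] := prodint_first_order cM 0 t e10.
  near=> m; rewrite ger0_norm ?nrm_ge0//.
  have [h1 h2 h3] : [/\ u m (k m) <= tau, tau <= u m (k m).+1 & (k m < 2 ^ m)%N].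
    by near: m; exact: hk.
  have hm : h m <= del by apply: ltW; near: m; exact: near_h.
  have hd : u m (k m).+1 - u m (k m) = h m by rewrite uS addrAC subrr add0r.
  have := hdel (u m (k m)) tau (u m (k m).+1) (grid_ge _ _ t0) h1 h2
    (grid_le_last t0 h3).
  rewrite hd => /(_ hm) hh.
  have p2 : 0 < 2 ^+ m :> R by rewrite exprn_gt0.
  have -> : t *: M tau = 2 ^+ m *: (h m *: M tau).
    by rewrite scalerA /h mulrCA divff ?mulr1// gt_eqF.
  rewrite -scalerBr nrmZ (ger0_norm (ltW p2)).
  apply: (le_trans (ler_wpM2l (ltW p2) hh)).
  rewrite mulrCA /h [2 ^+ m * _]mulrCA divff ?mulr1 ?gt_eqF//.
  rewrite mulrAC ler_pdivrMr ?ltr_wpDl// ler_wpM2l ?(ltW e0)//.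
  by rewrite lerDl.
have := mxcvgM (mxcvgM (mxcvg_cst (Pimx R d y)) key) (mxcvg_cst (Pimx R d y')).
rewrite -scalemxAr -scalemxAl; apply: mxcvg_near_eq; near=> m.
rewrite -scalemxAr -scalemxAl mulmxBr mulmx1 mulmxBl PP subr0//.
Unshelve. all: by end_near. Qed.

Definition is_ceil (c : R) (i : nat -> nat) := forall m,
  [/\ (i m <= 2 ^ m)%N, c <= u m (i m) & forall l, (l < i m)%N -> u m l < c].

Lemma ex_is_ceil c : 0 <= c <= t -> exists i, is_ceil c i.
Proof.
move=> hc; have /choice[i hi] m := grid_ceil m hc.
by exists i => m; exact: hi.
Qed.

Lemma is_ceil_cvg c i : 0 <= c <= t -> is_ceil c i -> u m (i m) @[m --> \oo] --> c.
Proof.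
move=> hc hi; apply/subr_cvg0; apply: squeeze0 h_lim; near=> m.
have [i1 i2 i3] := hi m.
rewrite ger0_norm ?subr_ge0// lerBlDl.
by have := grid_ceil_le hc i3; rewrite subr0.
Unshelve. all: by end_near. Qed.

(** Induction over the jumps: [filt_between] runs from the ceiling of T_n to the last grid point
    before T_(n+1), then [prodint_jump] crosses the cell with the jump, contributing one factor t.
    The projection on the right matters only for n = 0, where it gives limit zero to paths that do
    not start in [ord0]. *)
Lemma filt_at_jumps n c i : T n = c%:E -> c <= t -> is_ceil c i ->
  mxcvg (fun m => b m (i m)) (t ^+ n *: (alpha_bar M pi1 (Shist X w n) *m Pimx R d (Z c))).
Proof.
elim: n c i => [|n IH] tau j Ttau taut hj.
  move: Ttau => /= -[e0]; move: hj; rewrite -e0 => hj.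
  rewrite expr0 scale1r.
  apply: mxcvg_near_eq (mxcvg_cst _); near=> m.
  have [_ _ h3] := hj m.
  have -> : j m = 0%N.
    case: (j m) h3 => // k /(_ 0%N isT).
    by rewrite ltNge grid_ge.
  by rewrite /b /= -/(z m 0%N) /z /u grid0.
have [[_]|[c [Tc c0 [[]|[tau' [Tt ctau jtau _]]]]]] := jumpT_cases Zright n.
- by rewrite Ttau.
- by rewrite Ttau.
have et : tau' = tau by move: Tt; rewrite Ttau => -[].
subst tau'.
have ct : c <= t by exact: le_trans (ltW ctau) taut.
have tau0 : 0 <= tau by exact: le_trans c0 (ltW ctau).
have hct : 0 <= c <= t by rewrite c0.
have htt : 0 <= tau <= t by rewrite tau0.
have [i hi] := ex_is_ceil hct.
set y := Z c; set y' := Z tau.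
have yy' : y != y'.
  have [v /andP[cv vt] hv] := isjump_neq ctau jtau.
  rewrite /y -(jumpT_const Zright Tc (v := v)) ?hv//.
  by apply/andP; split; [rewrite lee_fin ltW|rewrite Tt lte_fin].
have [eps eps0 heps] := Zright tau0.
(* For a fine grid, the cell ending at [j m] contains tau, begins no earlier than the ceiling of
   T_n, and ends before Z leaves its value at tau. *)
have j1 : \forall m \near \oo, [/\ (0 < j m)%N, (i m <= (j m).-1)%N, u m (j m).-1 < tau,
    tau <= u m (j m) & u m (j m) < tau + eps].
  near=> m.
  have hm : h m < tau - c by near: m; apply: near_h; rewrite subr_gt0.
  have hme : h m < eps by near: m; exact: near_h.
  have [i1 i2 i3] := hi m; have [jm1 jm2 jm3] := hj m.
  have ui : u m (i m) < tau.
    apply: le_lt_trans (grid_ceil_le hct i3) _.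
    by rewrite subr0 -/(h m) -ltrBrDl.
  have ij : (i m < j m)%N.
    rewrite ltnNge; apply/negP => ji; have := le_lt_trans (grid_le m t0 ji) ui.
    by rewrite ltNge jm2.
  have j0 : (0 < j m)%N by exact: leq_ltn_trans ij.
  split => //.
  - by rewrite -ltnS prednK.
  - by apply: jm3; rewrite prednK.
  - apply: le_lt_trans (grid_ceil_le htt jm3) _.
    by rewrite subr0 ltrD2l.
have step1 := @filt_between n c i (fun m => (j m).-1) _ tau Tc ct _
  (is_ceil_cvg hct hi) _ (IH c i Tc ct hi).
have {step1}step1 : mxcvg (fun m => b m (j m).-1)
   (t ^+ n *: (alpha_bar M pi1 (Shist X w n) *m Pimx R d y) *m E y *m
     prodint (blkf M y y) c tau *m (E y)^T).
  apply: step1.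
  - near=> m.
    have [h1 h2 h3 h4 h5] : [/\ (0 < j m)%N, (i m <= (j m).-1)%N, u m (j m).-1 < tau,
      tau <= u m (j m) & u m (j m) < tau + eps] by near: m.
    have [_ i2 _] := hi m.
    split => //; first by rewrite (le_trans (ltW h3)).
    by rewrite Tt lte_fin.
  - apply/subr_cvg0; apply: squeeze0 h_lim; near=> m.
    have [h1 h2 h3 h4 h5] : [/\ (0 < j m)%N, (i m <= (j m).-1)%N, u m (j m).-1 < tau,
      tau <= u m (j m) & u m (j m) < tau + eps] by near: m.
    move: h4; rewrite -{1}(prednK h1) uS => h4.
    rewrite ltr0_norm ?subr_lt0//; lra.
have step2 : mxcvg (fun m => 2 ^+ m *: (Pimx R d y *m
      prodint M (u m (j m).-1) (u m (j m).-1.+1) *m Pimx R d y'))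
    (t *: (Pimx R d y *m M tau *m Pimx R d y')).
  apply: prodint_jump => //; near=> m.
  have [h1 h2 h3 h4 h5] : [/\ (0 < j m)%N, (i m <= (j m).-1)%N, u m (j m).-1 < tau,
    tau <= u m (j m) & u m (j m) < tau + eps] by near: m.
  have [jm1 _ _] := hj m.
  by rewrite prednK//; split => //; exact: ltW.
have := mxcvgM step1 step2.
have -> : t ^+ n *: (alpha_bar M pi1 (Shist X w n) *m Pimx R d y) *m E y *m
     prodint (blkf M y y) c tau *m (E y)^T *m (t *: (Pimx R d y *m M tau *m Pimx R d y')) =
   t ^+ n.+1 *: (alpha_bar M pi1 (Shist X w n.+1) *m Pimx R d y').
  rewrite (alpha_bar_Shist Tc Ttau) -/y -/y'.
  rewrite -!scalemxAl -!scalemxAr scalerA -exprSr; congr (_ *: _).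
  rewrite /blkf -!mulmxA; congr (_ *m _).
  by rewrite /Pimx !mulKTEmx.
apply: mxcvg_near_eq; near=> m.
have [h1 h2 h3 h4 h5] : [/\ (0 < j m)%N, (i m <= (j m).-1)%N, u m (j m).-1 < tau,
    tau <= u m (j m) & u m (j m) < tau + eps] by near: m.
have [_ i2 _] := hi m.
have zj : z m (j m).-1 = y.
  apply: (jumpT_const Zright Tc); apply/andP; split.
    by rewrite lee_fin (le_trans i2)// grid_le.
  by rewrite Tt lte_fin.
have zj' : z m (j m).-1.+1 = y' by rewrite prednK// /z heps// h4.
have hb : b m (j m).-1 *m Pimx R d y = b m (j m).-1 by rewrite -zj filt_Pimx.
have -> : b m (j m) = b m (j m).-1.+1 by rewrite prednK.
rewrite bS zj zj' /jfac (negbTE yy') -scalemxAr; congr (_ *: _).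
by rewrite mulmxA (mulmxA _ (Pimx R d y)) hb.
Unshelve. all: by end_near. Qed.

Lemma filt_limit n c : T n = c%:E -> c <= t -> (t%:E < T n.+1)%E ->
  mxcvg (fun m => filt M pi1 (jfac R m) (grid 0 t m) (fun k => Z (grid 0 t m k)) (2 ^ m))
    (t ^+ n *: (alpha_bar M pi1 (Shist X w n) *m E (Z c) *m
       prodint (blkf M (Z c) (Z c)) c t *m (E (Z c))^T)).
Proof.
move=> Tc ct tT.
have c0 : 0 <= c.
  by have [[]|[c' []]] := jumpT_cases Zright n; rewrite Tc// => -[->].
have hct : 0 <= c <= t by rewrite c0.
have [i hi] := ex_is_ceil hct.
have ul m : u m (2 ^ m) = t by exact: grid_last.
have := @filt_between n c i (fun m => 2 ^ m)%N _ t Tc ct _ (is_ceil_cvg hct hi) _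
  (filt_at_jumps Tc ct hi).
rewrite -!scalemxAl -(mulmxA _ (Pimx R d (Z c))) Pimx_Emx; apply.
- by near=> m; have [h1 h2 h3] := hi m; rewrite ul.
- by rewrite (_ : (fun m => _) = cst t); [exact: cvg_cst|apply/funext => m].
Unshelve. all: by end_near. Qed.

End PathLimit.

(** * Limits of elementary conditional probabilities *)

Section FiniteValued.
Context {dsp : measure_display} {Omega : measurableType dsp} {R : realType}.
Variable P : probability Omega R.

Section OneMap.
Context {T : finType} (G : Omega -> T).
Hypothesis mG : forall z, measurable (G @^-1` [set z]).

Lemma preimage_pred (S : pred T) : G @^-1` [set z | S z] =
  \big[setU/set0]_(z <- [seq z <- enum T | S z]) (G @^-1` [set z]).
Proof.
rewrite -bigcup_seq; apply/seteqP; split => w /=.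
  by move=> Sw; exists (G w) => //=; rewrite mem_filter Sw mem_enum.
by move=> [z /=]; rewrite mem_filter => /andP[Sz _] ->.
Qed.

Lemma measurable_preimage_pred (S : pred T) : measurable (G @^-1` [set z | S z]).
Proof. by rewrite preimage_pred; apply: bigsetU_measurable => z _; exact: mG. Qed.

Lemma ge0_integral_fibers (S : pred T) (f : Omega -> \bar R) :
  measurable_fun setT f -> (forall w, 0 <= f w)%E ->
  (\int[P]_(w in G @^-1` [set z | S z]) f w =
   \sum_(z | S z) \int[P]_(w in G @^-1` [set z]) f w)%E.
Proof.
move=> mf f0; rewrite preimage_pred ge0_integral_bigsetU//.
- by rewrite big_filter big_enum_cond.
- by apply: filter_uniq; exact: enum_uniq.
- by move=> i j _ _ [w [/= <- <-]].
- exact: measurable_funTS.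
Qed.

Lemma total_prob (S : pred T) (A : set Omega) : measurable A ->
  P (A `&` G @^-1` [set z | S z]) = (\sum_(z | S z) P (A `&` G @^-1` [set z]))%E.
Proof.
move=> mA; rewrite -integral_indic//; last exact: measurable_preimage_pred.
rewrite ge0_integral_fibers//.
  by apply: eq_bigr => z _; rewrite integral_indic.
by apply/measurable_EFinP; exact: measurable_indic.
Qed.

Lemma measurable_comp_finite (f : T -> R) : measurable_fun setT (f \o G).
Proof.
move=> _ B mB; rewrite setTI.
rewrite (_ : _ @^-1` B = G @^-1` [set z | `[< B (f z) >]]); last first.
  by apply/seteqP; split => w /=; [move/asboolP|move/asboolP].
exact: measurable_preimage_pred.
Qed.

Lemma integral_comp_finite (S : pred T) (f : T -> R) : (forall z, 0 <= f z) ->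
  (\int[P]_(w in G @^-1` [set z | S z]) (f (G w))%:E =
   \sum_(z | S z) (f z)%:E * P (G @^-1` [set z]))%E.
Proof.
move=> f0; rewrite ge0_integral_fibers//.
- apply: eq_bigr => z _.
  rewrite -integral_cst//; apply: eq_integral => w; rewrite inE /= => -> //.
- by apply/measurable_EFinP; exact: measurable_comp_finite.
- by move=> w; rewrite lee_fin.
Qed.

End OneMap.

Lemma bounded_cvg_integral (B : set Omega) (f_ : nat -> Omega -> R) (f : Omega -> R) (c : R) :
  measurable B -> (forall m, measurable_fun setT (f_ m)) ->
  (forall w, f_ m w @[m --> \oo] --> f w) -> (forall m w, `|f_ m w| <= c) ->
  (\int[P]_(w in B) (f_ m w)%:E @[m --> \oo] --> \int[P]_(w in B) (f w)%:E)%E.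
Proof.
move=> mB mf_ f_f fc.
have mf : measurable_fun setT f.
  by apply: (measurable_fun_cvg mf_) => w _; exact: f_f.
have [] // := @dominated_convergence _ _ R P B mB (fun m w => (f_ m w)%:E)
  (fun w => (f w)%:E) (cst c%:E).
- by move=> m; apply: measurable_funTS; apply/measurable_EFinP; exact: mf_.
- by apply: measurable_funTS; apply/measurable_EFinP.
- by apply: aeW => w _; apply: cvg_EFin; [exact: nearW|exact: f_f].
- apply: (integrableS measurableT) => //.
  exact: finite_measure_integrable_cst.
- by apply: aeW => w m _; rewrite lee_fin.
Qed.

Section RatioMeasurable.
Context {T : nat -> finType} (G : forall m, Omega -> T m).
Variables (nm dn : forall m, T m -> R) (Num Den : Omega -> R).
Hypothesis mG : forall m z, measurable (G m @^-1` [set z]).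
Hypothesis nm_cvg : forall w, nm (G m w) @[m --> \oo] --> Num w.
Hypothesis dn_cvg : forall w, dn (G m w) @[m --> \oo] --> Den w.
Hypothesis NumDen : forall w, 0 <= Num w <= Den w.

(** Adding [ep p] keeps the denominators positive. Where Den vanishes so does Num, and the value 0
    of the quotient is the limit. The sigma-algebra is left general so that F^Z(t) can be
    inserted. *)
Lemma measurable_ratio : measurable_fun setT (fun w => Num w / Den w).
Proof.
pose ep (p : nat) : R := p.+1%:R^-1.
have ep0 p : 0 < ep p by rewrite invr_gt0.
have epc : ep p @[p --> \oo] --> (0 : R) by exact: cvg_harmonic.
apply: (@measurable_fun_cvg _ _ _ setT (fun p w => Num w / (Den w + ep p))).
  move=> p; apply: (@measurable_fun_cvg _ _ _ setT
    (fun m => (fun z => nm z / (dn z + ep p)) \o G m)).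
    by move=> m; exact: measurable_comp_finite.
  move=> w _; apply: cvgM; first exact: nm_cvg.
  apply: cvgV; last by apply: cvgD; [exact: dn_cvg|exact: cvg_cst].
  by have /andP[h1 h2] := NumDen w; rewrite gt_eqF// ltr_wpDl// (le_trans h1).
move=> w _; have /andP[h1 h2] := NumDen w.
have [D0|D0] := eqVneq (Den w) 0.
  have -> : Num w = 0 by apply/eqP; rewrite eq_le h1 -D0 h2.
  by rewrite mul0r; under eq_fun do rewrite mul0r; exact: cvg_cst.
apply: cvgM; first exact: cvg_cst.
apply: cvgV => //; rewrite -[X in _ --> X]addr0.
by apply: cvgD => //; exact: cvg_cst.
Qed.

End RatioMeasurable.

(* The ratio Num/Den is the limit of the elementary conditional probabilities
   num_m/den_m; the weights wt_m rescale numerator and denominator to finite limits,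
   and the uniform bound on the sum of wt_m controls the part of the space where Den vanishes. *)
Section CondProbLimit.
Context {T : nat -> finType} (G : forall m, Omega -> T m).
Variables (A : set Omega) (num den wt nm dn : forall m, T m -> R).
Variables (Num Den : Omega -> R) (C : R).
Hypothesis mA : measurable A.
Hypothesis mG : forall m z, measurable (G m @^-1` [set z]).
Hypothesis numP : forall m z, P (A `&` G m @^-1` [set z]) = (num z)%:E.
Hypothesis denP : forall m z, P (G m @^-1` [set z]) = (den z)%:E.
Hypothesis wt0 : forall m (z : T m), 0 < wt z.
Hypothesis wtC : forall m, \sum_(z : T m) wt z <= C.
Hypothesis numE : forall m (z : T m), num z = wt z * nm z.
Hypothesis denE : forall m (z : T m), den z = wt z * dn z.
Hypothesis nm_cvg : forall w, nm (G m w) @[m --> \oo] --> Num w.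
Hypothesis dn_cvg : forall w, dn (G m w) @[m --> \oo] --> Den w.

Let nm_ge0 m (z : T m) : 0 <= nm z.
Proof.
have : 0 <= num z by rewrite -lee_fin -numP.
by rewrite numE pmulr_rge0.
Qed.

Let nm_le m (z : T m) : nm z <= dn z.
Proof.
have : num z <= den z.
  rewrite -lee_fin -numP -denP; apply: le_measure; rewrite ?inE//.
  exact: measurableI.
by rewrite numE denE ler_pM2l.
Qed.

Lemma Num_le_Den w : 0 <= Num w <= Den w.
Proof.
apply/andP; split.
  have c0 : (0 : R) @[_ --> \oo] --> (0 : R) by exact: cvg_cst.
  by apply: (ler_cvg_to c0 (@nm_cvg w)); apply: nearW => m.
by apply: (ler_cvg_to (@nm_cvg w) (@dn_cvg w)); apply: nearW => m.
Qed.

(** With q = nm / (dn + e) <= 1 one has num = q den + wt q e on every fibre, so replacing num by q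
    den costs at most e C in total. First m tends to infinity for fixed e, then e tends to 0, both
    times by dominated convergence. *)
Lemma integral_ratio m0 (S : pred (T m0)) :
  (forall m, (m0 <= m)%N -> exists rho : T m -> T m0, forall w, G m0 w = rho (G m w)) ->
  P (A `&` G m0 @^-1` [set z | S z]) =
  (\int[P]_(w in G m0 @^-1` [set z | S z]) (Num w / Den w)%:E)%E.
Proof.
move=> href; set B := _ @^-1` _.
have mB : measurable B by exact: measurable_preimage_pred.
pose f e m w : R := nm (G m w) / (dn (G m w) + e).
have f01 e m w : 0 < e -> 0 <= f e m w <= 1.
  move=> e0; have h1 := nm_ge0 (G m w); have h2 := nm_le (G m w).
  have p : 0 < dn (G m w) + e by rewrite ltr_wpDl// (le_trans h1).
  rewrite /f divr_ge0 ?(ltW p)//= ler_pdivrMr// mul1r (le_trans h2)// lerDl ltW//.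
have mf e m : measurable_fun setT (f e m).
  rewrite (_ : f e m = (fun z => nm z / (dn z + e)) \o G m)//.
  exact: measurable_comp_finite.
have f_cvg e w : 0 < e -> f e m w @[m --> \oo] --> Num w / (Den w + e).
  move=> e0; apply: cvgM; first exact: nm_cvg.
  apply: cvgV.
    have /andP[h1 h2] := Num_le_Den w.
    by rewrite gt_eqF// ltr_wpDl// (le_trans h1).
  by apply: cvgD; [exact: dn_cvg|exact: cvg_cst].
have bound e m : 0 < e -> (m0 <= m)%N ->
    (\int[P]_(w in B) (f e m w)%:E <= P (A `&` B) /\
     P (A `&` B) <= \int[P]_(w in B) (f e m w)%:E + (e * C)%:E)%E.
  move=> e0 m0m; have [rho hrho] := href m m0m.
  (* An event coded on grid m0 is a union of fibres of every finer grid, so the fibrewise estimate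
     can be summed over it. *)
  have BE : B = G m @^-1` [set z | S (rho z)].
    by apply/seteqP; split => w /=; rewrite /B/= hrho.
  rewrite BE total_prob// (integral_comp_finite (@mG m) (fun z => S (rho z))
    (f := fun z => nm z / (dn z + e))); last first.
    by move=> z; rewrite divr_ge0// addr_ge0 ?(ltW e0)// (le_trans (nm_ge0 z)).
  have -> : (\sum_(z | S (rho z)) P (A `&` G m @^-1` [set z]) =
      (\sum_(z | S (rho z)) num z)%:E)%E.
    by rewrite -sumEFin; apply: eq_bigr => z _; exact: numP.
  have -> : (\sum_(z | S (rho z)) (nm z / (dn z + e))%:E * P (G m @^-1` [set z]) =
      (\sum_(z | S (rho z)) nm z / (dn z + e) * den z)%:E)%E.
    by rewrite -sumEFin; apply: eq_bigr => z _; rewrite denP.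
  rewrite -EFinD !lee_fin.
  have hz (z : T m) : nm z / (dn z + e) * den z <= num z /\
      num z <= nm z / (dn z + e) * den z + e * wt z.
    have h1 := nm_ge0 z; have h2 := nm_le z; have h3 := wt0 z.
    have p : 0 < dn z + e by rewrite ltr_wpDl// (le_trans h1).
    set q := nm z / (dn z + e).
    have q0 : 0 <= q by rewrite divr_ge0// ltW.
    have q1 : q <= 1 by rewrite ler_pdivrMr// mul1r (le_trans h2)// lerDl ltW.
    have hq : nm z = q * (dn z + e) by rewrite divfK// gt_eqF.
    rewrite numE denE hq.
    have qe0 : 0 <= wt z * q * e.
      by apply: mulr_ge0; [apply: mulr_ge0 => //; exact: ltW|exact: ltW].
    have qe1 : wt z * q * e <= wt z * e.
      by rewrite ler_wpM2r ?(ltW e0)// ler_piMr ?(ltW h3).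
    by split; lra.
  split; first by apply: ler_sum => z _; exact: (hz z).1.
  apply: (@le_trans _ _ (\sum_(z | S (rho z)) (nm z / (dn z + e) * den z + e * wt z))).
    by apply: ler_sum => z _; exact: (hz z).2.
  rewrite big_split/= lerD2l -mulr_sumr ler_wpM2l ?(ltW e0)//.
  apply: le_trans (wtC m); rewrite [leRHS](bigID (fun z => S (rho z)))/= lerDl.
  by apply: sumr_ge0 => z _; exact: ltW.
have limb e : 0 < e -> (\int[P]_(w in B) (Num w / (Den w + e))%:E <= P (A `&` B) /\
     P (A `&` B) <= \int[P]_(w in B) (Num w / (Den w + e))%:E + (e * C)%:E)%E.
  move=> e0.
  have cv : (\int[P]_(w in B) (f e m w)%:E @[m --> \oo] -->
      \int[P]_(w in B) (Num w / (Den w + e))%:E)%E.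
    apply: (bounded_cvg_integral (c := 1)) => // [w|m w]; first exact: f_cvg.
    have /andP[h1 h2] := f01 e m w e0.
    by rewrite ger0_norm.
  split.
    apply: (cvge_le _ cv); exists m0 => // m /= hm.
    exact: (bound e m e0 hm).1.
  have cv2 : (\int[P]_(w in B) (f e m w)%:E + (e * C)%:E @[m --> \oo]
      --> \int[P]_(w in B) (Num w / (Den w + e))%:E + (e * C)%:E)%E.
    by refine (cvgeD _ cv (cvg_cst _)); rewrite fin_num_adde_defl.
  apply: (cvge_ge _ cv2); exists m0 => // m /= hm.
  exact: (bound e m e0 hm).2.
pose ep (p : nat) : R := p.+1%:R^-1.
have ep0 p : 0 < ep p by rewrite invr_gt0.
have epc : ep p @[p --> \oo] --> (0 : R) by exact: cvg_harmonic.
have cv : (\int[P]_(w in B) (Num w / (Den w + ep p))%:E @[p --> \oo] -->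
      \int[P]_(w in B) (Num w / Den w)%:E)%E.
  apply: (bounded_cvg_integral (c := 1)) => //.
  - move=> p; apply: (measurable_fun_cvg (mf (ep p))) => w _; exact: f_cvg.
  - move=> w; have /andP[h1 h2] := Num_le_Den w.
    have [D0|D0] := eqVneq (Den w) 0.
      have -> : Num w = 0 by apply/eqP; rewrite eq_le h1 -D0 h2.
      by rewrite mul0r; under eq_fun do rewrite mul0r; exact: cvg_cst.
    apply: cvgM; first exact: cvg_cst.
    apply: cvgV => //; rewrite -[X in _ --> X]addr0.
    by apply: cvgD => //; exact: cvg_cst.
  - move=> p w; have /andP[h1 h2] := Num_le_Den w.
    have pp : 0 < Den w + ep p by rewrite ltr_wpDl// (le_trans h1).
    rewrite ger0_norm ?divr_ge0 ?(ltW pp)// ler_pdivrMr// mul1r (le_trans h2)//.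
    by rewrite lerDl ltW.
apply/eqP; rewrite eq_le; apply/andP; split.
  have cv2 : (\int[P]_(w in B) (Num w / (Den w + ep p))%:E + (ep p * C)%:E @[p --> \oo]
      --> \int[P]_(w in B) (Num w / Den w)%:E + 0%:E)%E.
    have c0 : ((ep p * C)%:E @[p --> \oo] --> 0%:E)%E.
      apply: cvg_EFin; first exact: nearW.
      by rewrite -[X in _ --> X](mul0r C); apply: cvgM => //; exact: cvg_cst.
    by refine (cvgeD _ cv c0); rewrite fin_num_adde_defl.
  rewrite adde0 in cv2; apply: (cvge_ge _ cv2); apply: nearW => p.
  exact: (limb _ (ep0 p)).2.
apply: (cvge_le _ cv); apply: nearW => p; exact: (limb _ (ep0 p)).1.
Qed.

End CondProbLimit.
End FiniteValued.

(** * Finite-dimensional laws of the Markov jump process *)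

Section WeightSum.
Variable R : realType.

(* z is encoded by its initial value and its increments in the group Z/(J+1). *)
Lemma sum_path_weight (J N : nat) (h : R) :
  \sum_(z : {ffun 'I_N.+1 -> 'I_J.+1})
     \prod_(k < N) (if z (widen_ord (leqnSn N) k) == z (lift ord0 k) then 1 else h) =
  J.+1%:R * (1 + J%:R * h) ^+ N.
Proof.
pose g (i : 'I_N.+1) (x : 'I_J.+1) : R := if (i == ord0) || (x == 0) then 1 else h.
pose phi (z : {ffun 'I_N.+1 -> 'I_J.+1}) : {ffun 'I_N.+1 -> 'I_J.+1} :=
  [ffun i : 'I_N.+1 => if i == ord0 then z i else z i - z (inord i.-1)].
have phi_inj : injective phi.
  move=> z z' e; apply/ffunP => i.
  have h0 n : (n <= N)%N -> z (inord n) = z' (inord n).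
    elim: n => [_|n IH nN].
      have := congr1 (fun f : {ffun _ -> _} => f (inord 0)) e.
      by rewrite !ffunE (_ : inord 0 = ord0)//; apply: val_inj; rewrite /= inordK.
    have := congr1 (fun f : {ffun _ -> _} => f (inord n.+1)) e.
    rewrite !ffunE -val_eqE /= inordK//= (IH (ltnW nN)).
    by move/addIr.
  by have := h0 i; rewrite inord_val; apply; rewrite -ltnS.
transitivity (\sum_(z : {ffun 'I_N.+1 -> 'I_J.+1}) \prod_i g i (phi z i)).
  apply: eq_bigr => z _; rewrite big_ord_recl /g eqxx mul1r.
  apply: eq_bigr => k _; rewrite ffunE -val_eqE /= subr_eq0 eq_sym.
  congr (if _ == _ then _ else _); congr (z _).
  by apply: val_inj; rewrite /= add0n inordK// ltnS ltnW.
have <- : \sum_(f : {ffun 'I_N.+1 -> 'I_J.+1}) \prod_i g i (f i) =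
    \sum_z \prod_i g i (phi z i) by rewrite (reindex_inj phi_inj).
rewrite -(bigA_distr_bigA g) big_ord_recl; congr (_ * _).
  rewrite (eq_bigr (fun=> 1)) => [|x _]; last by rewrite /g eqxx.
  by rewrite sumr_const card_ord.
rewrite -[in RHS](card_ord N) -prodr_const; apply: eq_bigr => k _.
rewrite (bigD1 0)//= {1}/g eqxx orbT; congr (_ + _).
rewrite (eq_bigr (fun=> h)); last first.
  by move=> x x0; rewrite /g (negbTE x0) orbF.
rewrite sumr_const mulr_natl; congr (_ *+ _).
by have := cardC1 (0 : 'I_J.+1); rewrite card_ord.
Qed.

End WeightSum.

Section Process.
Context {R : realType} {dsp : measure_display} {Omega : measurableType dsp}.
Context {J : nat} {d : 'I_J.+1 -> nat}.
Variables (P : probability Omega R) (M : R -> 'M[R]_(dbar d)) (pi1 : 'rV[R]_(d ord0)).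
Variable X : R -> Omega -> state d.
Hypothesis hX : is_markov_jump P M pi1 X.
Hypothesis cM : mxcont M.
Notation E := (Emx R d).
Notation Z v w := (Defs.Zp X v w).
Notation filt1 := (filt M pi1 (fun _ _ => 1)).

Lemma mX u e : 0 <= u -> measurable (X u @^-1` [set e]).
Proof. by case: hX => h _ _; exact: h. Qed.

Lemma mX_pred u (S : pred (state d)) : 0 <= u -> measurable [set w | S (X u w)].
Proof.
by move=> u0; apply: (@measurable_preimage_pred _ _ _ (X u)) => e; exact: mX.
Qed.

Lemma mZ u y : 0 <= u -> measurable [set w | Z u w = y].
Proof.
move=> u0; rewrite (_ : [set _ | _] = [set w | (fun e => tag e == y) (X u w)]).
  exact: (mX_pred (fun e => tag e == y)).
by apply/seteqP; split => w /= /eqP.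
Qed.

Lemma Xright w t : 0 <= t ->
  exists2 eps : R, 0 < eps & forall v : R, t <= v < t + eps -> Z v w = Z t w.
Proof.
case: hX => _ h _ t0; have [[eps eps0 he] _] := h w t t0.
by exists eps => // v /he; rewrite /Defs.Zp => ->.
Qed.

Lemma Xleft w t : 0 < t ->
  exists2 eps : R, 0 < eps & exists y, forall v : R, t - eps < v < t -> Z v w = y.
Proof.
case: hX => _ h _ t0; have [_ /(_ t0)[eps eps0 [e he]]] := h w t (ltW t0).
by exists eps => //; exists (tag e) => v /he; rewrite /Defs.Zp => ->.
Qed.

Definition Dmx (S : pred (state d)) : 'M[R]_(dbar d) :=
  \sum_(e | S e) ev R e *m (ev R e)^T.

Lemma Dmx_tag y : Dmx (fun e => tag e == y) = Pimx R d y.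
Proof.
apply/matrixP => i k; have [f f1 f2] := sidx_bij d.
rewrite -(f2 i) -(f2 k) PimxE (inj_eq (@sidx_inj _ d)).
rewrite summxE (eq_bigr (fun x => ((f i == x) && (f k == x))%:R)); last first.
  have evij x l m : ev R x l m = (l == sidx x)%:R by rewrite mxE eq_sidx.
  move=> x _; rewrite mxE big_ord1 [X in _ * X]mxE !evij.
  by rewrite !(inj_eq (@sidx_inj _ d)) -natrM mulnb.
have [fy|fy] := boolP (tag (f i) == y).
  rewrite (bigD1 (f i))//= eqxx/= big1 ?addr0 1?eq_sym// => x /andP[_].
  by rewrite eq_sym => /negbTE ->.
rewrite big1// => x xy; case: eqP => // fx; move: fy; rewrite fx.
by move/eqP: xy => ->; rewrite eqxx.
Qed.

Fixpoint chain (u : nat -> R) (S : nat -> pred (state d)) (k : nat) : 'rV[R]_(dbar d) :=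
  match k with
  | 0%N => pi1 *m (E ord0)^T
  | k'.+1 => chain u S k' *m Dmx (S k') *m prodint M (u k') (u k'.+1)
  end.

(** Induction on the number i of coordinates relaxed from a prescribed state to a set: summing over
    the values of [X (u i)] in [S i] inserts the diagonal indicator matrix [Dmx (S i)]. *)
Lemma fdd_chain n (u : nat -> R) (S : nat -> pred (state d)) :
  u 0%N = 0 -> (forall k, (k < n)%N -> u k <= u k.+1) ->
  forall i, (i <= n)%N -> forall e : nat -> state d,
  P (\bigcap_(k in [set k | (k <= n)%N])
      [set w | if (k < i)%N then S k (X (u k) w) else X (u k) w == e k]) =
  ((chain u S i *m ev R (e i)) ord0 ord0 *
   \prod_(i <= k < n) ((ev R (e k))^T *m prodint M (u k) (u k.+1) *m ev R (e k.+1)) ord0 ord0)%:E.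
Proof.
move=> u0 umono.
have uk0 k : (k <= n)%N -> 0 <= u k.
  elim: k => [|k IH kn]; first by rewrite u0.
  by apply: le_trans (umono _ kn); apply: IH; exact: ltnW.
have mev i e : measurable (\bigcap_(k in [set k | (k <= n)%N])
      [set w | if (k < i)%N then S k (X (u k) w) else X (u k) w == e k]).
  apply: bigcap_measurable => [|k /= kn]; first by exists 0%N.
  case: (k < i)%N.
    exact: mX_pred (uk0 k kn).
  exact: (mX_pred (fun x => x == e k) (uk0 k kn)).
elim=> [_ e|i IH iN e].
  case: hX => _ _ /(_ n u e u0 umono) h.
  rewrite big_mkord -h; congr (P _); apply: eq_bigcapr => k _.
  by apply/seteqP; split => w /= /eqP.
set A := \bigcap_(k in _) _.
have AE : A = A `&` X (u i) @^-1` [set x | S i x].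
  rewrite setIidl// => w /(_ i) /=; rewrite ltnSn; apply; exact: ltnW.
rewrite AE (total_prob P _ (S i) (mev _ _)); last first.
  by move=> z; apply: mX; apply: uk0; exact: ltnW.
pose e' x k := if k == i then x else e k.
have term x : S i x -> P (A `&` X (u i) @^-1` [set x]) =
  ((chain u S i *m ev R x) ord0 ord0 *
    ((ev R x)^T *m prodint M (u i) (u i.+1) *m ev R (e i.+1)) ord0 ord0 *
   \prod_(i.+1 <= k < n) ((ev R (e k))^T *m prodint M (u k) (u k.+1) *m ev R (e k.+1)) ord0 ord0)%:E.
  move=> Sx; have := IH (ltnW iN) (e' x).
  have e'i : e' x i = x by rewrite /e' eqxx.
  have e'n k : (i < k)%N -> e' x k = e k by move=> ik; rewrite /e' gtn_eqF.
  rewrite big_ltn// (eq_big_nat _ _ (F2 := fun k =>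
     ((ev R (e k))^T *m prodint M (u k) (u k.+1) *m ev R (e k.+1)) ord0 ord0)); last first.
    by move=> k /andP[ik _]; rewrite !e'n// ltnW.
  rewrite e'i e'n// mulrA => <-; congr (P _).
  apply/seteqP; split => [w [Aw xw] k /= kn|w h].
    have := Aw k kn; rewrite /= ltnS /e'; case: ltngtP => // ki _.
    by apply/eqP; rewrite ki.
  split => [k /= kn|].
    by have := h k kn; rewrite /= ltnS /e'; case: ltngtP => // -> /eqP ->.
  by have := h i (ltnW iN); rewrite /= ltnn /e' eqxx => /eqP.
rewrite (eq_bigr _ term) sumEFin; congr EFin.
rewrite -mulr_suml; congr (_ * _).
rewrite /= /Dmx mulmx_sumr !mulmx_suml summxE; apply: eq_bigr => x _.
have -> : chain u S i *m (ev R x *m (ev R x)^T) *m prodint M (u i) (u i.+1) *m ev R (e i.+1) =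
  (chain u S i *m ev R x) *m ((ev R x)^T *m prodint M (u i) (u i.+1) *m ev R (e i.+1)).
  by rewrite !mulmxA.
by rewrite [RHS]mxE big_ord1.
Qed.

Lemma filt_chain u z k :
  filt1 u z k = chain u (fun k e => tag e == z k) k *m Pimx R d (z k).
Proof.
by elim: k => [//|k IH] /=; rewrite scale1r IH Dmx_tag.
Qed.

Lemma filt_ext c u z u' z' k : (forall l, (l <= k)%N -> u l = u' l /\ z l = z' l) ->
  filt M pi1 c u z k = filt M pi1 c u' z' k.
Proof.
elim: k => [|k IH] h /=; first by rewrite (h 0%N _).2.
rewrite IH; last by move=> l lk; apply: h; exact: leqW.
by rewrite !(h k.+1 _).1// !(h k.+1 _).2// (h k _).1// (h k _).2.
Qed.

Lemma prob_filt n u z e : u 0%N = 0 -> (forall k, (k < n)%N -> u k <= u k.+1) ->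
  P [set w | (forall k, (k <= n)%N -> Z (u k) w = z k) /\ X (u n) w = e] =
  ((filt1 u z n *m ev R e) ord0 ord0)%:E.
Proof.
move=> u0 umono.
have := @fdd_chain n u (fun k e => tag e == z k) u0 umono n (leqnn n) (fun=> e).
rewrite big_geq// mulr1 filt_chain -mulmxA.
have [ez|ez] := eqVneq (tag e) (z n); last first.
  rewrite /Pimx -[E _ *m _ *m _]mulmxA mulTEmx_ev_neq 1?eq_sym// !mulmx0 mxE => _.
  set B := [set _ | _]; have -> : B = set0.
    rewrite -subset0 => w [h Xe].
    by move/eqP: ez; apply; rewrite -(h n)// /Defs.Zp Xe.
  by rewrite measure0 mxE.
have -> : Pimx R d (z n) *m ev R e = ev R e.
  apply/matrixP => i k; have [f f1 f2] := sidx_bij d; rewrite -(f2 i) (ord1 k).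
  rewrite mulmx_ev PimxE (inj_eq (@sidx_inj _ d)).
  rewrite mxE eq_sidx (inj_eq (@sidx_inj _ d)).
  by case: (eqVneq (f i) e) => [->|_]; rewrite ?ez ?eqxx ?andbF.
move=> <-; congr (P _); apply/seteqP; split => [w [h Xe] k /= kn|w h].
  by case: ltngtP kn => // [kn _|->]; [apply/eqP; rewrite -(h k)// ltnW|rewrite Xe].
have Xe : X (u n) w = e by have := h n (leqnn n); rewrite /= ltnn => /eqP.
split => // k kn; move: (h k kn) => /=; case: ltngtP kn => // [kn _|->]; first by move/eqP.
by rewrite /Defs.Zp => _ _; rewrite Xe.
Qed.

End Process.

Section HoldProb.
Context {R : realType} {dsp : measure_display} {Omega : measurableType dsp}.
Context {J : nat} {d : 'I_J.+1 -> nat}.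
Variables (P : probability Omega R) (M : R -> 'M[R]_(dbar d)) (pi1 : 'rV[R]_(d ord0)).
Variable X : R -> Omega -> state d.
Hypothesis hX : is_markov_jump P M pi1 X.
Hypothesis cM : mxcont M.
Notation E := (Emx R d).
Notation Z v w := (Defs.Zp X v w).
Notation filt1 := (filt M pi1 (fun _ _ => 1)).

Definition obs (u : nat -> R) (n : nat) (z : nat -> 'I_J.+1) : set Omega :=
  [set w | forall k, (k <= n)%N -> Z (u k) w = z k].

Lemma measurable_obs u n z : (forall k, (k <= n)%N -> 0 <= u k) -> measurable (obs u n z).
Proof.
move=> u0; rewrite (_ : obs u n z =
  \bigcap_(k in [set k | (k <= n)%N]) [set w | Z (u k) w = z k]); last first.
  by apply/seteqP; split => w h k; exact: h.
apply: bigcap_measurable => [|k /= kn]; first by exists 0%N.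
by apply: (mZ hX); exact: u0.
Qed.

Definition hold (r s : R) (je : state d) : set Omega :=
  [set w | X s w = je /\ forall v : R, r <= v <= s -> Z v w = Z s w].

(** Free motion from t to r, then no exit from the block of [je] up to s, ending in [je]. *)
Definition hold_vec (t r s : R) (je : state d) : 'cV[R]_(dbar d) :=
  prodint M t r *m E (tag je) *m prodint (blkf M (tag je) (tag je)) r s *m etil R je.

Lemma hold_grid r s je : 0 <= r -> r <= s -> hold r s je =
  \bigcap_m [set w | obs (grid r s m) (2 ^ m) (fun=> tag je) w /\ X s w = je].
Proof.
move=> r0 rs; apply/seteqP; split => [w [Xs h] m _|w h].
  split=> // k km; rewrite h ?grid_ge ?grid_le_last//.
  by rewrite /Defs.Zp Xs.
have Xs : X s w = je by exact: (h 0%N I).2.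
split=> //; apply/(const_grid (Z := fun v => Z v w) r0 rs).
  by move=> v v0; exact: (Xright hX w v0).
by move=> m k km; rewrite ((h m I).1 k km) /Defs.Zp Xs.
Qed.

Lemma measurable_hold r s je : 0 <= r -> r <= s -> measurable (hold r s je).
Proof.
move=> r0 rs; rewrite hold_grid//; apply: bigcapT_measurable => m.
apply: measurableI; last by apply: (mX hX); exact: le_trans r0 rs.
by apply: measurable_obs => k _; rewrite (le_trans r0)// grid_ge.
Qed.

(** The observation times are continued by dyadic grids of [r, s]. The grid events decrease to the
    holding event by right continuity, and their matrix products converge by [euler_cvg]; the two
    limits of the same probabilities agree. *)
Lemma prob_hold n (u : nat -> R) z r s je : u 0%N = 0 ->
  (forall k, (k < n)%N -> u k <= u k.+1) -> u n <= r -> r <= s ->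
  P (obs u n z `&` hold r s je) = ((filt1 u z n *m hold_vec (u n) r s je) ord0 ord0)%:E.
Proof.
move=> u0 umono unr rs; set j := tag je.
have uk0 k : (k <= n)%N -> 0 <= u k.
  elim: k => [|k IH kn]; first by rewrite u0.
  by apply: le_trans (umono _ kn); apply: IH; exact: ltnW.
have r0 : 0 <= r by exact: le_trans (uk0 n (leqnn n)) unr.
have s0 : 0 <= s by exact: le_trans r0 rs.
(* Index n.+1 is r itself, so the step from n to n.+1 is the unobserved passage from [u n] to r. *)
pose u' m k := if (k <= n)%N then u k else grid r s m (k - n.+1).
pose z' k := if (k <= n)%N then z k else j.
have u'E m k : u' m (n.+1 + k)%N = grid r s m k.
  by rewrite /u' leqNgt ltn_addr// addKn.
have z'E k : z' (n.+1 + k)%N = j by rewrite /z' leqNgt ltn_addr.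
have u'l m k : (k <= n)%N -> u' m k = u k by rewrite /u' => ->.
have z'l k : (k <= n)%N -> z' k = z k by rewrite /z' => ->.
pose F m := obs u n z `&` [set w | obs (grid r s m) (2 ^ m) (fun=> j) w /\ X s w = je].
have FE m : F m = [set w | (forall k, (k <= n.+1 + 2 ^ m)%N -> Z (u' m k) w = z' k) /\
    X (u' m (n.+1 + 2 ^ m)%N) w = je].
  rewrite u'E grid_last; apply/seteqP; split => [w [h1 [h2 h3]]|w [h1 h2]].
    split => // k; have [kn _|kn] := leqP k n; first by rewrite u'l// z'l// h1.
    rewrite -(subnKC kn) u'E z'E leq_add2l => km; exact: h2.
  split; first by move=> k kn; rewrite -(u'l m)// -z'l// h1// (leq_trans kn)// ltnW// ltn_addr.
  split => // k km; rewrite -(u'E m k) h1 ?z'E// leq_add2l//.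
have PF m : P (F m) = ((filt1 (u' m) z' (n.+1 + 2 ^ m) *m ev R je) ord0 ord0)%:E.
  rewrite FE; apply: (prob_filt hX); first by rewrite u'l.
  move=> k kn; have [kn'|kn'] := ltnP k n; first by rewrite !u'l ?umono// ltnW.
  have [->|nk] := eqVneq k n.
    by rewrite u'l// -[n.+1]addn0 u'E grid0.
  have {}nk : (n.+1 <= k)%N by rewrite ltn_neqAle eq_sym nk.
  by rewrite -(subnKC nk) -addnS !u'E grid_le.
have lim1 : P (F m) @[m --> \oo] --> P (obs u n z `&` hold r s je).
  have -> : obs u n z `&` hold r s je = \bigcap_m F m.
    rewrite hold_grid//; apply/seteqP; split => [w [h1 h2] m _|w h].
      by split => //; exact: h2.
    by split => [|m _]; [exact: (h 0%N I).1|exact: (h m I).2].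
  have mF m : measurable (F m).
    apply: measurableI; first exact: measurable_obs.
    apply: measurableI; last by apply: (mX hX).
    by apply: measurable_obs => k _; rewrite (le_trans r0)// grid_ge.
  apply: nonincreasing_cvg_mu => //.
  - by rewrite (le_lt_trans (probability_le1 _ _))// ltry.
  - exact: bigcapT_measurable.
  - move=> m m' mm'; apply/subsetPset => w [h1 [h2 h3]]; split=> //; split=> // k km.
    rewrite -(grid_refine r s m (m' - m) k) subnKC// h2//.
    by rewrite -{2}(subnKC mm') expnD leq_mul2r km orbT.
have filtS v y k : filt1 v y k.+1 =
  filt1 v y k *m prodint M (v k) (v k.+1) *m Pimx R d (y k.+1) by rewrite /= scale1r.
have filtE m k : filt1 (u' m) z' (n.+1 + k) *m E j *m (E j)^T = filt1 (u' m) z' (n.+1 + k).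
  by have := filt_EE M pi1 (fun _ _ => 1) (u' m) z' (n.+1 + k); rewrite z'E.
have lim2 : mxcvg (fun m => filt1 (u' m) z' (n.+1 + 2 ^ m) *m E j)
    (filt1 u z n *m prodint M (u n) r *m E j *m prodint (blkf M j j) r s).
  apply: (@euler_cvg R _ (blkf M j j) (fun u v => (E j)^T *m prodint M u v *m E j) s
    _ (fun m k => filt1 (u' m) z' (n.+1 + k) *m E j) (grid r s)
    (fun m => (s - r) / 2 ^+ m) (fun=> 0%N) (fun m => 2 ^ m)%N) => //.
  - exact: mxcont_blkf.
  - by move=> e e0; exact: blk_first_order.
  - by move=> m; exact: grid_step_ge0.
  - exact: cvg_grid_step.
  - near=> m; split => //; first by rewrite grid0.
      by rewrite grid_last.
    move=> k _; split; first by rewrite gridS.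
    by rewrite addnS filtS -addnS !u'E z'E -[LHS]mulmxA Pimx_Emx !mulmxA filtE.
  - apply: mxcvg_near_eq (mxcvg_cst _); near=> m.
    rewrite addn0 filtS u'l// -[n.+1]addn0 u'E grid0 z'E.
    rewrite -[RHS]mulmxA Pimx_Emx; congr (_ *m _ *m _).
    by apply: filt_ext => l ln; rewrite u'l// z'l.
  - by under eq_fun do rewrite grid0; exact: cvg_cst.
  - by under eq_fun do rewrite grid_last; exact: cvg_cst.
have lim3 : P (F m) @[m --> \oo] -->
    ((filt1 u z n *m hold_vec (u n) r s je) ord0 ord0)%:E.
  have h := @mxcvg_entry _ _ _ _ _ ord0 ord0 (mxcvgM lim2 (mxcvg_cst (etil R je))).
  have -> : filt1 u z n *m hold_vec (u n) r s je =
    filt1 u z n *m prodint M (u n) r *m E j *m prodint (blkf M j j) r s *m etil R je.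
    by rewrite /hold_vec !mulmxA.
  under eq_fun do rewrite PF.
  apply: cvg_EFin; first exact: nearW.
  apply: cvg_trans h; apply: near_eq_cvg; near=> m => /=.
  by rewrite -mulTEmx_ev mulmxA filtE.
exact: (cvg_unique _ lim1 lim3).
Unshelve. all: by end_near. Qed.

(** The event is the increasing union of holding events started at [r p], which tends to s - dur
    from below; the holding probabilities are continuous along this sequence. *)
Lemma prob_duration n (u : nat -> R) z s dur je : u 0%N = 0 ->
  (forall k, (k < n)%N -> u k <= u k.+1) -> u n < s - dur -> 0 <= dur ->
  P (obs u n z `&` [set w | X s w = je /\ dur < Udur X s w]) =
  ((filt1 u z n *m hold_vec (u n) (s - dur) s je) ord0 ord0)%:E.
Proof.
move=> u0 umono unr dur0; set j := tag je.
have uk0 k : (k <= n)%N -> 0 <= u k.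
  elim: k => [|k IH kn]; first by rewrite u0.
  by apply: le_trans (umono _ kn); apply: IH; exact: ltnW.
have un0 : 0 <= u n by exact: uk0.
(* Starting the margins at p0 keeps every [r p] at or after the last observation, as [prob_hold]
   requires. *)
have [p0 hp0] : exists p : nat, p.+1%:R^-1 < s - dur - u n.
  by apply: ex_harmonic_lt; rewrite subr_gt0.
have s0 : 0 <= s by lra.
pose r p : R := s - dur - (p0 + p).+1%:R^-1.
have inv_le (p q : nat) : (p <= q)%N -> q.+1%:R^-1 <= p.+1%:R^-1 :> R.
  by move=> pq; rewrite lef_pV2 ?posrE// ler_nat ltnS.
have inv0 (p : nat) : 0 < p.+1%:R^-1 :> R by rewrite invr_gt0.
have ur p : u n <= r p.
  by rewrite /r; have := inv_le p0 (p0 + p)%N (leq_addr _ _); move: hp0; set a := _^-1;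
    set b := _^-1; lra.
have rs p : r p <= s.
  by rewrite /r; have := inv0 (p0 + p)%N; set a := _^-1; lra.
have rsd p : r p <= s - dur.
  by rewrite /r; have := inv0 (p0 + p)%N; set a := _^-1; lra.
have rmono p q : (p <= q)%N -> r p <= r q.
  by move=> pq; rewrite lerD2l lerN2 inv_le// leq_add2l.
pose F p := obs u n z `&` hold (r p) s je.
have FU : obs u n z `&` [set w | X s w = je /\ dur < Udur X s w] = \bigcup_p F p.
  rewrite /F -setI_bigcupr; congr (_ `&` _); apply/seteqP; split => w.
    move=> [Xs /(Udur_gt X w s0 dur0)[p [hp1 hp2]]].
    exists p => //; split => // v /andP[v1 v2]; apply: hp2; rewrite v2 andbT.
    by apply: le_trans v1; rewrite /r lerD2l lerN2; exact/inv_le/leq_addl.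
  move=> [p _ [Xs h]]; split => //; apply/(Udur_gt X w s0 dur0).
  exists (p0 + p)%N; split; first exact: le_trans un0 (ur p).
  exact: h.
have lim1 : P (F p) @[p --> \oo] --> P (\bigcup_p F p).
  have mF p : measurable (F p).
    apply: measurableI; first exact: measurable_obs.
    by apply: measurable_hold => //; exact: le_trans un0 (ur p).
  apply: nondecreasing_cvg_mu => //; first exact: bigcup_measurable.
  move=> p q pq; apply/subsetPset => w [h1 [h2 h3]]; split => //; split => //.
  by move=> v /andP[v1 v2]; apply: h3; rewrite v2 (le_trans (rmono _ _ pq)).
rewrite FU.
have rlim : r p @[p --> \oo] --> s - dur.
  rewrite -[X in _ --> X]subr0; apply: cvgB; first exact: cvg_cst.
  have := @cvg_harmonic R; rewrite -(cvg_shiftn p0); apply: cvg_trans.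
  by apply: near_eq_cvg; near=> p; rewrite addnC.
have cb : mxcont (blkf M j j) by exact: mxcont_blkf.
(* The starting points now approach from the left, which [prodint_cvg] excludes; the short initial
   factor tends to 1 instead. *)
have blim : mxcvg (fun p => prodint (blkf M j j) (r p) s) (prodint (blkf M j j) (s - dur) s).
  have [C C0 hC] := prodint_sub1 cb 0 s.
  have h1 : mxcvg (fun p => prodint (blkf M j j) (r p) (s - dur)) 1%:M.
    apply: (@mxcvg_le _ _ _ _ _ (fun p => C * (s - dur - r p))).
      near=> p; apply: hC; [exact: le_trans un0 (ur p)|exact: rsd|lra].
    rewrite -[X in _ --> X](mulr0 C); apply: cvgMr.
    by rewrite -(subrr (s - dur)); apply: cvgB => //; exact: cvg_cst.
  have := mxcvgM h1 (mxcvg_cst (prodint (blkf M j j) (s - dur) s)).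
  rewrite mul1mx; apply: mxcvg_near_eq; near=> p.
  by rewrite prodint_mul//; lra.
have lim2 : mxcvg (fun p => filt1 u z n *m hold_vec (u n) (r p) s je)
    (filt1 u z n *m hold_vec (u n) (s - dur) s je).
  apply: mxcvgM (mxcvg_cst _) _; apply: mxcvgM _ (mxcvg_cst _).
  apply: mxcvgM blim; apply: mxcvgM _ (mxcvg_cst _).
  by apply: mxcvg_cont => //; exact: is_mxderive_cont (is_mxderive_prodint cM _).
have lim3 : P (F p) @[p --> \oo] -->
    ((filt1 u z n *m hold_vec (u n) (s - dur) s je) ord0 ord0)%:E.
  under eq_fun do rewrite prob_hold//.
  apply: cvg_EFin; first exact: nearW.
  exact: mxcvg_entry lim2.
exact: (cvg_unique _ lim1 lim3).
Unshelve. all: by end_near. Qed.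

Lemma prob_obs n (u : nat -> R) z : u 0%N = 0 ->
  (forall k, (k < n)%N -> u k <= u k.+1) ->
  P (obs u n z) = ((filt1 u z n *m (const_mx 1 : 'cV[R]_(dbar d))) ord0 ord0)%:E.
Proof.
move=> u0 umono.
have uk0 k : (k <= n)%N -> 0 <= u k.
  elim: k => [|k IH kn]; first by rewrite u0.
  by apply: le_trans (umono _ kn); apply: IH; exact: ltnW.
have mXn e : measurable (X (u n) @^-1` [set e]) by apply: (mX hX); exact: uk0.
have := total_prob P mXn predT (measurable_obs z uk0).
rewrite (_ : [set z | predT z] = setT) ?preimage_setT ?setIT; last by apply/seteqP.
move=> ->; rewrite mulmx_ones -sumEFin; apply: eq_bigr => e _.
exact: (prob_filt hX).
Qed.

End HoldProb.

(** * Conditional probability given the history of the macrostate *)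

Section Weights.
Variables (R : realType) (J : nat) (d : 'I_J.+1 -> nat) (M : R -> 'M[R]_(dbar d)).
Variable pi1 : 'rV[R]_(d ord0).

Definition jwt (m : nat) (y y' : 'I_J.+1) : R := if y == y' then 1 else 2^-1 ^+ m.

Lemma jwt_jfac m y y' : jwt m y y' * jfac R m y y' = 1.
Proof.
by rewrite /jwt /jfac; case: ifP; rewrite ?mulr1// -exprMn mulVf ?expr1n.
Qed.

Lemma filt_jfac m u z k : filt M pi1 (fun _ _ => 1) u z k =
  (\prod_(l < k) jwt m (z l) (z l.+1)) *: filt M pi1 (jfac R m) u z k.
Proof.
elim: k => [|k IH]; first by rewrite big_ord0 scale1r.
rewrite big_ord_recr/= scale1r IH -!scalemxAl scalerA -mulrA jwt_jfac mulr1.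
by [].
Qed.

End Weights.

Section PathCoding.
Context {R : realType} {dsp : measure_display} {Omega : measurableType dsp}.
Context {J : nat} {d : 'I_J.+1 -> nat}.
Variables (X : R -> Omega -> state d) (t : R).
Notation Z v w := (Defs.Zp X v w).

Definition pathT (m : nat) : finType := {ffun 'I_(2 ^ m).+1 -> 'I_J.+1}.

Definition gpath (m : nat) (w : Omega) : pathT m :=
  [ffun k : 'I_(2 ^ m).+1 => Z (grid 0 t m k) w].

Definition pathv m (y : pathT m) (k : nat) : 'I_J.+1 := y (inord k).

Lemma pathv_gpath m w k : (k <= 2 ^ m)%N -> pathv (gpath m w) k = Z (grid 0 t m k) w.
Proof. by move=> km; rewrite /pathv ffunE inordK. Qed.

Lemma gpath_fiber m y : gpath m @^-1` [set y] = obs X (grid 0 t m) (2 ^ m) (pathv y).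
Proof.
apply/seteqP; split => w /=.
  by move=> <- k km; rewrite pathv_gpath.
by move=> h; apply/ffunP => k; rewrite ffunE h -1?ltnS// /pathv inord_val.
Qed.

Lemma gpath_refine m m' : (m <= m')%N ->
  exists rho : pathT m' -> pathT m, forall w, gpath m w = rho (gpath m' w).
Proof.
move=> mm'.
exists (fun y => [ffun k : 'I_(2 ^ m).+1 => pathv y (k * 2 ^ (m' - m))]) => w.
apply/ffunP => k; rewrite !ffunE pathv_gpath; last first.
  by rewrite -{2}(subnKC mm') expnD leq_mul2r -ltnS ltn_ord orbT.
by rewrite -[in RHS](subnKC mm') addKn grid_refine.
Qed.

Definition path_wt m (y : pathT m) : R :=
  \prod_(k < 2 ^ m) (if y (widen_ord (leqnSn (2 ^ m)) k) == y (lift ord0 k)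
                     then 1 else 2^-1 ^+ m).

Lemma path_wtE m (y : pathT m) :
  path_wt y = \prod_(l < 2 ^ m) jwt R m (pathv y l) (pathv y l.+1).
Proof.
apply: eq_bigr => k _; rewrite /jwt /pathv; congr (if y _ == y _ then _ else _).
  by apply: val_inj; rewrite /= inordK// ltnS ltnW.
by apply: val_inj; rewrite /= inordK// ltnS.
Qed.

Lemma path_wt_gt0 m (y : pathT m) : 0 < path_wt y.
Proof. by apply: prodr_gt0 => k _; case: ifP; rewrite ?exprn_gt0. Qed.

(** The sum is (J+1) (1 + J 2^-m)^(2^m), and 1 + x <= exp x bounds it independently of m. *)
Lemma sum_path_wt m : \sum_(y : pathT m) path_wt y <= J.+1%:R * expR J%:R.
Proof.
rewrite /path_wt (sum_path_weight J (2 ^ m) (2^-1 ^+ m : R)) ler_wpM2l//.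
apply: (@le_trans _ _ (expR (J%:R * 2^-1 ^+ m) ^+ (2 ^ m))).
  apply: lerXn2r; rewrite ?nnegrE ?expR_ge0 ?expR_ge1Dx//.
rewrite -expRM_natl ler_expR natrX mulrCA -exprMn divff ?expr1n ?mulr1//.
Qed.

End PathCoding.

Section Final.
Context {R : realType} {dsp : measure_display} {Omega : measurableType dsp}.
Context {J : nat} {d : 'I_J.+1 -> nat}.
Variables (P : probability Omega R) (M : R -> 'M[R]_(dbar d)) (pi1 : 'rV[R]_(d ord0)).
Variable X : R -> Omega -> state d.
Hypothesis hX : is_markov_jump P M pi1 X.
Hypothesis cM : mxcont M.
Variables (t s z : R) (je : state d).
Hypotheses (ht : 0 <= t) (hts : t <= s) (hz : 0 <= z).
Notation E := (Emx R d).
Notation Z v w := (Defs.Zp X v w).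
Notation G := (gpath X t).

Let s0 : 0 <= s. Proof. exact: le_trans ht hts. Qed.

Let current w : exists n, (jumpT X w n <= t%:E)%E /\ (t%:E < jumpT X w n.+1)%E.
Proof. exact: (jumpT_exists (Xright hX w) (Xleft hX w)). Qed.

Definition njump w : nat := sval (cid (current w)).
Definition last_jump w : R := fine (jumpT X w (njump w)).

Lemma njumpP w : [/\ jumpT X w (njump w) = (last_jump w)%:E,
  last_jump w <= t & (t%:E < jumpT X w (njump w).+1)%E].
Proof.
have [] := svalP (cid (current w)); rewrite -/(njump w) /last_jump.
move: (njump w) => n h1 h2.
have [[e _]|[c [e c0 _]]] := jumpT_cases (Xright hX w) n.
  by move: h1; rewrite e leye_eq.
split => //; first by rewrite e.
by rewrite -lee_fin e in h1 *.
Qed.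

(* The unnormalized conditional law of X(t) given the jump history up to t. *)
Definition filter_row w : 'rV[R]_(dbar d) :=
  let c := last_jump w in let y := Z c w in
  alpha_bar M pi1 (Shist X w (njump w)) *m E y *m prodint (blkf M y y) c t *m (E y)^T.

Definition target : 'cV[R]_(dbar d) := hold_vec M t (Num.max (s - z) t) s je.

(** The factor t^n is what rescaling by 2^m per jump leaves behind; it cancels in the ratio of two
    such values. *)
Definition rowval (c : 'cV[R]_(dbar d)) w := t ^+ njump w * (filter_row w *m c) ord0 ord0.

Lemma rowval_cvg (c : 'cV[R]_(dbar d)) w :
  (filt M pi1 (jfac R m) (grid 0 t m) (pathv (G m w)) (2 ^ m) *m c) ord0 ord0
    @[m --> \oo] --> rowval c w.
Proof.
have [Tc ct tT] := njumpP w.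
have h := filt_limit pi1 cM ht (Xright hX w) Tc ct tT.
have := @mxcvg_entry _ _ _ _ _ ord0 ord0 (mxcvgM h (mxcvg_cst c)).
rewrite -scalemxAl [X in _ --> X]mxE; apply: cvg_trans; apply: near_eq_cvg; near=> m => /=.
congr ((_ *m c) ord0 ord0); apply: filt_ext => l lm.
by rewrite pathv_gpath.
Unshelve. all: by end_near. Qed.

Definition dur_event : set Omega := [set w | X s w = je /\ z < Udur X s w].

(* The event whose conditional probability is [filter_row] (normalized) times [target]:
   when s - z <= t, the part of the duration condition that concerns [0, t] is left
   out, because it is determined by the history. *)
Definition late_event : set Omega := if t < s - z then dur_event else hold X t s je.

Lemma measurable_dur_event : measurable dur_event.
Proof.
rewrite (_ : dur_event = \bigcup_(p in [set p : nat | 0 <= s - z - p.+1%:R^-1])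
   hold X (s - z - p.+1%:R^-1) s je); last first.
  apply/seteqP; split => w.
    by move=> [Xs /(Udur_gt X w s0 hz)[p [p1 p2]]]; exists p.
  move=> [p /= p1 [Xs p2]]; split => //; apply/(Udur_gt X w s0 hz).
  by exists p.
apply: bigcup_measurable => p /= p0; apply: (measurable_hold hX) => //.
have : 0 < p.+1%:R^-1 :> R by rewrite invr_gt0.
by move: hz; set q : R := p.+1%:R^-1; lra.
Qed.

Lemma measurable_late_event : measurable late_event.
Proof.
rewrite /late_event; case: ifP => _; first exact: measurable_dur_event.
exact: (measurable_hold hX).
Qed.

Lemma measurable_gpath m y : measurable (G m @^-1` [set y]).
Proof.
by rewrite gpath_fiber; apply: (measurable_obs hX) => k _; exact: grid_ge.
Qed.

(** The maximum in [target] merges two cases: the holding interval starts at s - z after t, up to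
    the strict inequality, or at t itself. *)
Lemma prob_late_event m (y : pathT m) : P (late_event `&` G m @^-1` [set y]) =
  ((filt M pi1 (fun _ _ => 1) (grid 0 t m) (pathv y) (2 ^ m) *m target) ord0 ord0)%:E.
Proof.
have umono k : (k < 2 ^ m)%N -> grid 0 t m k <= grid 0 t m k.+1.
  by move=> _; exact: grid_le.
rewrite gpath_fiber setIC /late_event /target; case: ifPn => [tsz|].
  rewrite (max_idPl (ltW tsz)).
  have := @prob_duration _ _ _ _ _ P M pi1 X hX cM (2 ^ m) (grid 0 t m) (pathv y) s z je.
  by rewrite grid_last; apply => //; rewrite grid0.
rewrite -leNgt => szt; rewrite (max_idPr szt).
have := @prob_hold _ _ _ _ _ P M pi1 X hX cM (2 ^ m) (grid 0 t m) (pathv y) t s je.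
by rewrite grid_last; apply => //; rewrite grid0.
Qed.

Lemma prob_gpath m (y : pathT m) : P (G m @^-1` [set y]) =
  ((filt M pi1 (fun _ _ => 1) (grid 0 t m) (pathv y) (2 ^ m)
     *m (const_mx 1 : 'cV[R]_(dbar d))) ord0 ord0)%:E.
Proof.
rewrite gpath_fiber; apply: (prob_obs hX); first by rewrite grid0.
by move=> k _; exact: grid_le.
Qed.

Let wtE (c : 'cV[R]_(dbar d)) m (y : pathT m) :
  (filt M pi1 (fun _ _ => 1) (grid 0 t m) (pathv y) (2 ^ m) *m c) ord0 ord0 =
  @path_wt R J m y * (filt M pi1 (jfac R m) (grid 0 t m) (pathv y) (2 ^ m) *m c) ord0 ord0.
Proof. by rewrite (filt_jfac M pi1 m) -scalemxAl mxE path_wtE. Qed.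

Let one : 'cV[R]_(dbar d) := const_mx 1.

Let rowm (c : 'cV[R]_(dbar d)) m (y : pathT m) : R :=
  (filt M pi1 (jfac R m) (grid 0 t m) (pathv y) (2 ^ m) *m c) ord0 ord0.
Let obsm (c : 'cV[R]_(dbar d)) m (y : pathT m) : R :=
  (filt M pi1 (fun _ _ => 1) (grid 0 t m) (pathv y) (2 ^ m) *m c) ord0 ord0.

Lemma rowval_le w : 0 <= rowval target w <= rowval one w.
Proof.
exact: (@Num_le_Den _ _ _ P pathT G late_event (obsm target) (obsm one)
  (@path_wt R J) (rowm target) (rowm one) (rowval target) (rowval one)
  measurable_late_event
  measurable_gpath prob_late_event prob_gpath (@path_wt_gt0 R J)
  (wtE target) (wtE one) (@rowval_cvg target) (@rowval_cvg one) w).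
Qed.

Lemma rowval_ratio_ge0 w : 0 <= rowval target w / rowval one w.
Proof.
by have /andP[h1 h2] := rowval_le w; rewrite divr_ge0// (le_trans h1).
Qed.

Lemma prob_late_event_gpath m (S : pred (pathT m)) :
  P (late_event `&` G m @^-1` [set y | S y]) =
  (\int[P]_(w in G m @^-1` [set y | S y]) (rowval target w / rowval one w)%:E)%E.
Proof.
apply: (@integral_ratio _ _ _ P pathT G late_event (obsm target) (obsm one)
  (@path_wt R J) (rowm target) (rowm one) (rowval target) (rowval one)
  (J.+1%:R * expR J%:R)
  measurable_late_event measurable_gpath prob_late_event prob_gpath (@path_wt_gt0 R J)
  (@sum_path_wt R J) (wtE target) (wtE one) (@rowval_cvg target) (@rowval_cvg one)).
by move=> m' mm'; exact: gpath_refine.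
Qed.

End Final.

(** * Extension from a pi-system to the generated sigma-algebra *)

Section Uniqueness.
Context {R : realType} {dsp : measure_display} {Omega : measurableType dsp}.
Variable P : probability Omega R.

(** Dynkin's theorem: the sets satisfying the identity form a lambda-system. *)
Lemma sigma_algebra_prob_integral (A : set Omega) (f : Omega -> R) (Gs : set (set Omega)) :
  measurable A -> measurable_fun setT f -> (forall w, 0 <= f w) ->
  Gs `<=` measurable -> setI_closed Gs -> Gs setT ->
  (forall B, Gs B -> P (A `&` B) = (\int[P]_(w in B) (f w)%:E)%E) ->
  forall B, <<s Gs >> B -> measurable B /\ P (A `&` B) = (\int[P]_(w in B) (f w)%:E)%E.
Proof.
move=> mA mf f0 mGs GI GT GP B; rewrite -setI_closed_g_dynkin_g_sigma_algebra//.
pose D := [set B | measurable B /\ P (A `&` B) = (\int[P]_(w in B) (f w)%:E)%E].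
have mfE C : measurable C -> measurable_fun C (fun w => (f w)%:E).
  by move=> mC; apply: measurable_funTS; exact/measurable_EFinP.
have fE0 w : (0 <= (f w)%:E)%E by rewrite lee_fin.
move: B; apply: smallest_sub; last by move=> B GB; split; [exact: mGs|exact: GP].
split; first by split; [exact: measurableT|exact: GP].
- move=> B [mB eB]; split; first exact: measurableC.
  (* The passage to complements cancels this integral, which is finite because it equals a
     probability. *)
  have fin : (\int[P]_(w in B) (f w)%:E)%E \is a fin_num.
    by rewrite -eB fin_num_measure//; exact: measurableI.
  rewrite -[LHS](addeK _ fin) -[RHS](addeK _ fin); congr (_ - _)%E.
  rewrite addeC [RHS]addeC.
  rewrite -ge0_integral_setU ?setUv//; [|exact: measurableC|exact: mfE| ]; last first.
    by rewrite disj_set2E setICr.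
  rewrite -(GP _ GT) -eB -measureU.
  + by rewrite -setIUr setUv.
  + exact: measurableI.
  + by apply: measurableI => //; exact: measurableC.
  + by rewrite setIACA setICr setI0.
- move=> F tF DF; have mF k : measurable (F k) by case: (DF k).
  split; first exact: bigcupT_measurable.
  rewrite ge0_integral_bigcup//; last by apply: mfE; exact: bigcupT_measurable.
  rewrite setI_bigcupr measure_bigcup; first last.
  + by apply: trivIset_setIl.
  + by move=> k _; exact: measurableI.
  rewrite (eq_eseriesl (Q := xpredT)); last by move=> k; rewrite in_setT.
  by apply: eq_eseriesr => k _; case: (DF k).
Qed.

End Uniqueness.

Section Conclusion.
Context {R : realType} {dsp : measure_display} {Omega : measurableType dsp}.
Context {J : nat} {d : 'I_J.+1 -> nat}.
Variables (P : probability Omega R) (M : R -> 'M[R]_(dbar d)) (pi1 : 'rV[R]_(d ord0)).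
Variable X : R -> Omega -> state d.
Hypothesis hX : is_markov_jump P M pi1 X.
Hypothesis cM : mxcont M.
Variables (t s z : R) (je : state d).
Hypotheses (ht : 0 <= t) (hts : t <= s) (hz : 0 <= z).
Notation E := (Emx R d).
Notation Z v w := (Defs.Zp X v w).
Notation G := (gpath X t).
Notation njump := (njump hX ht).
Notation last_jump := (last_jump hX ht).
Notation filter_row := (filter_row hX ht).
Notation target := (target M t s z je).
Notation one := (const_mx 1 : 'cV[R]_(dbar d)).
Notation rowval := (rowval hX ht).

(** The factor t^n cancels: either n = 0, or some jump time in (0, t] makes t positive. *)
Lemma rowval_ratioE w : rowval target w / rowval one w =
  (filter_row w *m target) ord0 ord0 / (filter_row w *m one) ord0 ord0.
Proof.
have [Tc ct _] := njumpP hX ht w.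
have tn0 : t ^+ njump w != 0.
  rewrite expf_eq0 negb_and; move: Tc; case: (njump w) => [//|n] Tc.
  have [j0 _] := jumpT_isjump (Xright hX w) Tc.
  by rewrite gt_eqF ?orbT// (lt_le_trans j0).
by rewrite /rowval -mulf_div divff// mul1r.
Qed.

Lemma ptilde_njump w : ptilde M pi1 t s z (Shist X w (njump w)) je =
  if s - z <= last_jump w then 0 else rowval target w / rowval one w.
Proof.
rewrite rowval_ratioE /ptilde /alpha; cbv zeta; rewrite last_Shist.
rewrite -/(last_jump w) /=; case: ifP => // _.
rewrite /filter_row /target /hold_vec; cbv zeta.
by rewrite -[X in _ = _ / X]/((_ *m _) _ _) !mulmxA -(mulmxA _ _ one) TEmx_ones.
Qed.

(** At most one index satisfies the condition, and [njump w] does, so the partial sums are constant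
    once N exceeds it. *)
Lemma lim_ptilde w : limn (fun N => \sum_(n < N)
    (if ((jumpT X w n <= t%:E)%E && (t%:E < jumpT X w n.+1)%E)
     then ptilde M pi1 t s z (Shist X w n) je else 0)) =
  if s - z <= last_jump w then 0 else rowval target w / rowval one w.
Proof.
rewrite -ptilde_njump; apply: cvg_lim => //.
have [Tc ct tT] := njumpP hX ht w.
apply: cvg_near_cst; near=> N.
have nN : (njump w < N)%N by near: N; exact: nbhs_infty_gt.
have cur : (jumpT X w (njump w) <= t%:E < jumpT X w (njump w).+1)%E.
  by rewrite tT andbT Tc lee_fin.
rewrite (bigD1 (Ordinal nN))// big1 => [|n].
  by rewrite [LHS]addr0; exact: ifT cur.
move=> nn.
case: ifP => // /andP[h1 h2]; case/eqP: nn.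
have /andP[h3 h4] := cur.
by apply: ord_inj; exact: (jumpT_unique (Xright hX w) h1 h2 h3 h4).
Unshelve. all: by end_near. Qed.

(** The generators of [FZ X t] under a name, so that [Ot] makes Omega a measurable space with
    sigma-algebra F^Z(t). *)
Definition FZgen : set (set Omega) :=
  [set A | exists v k, 0 <= v <= t /\ A = [set w | Z v w = k]].
Notation Ot := (g_sigma_algebraType FZgen).

Lemma FZ_Z (v : R) k : 0 <= v <= t -> measurable ([set w | Z v w = k] : set Ot).
Proof. by move=> hv; apply: sub_sigma_algebra; exists v, k. Qed.

Lemma FZ_eq (a b : R) : 0 <= a <= t -> 0 <= b <= t ->
  measurable ([set w | Z a w = Z b w] : set Ot).
Proof.
move=> ha hb; rewrite (_ : [set _ | _] =
  \bigcup_(k in [set: 'I_J.+1]) ([set w | Z a w = k] `&` [set w | Z b w = k])).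
  apply: fin_bigcup_measurable => // k _.
  by apply: measurableI; exact: FZ_Z.
by apply/seteqP; split => w /= => [ab|[k _ [-> ->]]]//; exists (Z a w).
Qed.

Lemma FZ_gpath m y : measurable (G m @^-1` [set y] : set Ot).
Proof.
rewrite gpath_fiber (_ : obs _ _ _ _ =
  \bigcap_(k in [set k | (k <= 2 ^ m)%N]) [set w | Z (grid 0 t m k) w = pathv y k]).
  apply: bigcap_measurable => [|k /= km]; first by exists 0%N.
  by apply: FZ_Z; rewrite grid_ge// grid_le_last.
by apply/seteqP; split => w h k; exact: h.
Qed.

Lemma FZ_last_jump : measurable ([set w | last_jump w < s - z] : set Ot).
Proof.
have [tsz|szt] := ltP t (s - z).
  rewrite (_ : [set _ | _] = setT); first exact: measurableT.
  apply/seteqP; split => // w _ /=.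
  by have [_ ct _] := njumpP hX ht w; exact: le_lt_trans ct tsz.
pose a p : R := s - z - p.+1%:R^-1.
have at_ p : a p <= t by rewrite lerBlDr (le_trans szt)// lerDl invr_ge0.
rewrite (_ : [set _ | _] = \bigcup_(p in [set p | 0 <= a p])
  \bigcap_m \bigcap_(k in [set k | (k <= 2 ^ m)%N])
    [set w | Z (grid (a p) t m k) w = Z t w]).
  apply: bigcup_measurable => p /= ap; apply: bigcapT_measurable => m.
  apply: bigcap_measurable => [|k /= km]; first by exists 0%N.
  apply: FZ_eq; last by rewrite ht lexx.
  by rewrite (le_trans ap) ?grid_ge// grid_le_last.
have cg p w : 0 <= a p -> (forall v : R, a p <= v <= t -> Z v w = Z t w) <->
    (forall m k, (k <= 2 ^ m)%N -> Z (grid (a p) t m k) w = Z t w).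
  move=> ap; apply: (const_grid (Z := fun v => Z v w) ap (at_ p)).
  by move=> v v0; exact: (Xright hX w v0).
apply/seteqP; split => w /=.
  have [Tc ct tT] := njumpP hX ht w.
  move=> /(jumpT_lt_iff (Xright hX w) Tc ct tT szt)[p [p0 hp]].
  by exists p => // m _ k km; apply: (cg p w p0).1.
move=> [p /= p0 hp]; have [Tc ct tT] := njumpP hX ht w.
apply/(jumpT_lt_iff (Xright hX w) Tc ct tT szt); exists p; split => //.
by apply: (cg p w p0).2 => m k km; exact: hp.
Qed.

(** The approximating ratios are functions of grid observations in [0, t], so the limit is
    measurable for F^Z(t) and not merely for the ambient sigma-algebra. *)
Lemma FZ_ratio : measurable_fun [set: Ot] (fun w => rowval target w / rowval one w).
Proof.
have h := (@measurable_ratio _ Ot R (@pathT J) (fun m => G m)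
  (fun m y => (filt M pi1 (jfac R m) (grid 0 t m) (pathv y) (2 ^ m) *m target) ord0 ord0)
  (fun m y => (filt M pi1 (jfac R m) (grid 0 t m) (pathv y) (2 ^ m) *m one) ord0 ord0)
  (rowval target) (rowval one) FZ_gpath (fun w => @rowval_cvg _ _ _ _ _ _ _ _ _ hX cM _ ht target w)
  (fun w => @rowval_cvg _ _ _ _ _ _ _ _ _ hX cM _ ht one w) (rowval_le hX cM je ht hts hz)).
exact: h.
Qed.

Lemma FZ_measurable B : FZ X t B -> measurable B.
Proof.
apply: smallest_sub; first exact: sigma_algebra_measurable.
by move=> _ [v [k [/andP[v0 _] ->]]]; exact: (mZ hX).
Qed.

Definition pathgen : set (set Omega) :=
  [set B | exists (m : nat) (S : pred (@pathT J m)), B = G m @^-1` [set y | S y]].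

(** Events of two levels are both functions of the path on the finer grid. *)
Lemma pathgen_setI : setI_closed pathgen.
Proof.
move=> _ _ [m [S ->]] [m' [S' ->]].
have [rho hr] := @gpath_refine _ _ Omega _ _ X t _ _ (leq_maxl m m').
have [rho' hr'] := @gpath_refine _ _ Omega _ _ X t _ _ (leq_maxr m m').
exists (maxn m m'), (fun y => S (rho y) && S' (rho' y)).
by apply/seteqP; split => w /=; rewrite hr hr' => /andP.
Qed.

Lemma pathgen_setT : pathgen setT.
Proof. by exists 0%N, xpredT; apply/seteqP. Qed.

(** A non-dyadic v is reached from the right by its grid ceilings. Z at these points is eventually
    [Z v], so the generator is a limit inferior of grid events. *)
Lemma FZ_pathgen B : FZ X t B -> <<s pathgen >> B.
Proof.
apply: smallest_sub; first exact: smallest_sigma_algebra.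
move=> _ [v [k [hv ->]]].
have [i hi] := ex_is_ceil hv.
suff : measurable ([set w | Z v w = k] : set (g_sigma_algebraType pathgen)) by [].
rewrite (_ : [set _ | _] = \bigcup_n \bigcap_(m in [set m | (n <= m)%N])
   [set w | Z (grid 0 t m (i m)) w = k]).
  apply: bigcupT_measurable => n; apply: bigcap_measurable => [|m _].
    by exists n => /=.
  apply: sub_sigma_algebra; exists m, (fun y => pathv y (i m) == k).
  have [im _ _] := hi m.
  by apply/seteqP; split => w /=; rewrite pathv_gpath// => /eqP.
have ev w : \forall m \near \oo, Z (grid 0 t m (i m)) w = Z v w.
  have [eps eps0 he] := Xright hX w (andP hv).1.
  have /cvgrPdist_lt/(_ _ eps0) := is_ceil_cvg hv hi.
  apply: filterS => m hm; have [_ vi _] := hi m.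
  by apply: he; rewrite vi/= -ltrBlDl; rewrite distrC ger0_norm ?subr_ge0// in hm.
apply/seteqP; split => w /=.
  by move=> <-; have [n _ hn] := ev w; exists n.
move=> [n _ hn]; have [n' _ hn'] := ev w.
rewrite -(hn' (maxn n n')) /= ?leq_maxr//.
by apply: hn => /=; exact: leq_maxl.
Qed.

Lemma prob_late_event_FZ B : FZ X t B ->
  P (late_event X t s z je `&` B) =
  (\int[P]_(w in B) (rowval target w / rowval one w)%:E)%E.
Proof.
move=> /FZ_pathgen hB.
have mf : measurable_fun [set: Omega] (fun w => rowval target w / rowval one w).
  by move=> _ C mC; apply: FZ_measurable; exact: (FZ_ratio measurableT mC).
have mgen : pathgen `<=` measurable.
  move=> _ [m [S ->]]; apply: measurable_preimage_pred => y.
  exact: (measurable_gpath hX).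
have := sigma_algebra_prob_integral (measurable_late_event hX je ht hts hz) mf
  (rowval_ratio_ge0 hX cM je ht hts hz) mgen pathgen_setI pathgen_setT.
move=> /(_ P) h; apply: (h _ _ hB).2 => _ [m [S ->]].
exact: (prob_late_event_gpath hX cM je ht hts hz).
Qed.

Lemma dur_event_late w : dur_event X s z je w <->
  last_jump w < s - z /\ late_event X t s z je w.
Proof.
have [Tc ct tT] := njumpP hX ht w; rewrite /late_event; case: ifPn => [tsz|].
  by split => [h|[]//]; split => //; exact: le_lt_trans ct tsz.
rewrite -leNgt => szt; rewrite /dur_event /hold /=.
by rewrite (Udur_gt_split (Xright hX w) Tc ct tT hts hz szt ht); tauto.
Qed.

Lemma is_cond_prob_lim : is_cond_prob P (FZ X t) (dur_event X s z je)
  (fun w => if s - z <= last_jump w then 0 else rowval target w / rowval one w).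
Proof.
split=> [B mB|B FB].
  suff mY : measurable_fun [set: Ot]
      (fun w => if s - z <= last_jump w then 0 else rowval target w / rowval one w).
    by have := mY measurableT B mB; rewrite setTI.
  rewrite (_ : (fun w => _) = (fun w => rowval target w / rowval one w)
     \* \1_[set w | last_jump w < s - z]).
    by apply: measurable_funM; [exact: FZ_ratio|exact: measurable_indic FZ_last_jump].
  apply/funext => w /=; rewrite indicE; case: ifPn => h.
    by rewrite memNset ?mulr0//= ltNge h.
  by rewrite mem_set ?mulr1//= ltNge h.
(* H belongs to F^Z(t): intersecting it with B instead of with the event reduces the claim to
   [late_event], and on the other side it produces the zero branch of the integrand. *)
pose H := [set w | last_jump w < s - z].
have -> : dur_event X s z je `&` B = late_event X t s z je `&` (B `&` H).
  apply/seteqP; split => w /=; first by move=> [/dur_event_late[h1 h2] h3].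
  by move=> [h1 [h2 h3]]; split => //; apply/dur_event_late.
have FBH : FZ X t (B `&` H).
  by apply: (@measurableI _ Ot) => //; exact: FZ_last_jump.
rewrite prob_late_event_FZ// integral_mkcondr; apply: eq_integral => w _.
rewrite patchE; have [h|h] := leP (s - z) (last_jump w).
  by rewrite memNset//= /H/= ltNge h.
by rewrite mem_set.
Qed.

End Conclusion.

Unset Implicit Arguments. Set Strict Implicit. Set Printing Implicit Defensive.

Theorem theorem5p1 (R : realType) (dsp : measure_display)
  (Omega : measurableType dsp) (P : probability Omega R)
  (J : nat) (d : 'I_J.+1 -> nat) (hd : forall j, (0 < d j)%N)
  (M : R -> 'M[R]_(dbar d))
  (hMcont : forall i k : 'I_(dbar d), continuous (fun x : R => M x i k))
  (hMoff : forall x (i k : 'I_(dbar d)), i != k -> 0 <= M x i k)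
  (hMrow : forall x (i : 'I_(dbar d)), \sum_(k < dbar d) M x i k = 0)
  (pi1 : 'rV[R]_(d ord0))
  (hpi0 : forall l, 0 <= pi1 ord0 l) (hpi1 : \sum_(l < d ord0) pi1 ord0 l = 1)
  (X : R -> Omega -> state d) (hX : is_markov_jump P M pi1 X)
  (t s z : R) (je : state d) (ht : 0 <= t) (hts : t <= s) (hz : 0 <= z) :
  is_cond_prob P (FZ X t) [set w | X s w = je /\ z < Udur X s w]
    (fun w => limn (fun N => \sum_(n < N)
        (if ((jumpT X w n <= t%:E)%E && (t%:E < jumpT X w n.+1)%E)
         then ptilde M pi1 t s z (Shist X w n) je else 0)))
  /\
  (forall sn : seq (R * 'I_J.+1),
     let tn := (last (0, ord0) sn).1 in
     let yn := (last (0, ord0) sn).2 in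
     tn < s - z -> s - z <= t ->
     ptilde M pi1 t s z sn je =
       (yn == tag je)%:R *
       ((alpha M pi1 sn *m prodint (blkf M yn yn) tn s
           *m ((Emx R d yn)^T *m ev R je)) ord0 ord0)
       / ((alpha M pi1 sn *m prodint (blkf M yn yn) tn t *m (const_mx 1 : 'cV[R]_(d yn)))
            ord0 ord0)).
Proof.
have cM : mxcont M := hMcont.
split.
  rewrite (_ : (fun w => _) = (fun w => if s - z <= last_jump hX ht w then 0
    else rowval hX ht (target M t s z je) w / rowval hX ht (const_mx 1) w)).
    exact: is_cond_prob_lim.
  by apply/funext => w; exact: lim_ptilde.
move=> sn tn yn tnsz szt; rewrite /ptilde; cbv zeta.
rewrite -/tn -/yn leNgt tnsz/= (max_idPr szt) (prodint_refl cM) mulmx1; congr (_ / _).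
rewrite -/yn; move: (alpha _ _ _); rewrite -/yn => a.
have [eyj|yj] := eqVneq yn (tag je).
  (* With s - z <= t the middle factor is the identity; in the same block the product integrals over
     [tn, t] and [t, s] join into one. *)
  rewrite mul1r -(mulmxA _ _ (Emx R d (tag je))); move: a; rewrite eyj => a.
  rewrite mulTEmx mulmx1 -(mulmxA a) prodint_mul ?mulTEmx_ev//.
  exact: mxcont_blkf.
by rewrite mul0r -(mulmxA _ _ (Emx R d (tag je))) mulTEmx_neq// mulmx0 !mul0mx mxE.
Qed.
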